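(* Let $F$ be a finite bipartite graph. Then \[\rho(\omega\cdot F)=f\left(\min_{I}\frac{|N(I)|}{|I|}\right),\] where the minimum is over all non-empty independent sets $I$ of $F$. In particular, for all integers $1\leq a\leq b$, \[\rho(\omega\cdot K_{a,b})=f\left(\frac ab\right)=\frac{2\left(\frac ab\right)^2+3\left(\frac ab\right)+7+2\sqrt{\frac ab+1}}{4\left(\frac ab\right)^2+4\left(\frac ab\right)+9}.\]
   Context: Finite graphs are assumed to have at least one vertex. For a finite graph $F$, $\omega\cdot F$ denotes the disjoint union of a countably infinite number of copies of $F$. For a set $S$ of vertices of a graph, $N(S)=\left(\bigcup_{v\in S}N(v)\right)\setminus S$ is the set of vertices outside $S$ with a neighbor in $S$. $K_{a,b}$ is the complete bipartite graph with parts of sizes $a$ and $b$. Let $K_{\mathbb{N}}$ be the complete graph on the natural numbers $\mathbb{N}=\{1,2,\dots\}$, and $[n]=\{1,\dots,n\}$. For $S\subseteq\mathbb{N}$ the (upper) density is $\bar d(S)=\limsup_{n\to\infty}|S\cap[n]|/n$, and for a subgraph $H'\subseteq K_{\mathbb{N}}$ we set $\bar d(H')=\bar d(V(H'))$. For a countably infinite graph $H$ (vertex set of the same cardinality as $\mathbb{N}$), the Ramsey upper density $\rho(H)$ is the supremum of the values $\lambda$ for which, for every two-coloring of $E(K_{\mathbb{N}})$, there exists a monochromatic (not necessarily induced) subgraph $H'\subseteq K_{\mathbb{N}}$, isomorphic to $H$, with $\bar d(H')\geq\lambda$. Definition of $f:[0,+\infty]\to\mathbb{R}$. Let $\gamma\in(-1,1)$.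 For a continuous $g:[0,+\infty)\to\mathbb{R}$ let $\Gamma^+_\gamma(g,t)=\min\{x:\gamma x+g(x)\geq t\}$ and $\Gamma^-_\gamma(g,t)=\min\{x:\gamma x-g(x)\geq t\}$, the minimum of the empty set being $+\infty$. Let $h(\gamma)=\inf_g\limsup_{t\to\infty}\frac{\Gamma^+_\gamma(g,t)+\Gamma^-_\gamma(g,t)}{t}$, the infimum being over all 1-Lipschitz functions $g:[0,+\infty)\to\mathbb{R}$ with $g(0)=0$ (1-Lipschitz: $|g(x)-g(y)|\leq|x-y|$ for all $x,y$). For $\lambda\in(0,+\infty)$ set \[f(\lambda)=1-\frac{1}{\frac{2\lambda}{(1+\lambda)^2}h\left(\frac{\lambda-1}{\lambda+1}\right)+\frac{2\lambda}{1+\lambda}},\] and $f(0)=1$, $f(+\infty)=1/2$. *)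

(* Defs.v *)
(* MathComp-Analysis, over an arbitrary realType *)
From HB Require Import structures.
From mathcomp Require Import all_boot all_order all_algebra.
From mathcomp Require Import all_classical all_reals all_analysis.
From mathcomp Require Import ring lra.
Import Order.TTheory GRing.Theory Num.Theory.
Import numFieldNormedType.Exports.

Set Implicit Arguments.
Unset Strict Implicit.
Unset Printing Implicit Defensive.

Local Open Scope ring_scope.

Record graph := Graph {
  vertex :> Type;
  adj : vertex -> vertex -> Prop;
  adj_sym : forall u v, adj u v -> adj v u;
  adj_irr : forall v, ~ adj v v }.

(* Nonemptiness is not part of the structure. *)
Record fin_graph := FinGraph {
  fvertex :> finType;
  fadj : rel fvertex;
  fadj_sym : symmetric fadj;
  fadj_irr : irreflexive fadj }.

Section FiniteGraphs.
Variable F : fin_graph.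
Implicit Types S I A : {set F}.

Definition neighbors (v : F) : {set F} := [set w | fadj v w]%SET.

Definition neighborhood S : {set F} := ((\bigcup_(v in S) neighbors v) :\: S)%SET.

Definition independent I : bool :=
  [forall u in I, forall v in I, ~~ fadj u v].

Definition bipartite : Prop :=
  exists A, independent A /\ independent (~: A)%SET.

(* Singletons are independent, so for nonempty F the default value +oo of the
   iterated minimum is never attained. *)
Definition min_ratio (R : realType) : \bar R :=
  \big[Order.min/+oo%E]_(I : {set F} | (I != finset.set0) && independent I)
    (#|neighborhood I|%:R / #|I|%:R)%:E.

Definition omega_adj (p q : nat * F) : Prop := p.1 = q.1 /\ fadj p.2 q.2.

Lemma omega_adj_sym p q : omega_adj p q -> omega_adj q p.
Proof. by case=> pq1 pq2; split; rewrite // fadj_sym. Qed.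

Lemma omega_adj_irr p : ~ omega_adj p p.
Proof. by case=> _; rewrite fadj_irr. Qed.

Definition omega : graph := Graph omega_adj_sym omega_adj_irr.

End FiniteGraphs.

Section CompleteBipartite.
Variables a b : nat.

Definition Kbip_adj (u v : 'I_a + 'I_b) : bool :=
  match u, v with
  | inl _, inr _ | inr _, inl _ => true
  | _, _ => false
  end.

Lemma Kbip_adj_sym : symmetric Kbip_adj.
Proof. by case=> i [] j. Qed.

Lemma Kbip_adj_irr : irreflexive Kbip_adj.
Proof. by case. Qed.

Definition Kbip : fin_graph := FinGraph Kbip_adj_sym Kbip_adj_irr.

End CompleteBipartite.

Local Open Scope classical_set_scope.

(* A subgraph of the complete graph on {1, 2, ...} *)
Record subgraphKN := SubgraphKN {
  svertex : set nat;
  sadj : nat -> nat -> Prop;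
  svertex_pos : forall x, svertex x -> (0 < x)%N;
  sadj_vertex : forall x y, sadj x y -> svertex x /\ svertex y;
  sadj_sym : forall x y, sadj x y -> sadj y x;
  sadj_irr : forall x, ~ sadj x x }.

Definition isomorphic (H : graph) (H' : subgraphKN) : Prop :=
  exists phi : H -> nat, set_bij setT (svertex H') phi /\
    forall u v, adj u v <-> sadj H' (phi u) (phi v).

(* A two-coloring of the edges is given by a symmetric function; its values on
   the diagonal and at 0 are irrelevant. *)
Definition monochromatic (c : nat -> nat -> bool) (H' : subgraphKN) : Prop :=
  exists i : bool, forall x y, sadj H' x y -> c x y = i.

Section Density.
Variable R : realType.

Definition upper_density (S : set nat) : \bar R :=
  limn_esup (fun n => ((count (mem S) (iota 1 n))%:R / n%:R)%:E).

Definition ramsey_density (H : graph) : \bar R :=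
  ereal_sup [set l%:E | l in [set l : R |
    forall c : nat -> nat -> bool, symmetric c ->
    exists H' : subgraphKN, [/\ monochromatic c H', isomorphic H H'
      & (l%:E <= upper_density (svertex H'))%E]]].

End Density.

Section TheFunctionF.
Variable R : realType.
Implicit Types (gam t l : R) (g : R -> R).

Definition admissible g : Prop :=
  1.-lipschitz_[set x : R | 0 <= x] g /\ g 0 = 0.

Lemma affine_lip gam (F : R -> R) x y : `|gam| < 1 -> `|F x - F y| <= `|x - y| ->
  (gam * x + F x) - (gam * y + F y) <= 2 * `|x - y|.
Proof.
move=> g1 l1; rewrite (_ : _ - _ = gam * (x - y) + (F x - F y)); last by ring.
apply: (le_trans (ler_norm _)); apply: (le_trans (ler_normD _ _)).
rewrite mulrDl !mul1r lerD// normrM ler_piMl//; exact: ltW.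
Qed.

Lemma attained gam (F : R -> R) t : `|gam| < 1 -> 1.-lipschitz_[set x : R | 0 <= x] F ->
  let S := [set x : R | 0 <= x /\ t <= gam * x + F x] in
  S !=set0 -> exists2 m, S m & ereal_inf [set x%:E | x in S] = m%:E.
Proof.
move=> g1 Flip S S0.
have lbS : has_lbound S by exists 0 => x [].
have Sinf : has_inf S by [].
have m0 : 0 <= inf S by apply: lb_le_inf => // x [].
have Sm : S (inf S).
  split=> //; rewrite leNgt; apply/negP => ltF.
  set d := (t - (gam * inf S + F (inf S))) / 2.
  have d0 : 0 < d by rewrite divr_gt0// subr_gt0.
  have [x Sx xlt] := inf_adherent d0 Sinf.
  have mx : inf S <= x by apply: ge_inf.
  have := Flip (x, inf S) (conj Sx.1 m0); rewrite /= mul1r.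
  move=> /(affine_lip g1).
  rewrite ger0_norm ?subr_ge0// => h.
  have := Sx.2; move: xlt h; rewrite /d => xlt h h2; lra.
exists (inf S) => //; apply/eqP; rewrite eq_le; apply/andP; split.
  by apply: ereal_inf_lbound; exists (inf S).
by apply: le_ereal_inf_tmp => _ [x Sx <-]; rewrite lee_fin; apply: ge_inf.
Qed.

(* The minimum over x >= 0, which is attained for admissible g as soon as the
   set is nonempty (see Gamma_plus_min and Gamma_minus_min); ereal_inf set0 is +oo. *)
Definition Gamma_plus gam g t : \bar R :=
  ereal_inf [set x%:E | x in [set x : R | 0 <= x /\ t <= gam * x + g x]].

Definition Gamma_minus gam g t : \bar R :=
  ereal_inf [set x%:E | x in [set x : R | 0 <= x /\ t <= gam * x - g x]].

Lemma Gamma_plus_min gam g t : `|gam| < 1 -> admissible g ->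
  let S := [set x : R | 0 <= x /\ t <= gam * x + g x] in
  S !=set0 -> exists2 m, S m & Gamma_plus gam g t = m%:E.
Proof. by move=> g1 [glip _]; apply: attained. Qed.

Lemma Gamma_minus_min gam g t : `|gam| < 1 -> admissible g ->
  let S := [set x : R | 0 <= x /\ t <= gam * x - g x] in
  S !=set0 -> exists2 m, S m & Gamma_minus gam g t = m%:E.
Proof.
move=> g1 [glip _]; apply: (@attained gam (fun x => - g x)) => // -[x y] xy /=.
by rewrite /= -opprD normrN; apply: (glip (x, y)).
Qed.

Definition hfun gam : \bar R :=
  ereal_inf [set limf_esup
                   (fun t => (Gamma_plus gam g t + Gamma_minus gam g t)
                             * (t^-1)%:E)%E (pinfty_nbhs R)
            | g in admissible].

Lemma hfun_fin_num gam : `|gam| < 1 -> hfun gam \is a fin_num.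
Proof.
move=> g1; rewrite fin_real//; apply/andP; split.
  apply: (@lt_le_trans _ _ 0%E) => //; apply: le_ereal_inf_tmp => _ [g _ <-].
  apply: le_ereal_inf_tmp => _ [V [M [_ MV]] <-].
  pose t := Num.max M 0 + 1.
  have Vt : V t by apply: MV; rewrite /t ltr_pwDr// le_max lexx.
  apply: (@le_trans _ _ ((Gamma_plus gam g t + Gamma_minus gam g t)
                             * (t^-1)%:E)%E); last first.
    by apply: ereal_sup_ubound; exists t.
  apply: mule_ge0; last first.
    by rewrite lee_fin invr_ge0 /t addr_ge0 ?le_max ?lexx ?orbT.
  by apply: adde_ge0; apply: le_ereal_inf_tmp => _ [x [x0 _] <-]; rewrite lee_fin.
have [eps [eps0 eps1 epsg]] : exists e : R, [/\ 0 < e, e < 1 & `|gam| < e].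
  by exists ((1 + `|gam|) / 2); have := normr_ge0 gam; split; lra.
pose q := (1 + eps) / (1 - eps).
have q1 : 1 < q by rewrite /q ltr_pdivlMr; lra.
have q0 : 0 < q by lra.
have qe : q * (1 - eps) = 1 + eps by rewrite /q divfK//; apply/eqP; lra.
pose p o : R := if o is Some n then q ^+ n else 0.
pose y o : R := if o is Some n then (-1) ^+ n * (eps * q ^+ n) else 0.
have qn0 n : 0 < q ^+ n by rewrite exprn_gt0.
have p0 o : 0 <= p o by case: o => //= n; exact: ltW.
have ny o : `|y o| = eps * p o.
  case: o => [n|]; rewrite /= ?normr0 ?mulr0//.
  by rewrite normrM normrX normrN1 expr1n mul1r gtr0_norm// mulr_gt0.
have compat0 n m : (n < m)%N -> eps * q ^+ m + eps * q ^+ n <= q ^+ m - q ^+ n.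
  move=> nm; have : q ^+ n.+1 <= q ^+ m by rewrite ler_weXn2l// ltW.
  have : q ^+ n * (q * (1 - eps)) = q ^+ n * (1 + eps) by rewrite qe.
  rewrite exprS => h1 h2.
  have : (1 - eps) * (q * q ^+ n) <= (1 - eps) * q ^+ m.
    by rewrite ler_wpM2l//; lra.
  by move: h1; lra.
have compat o o' : y o - y o' <= `|p o - p o'|.
  have : y o - y o' <= `|y o| + `|y o'|.
    by rewrite (le_trans (ler_norm _))// ler_normB.
  have [->|oo] := eqVneq o o'; first by rewrite !subrr normr0.
  move=> /le_trans; apply; rewrite !ny.
  case: o o' oo => [n|] [m|] //= nm.
  - have [mn|mn|mn] := ltngtP m n.
    + by rewrite (le_trans (compat0 _ _ mn))// ler_norm.
    + by rewrite distrC addrC (le_trans (compat0 _ _ mn))// ler_norm.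
    + by rewrite mn eqxx in nm.
  - by rewrite mulr0 addr0 subr0 gtr0_norm//; have := qn0 n; nra.
  - by rewrite mulr0 add0r sub0r normrN gtr0_norm//; have := qn0 m; nra.
pose A x := [set y o + `|x - p o| | o in setT].
have Ane x : A x !=set0 by exists (y None + `|x - p None|); exists None.
have Alb x : has_lbound (A x).
  exists (y None - `|x - p None|) => _ [i _ <-].
  have := compat None i.
  have := ler_distD x (p None) (p i).
  by rewrite (distrC (p None) x); lra.
pose g x := inf (A x).
have glb x z : (forall o, z <= y o + `|x - p o|) -> z <= g x.
  by move=> h; apply: lb_le_inf => // _ [i _ <-].
have gub x o : g x <= y o + `|x - p o|.
  by apply: ge_inf => //; exists o.
have gp o : g (p o) = y o.
  apply/eqP; rewrite eq_le; apply/andP; split.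
    by rewrite (le_trans (gub _ o))// subrr normr0 addr0.
  by apply: glb => o'; rewrite -lerBlDl.
have glip x z : g x - g z <= `|x - z|.
  rewrite lerBlDr -lerBlDl; apply: glb => o.
  have := gub x o; have := ler_distD z x (p o); lra.
have adm : admissible g.
  split; last by have := gp None.
  move=> [x z] _ /=; rewrite mul1r ler_norml glip andbT lerNl opprB distrC.
  exact: glip.
pose C := q ^+ 4 / (eps - `|gam|).
have eg0 : 0 < eps - `|gam| by rewrite subr_gt0.
have bnd t (b : bool) : 1 <= t -> exists n, odd n = b /\
    t <= (eps - `|gam|) * q ^+ n /\ q ^+ n <= C * t.
  move=> t1.
  have [N hN] : exists N, t / (eps - `|gam|) <= q ^+ N.
    exists (Num.bound ((t / (eps - `|gam|)) / (q - 1))).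
    set u := t / (eps - `|gam|).
    have u0 : 0 <= u by apply: divr_ge0; lra.
    set N := Num.bound _.
    have : u / (q - 1) < N%:R.
      by apply: archi_boundP; apply: divr_ge0 => //; lra.
    rewrite ltr_pdivrMr; last by lra.
    move=> uN; apply: (le_trans (ltW uN)).
    have : N%:R * (q - 1) + 1 <= q ^+ N.
      elim: N {uN} => [|k IH]; first by rewrite mul0r add0r expr0.
      rewrite exprS -natr1.
      have : 0 <= k%:R * ((q - 1) * (q - 1)).
        by rewrite mulr_ge0// mulr_ge0//; lra.
      have : q * (k%:R * (q - 1) + 1) <= q * q ^+ k by rewrite ler_pM2l.
      by move: IH => _; lra.
    by lra.
  have ex : exists N, t / (eps - `|gam|) <= q ^+ N by exists N.
  case: (ex_minnP ex) => m hm mmin.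
  have qm : q ^+ m <= q ^+ 1 * (t / (eps - `|gam|)) * q.
    case: m hm mmin => [|m] hm mmin.
      rewrite expr0 expr1.
      have : 1 <= t / (eps - `|gam|) by rewrite ler_pdivlMr//; have := normr_ge0 gam; lra.
      by move=> h; nra.
    have : q ^+ m < t / (eps - `|gam|).
      by rewrite ltNge; apply/negP => /mmin; rewrite ltnn.
    rewrite exprS expr1 => h.
    have : 0 <= t / (eps - `|gam|) by apply: divr_ge0; lra.
    rewrite -mulrA ler_pM2l// => u0.
    by apply: (le_trans (ltW h)); rewrite ler_peMr// ltW.
  have tm : t <= (eps - `|gam|) * q ^+ m by move: hm; rewrite ler_pdivrMr// mulrC.
  have mC : q ^+ m * q <= C * t.
    move: qm; rewrite /C expr1 => qm.
    rewrite mulrAC -mulrA; set u := t / _ in qm *.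
    have u0 : 0 <= u by apply: divr_ge0; lra.
    have : q ^+ m * q <= q * u * q * q by rewrite ler_wpM2r// ltW.
    move=> h1; apply: (le_trans h1).
    rewrite (_ : q ^+ 4 * u = q * u * q * q * q); last by ring.
    have z0 : 0 <= q * u * q * q := mulr_ge0 (mulr_ge0 (mulr_ge0 (ltW q0) u0) (ltW q0)) (ltW q0).
    by rewrite ler_peMr// ltW.
  have [mb|mb] := eqVneq (odd m) b.
    exists m; split=> //; split => //; apply: (le_trans _ mC).
    by rewrite ler_peMr// ltW.
  exists m.+1; split; first by rewrite /=; case: (odd m) b mb => [] [].
  split; last by rewrite exprSr.
  by apply: (le_trans tm); rewrite ler_pM2l// exprS ler_peMl// ltW.
have gamb n : - (`|gam| * q ^+ n) <= gam * q ^+ n.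
  by rewrite -mulNr ler_pM2r// lerNl -normrN ler_norm.
have Gp t : 1 <= t -> (Gamma_plus gam g t <= (C * t)%:E)%E.
  move=> t1; have [n [no [tn nC]]] := bnd t false t1.
  apply: (@le_trans _ _ (q ^+ n)%:E); last by rewrite lee_fin.
  apply: ereal_inf_lbound; exists (q ^+ n) => //; split; first exact: ltW.
  have -> : g (q ^+ n) = eps * q ^+ n.
    by have := gp (Some n); rewrite /= => ->; rewrite -signr_odd no expr0 mul1r.
  have := gamb n; lra.
have Gm t : 1 <= t -> (Gamma_minus gam g t <= (C * t)%:E)%E.
  move=> t1; have [n [no [tn nC]]] := bnd t true t1.
  apply: (@le_trans _ _ (q ^+ n)%:E); last by rewrite lee_fin.
  apply: ereal_inf_lbound; exists (q ^+ n) => //; split; first exact: ltW.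
  have -> : g (q ^+ n) = - (eps * q ^+ n).
    by have := gp (Some n); rewrite /= => ->; rewrite -signr_odd no expr1 mulN1r.
  have := gamb n; lra.
apply: (@le_lt_trans _ _ (C + C)%:E); last exact: ltry.
apply: (@le_trans _ _ (limf_esup
   (fun t => (Gamma_plus gam g t + Gamma_minus gam g t) * (t^-1)%:E)%E
   (pinfty_nbhs R))).
  by apply: ereal_inf_lbound; exists g.
apply: (@le_trans _ _ (ereal_sup [set ((Gamma_plus gam g t + Gamma_minus gam g t)
      * (t^-1)%:E)%E | t in [set t | 1 < t]])).
  by apply: ereal_inf_lbound; exists [set t | 1 < t] => //; exists 1.
apply: ge_ereal_sup => _ [t /= t1 <-].
have t0 : 0 < t by lra.
apply: (@le_trans _ _ ((C * t + C * t)%:E * (t^-1)%:E)%E).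
  apply: lee_wpmul2r; first by rewrite lee_fin invr_ge0 ltW.
  by rewrite EFinD; apply: leeD; [apply: Gp|apply: Gm]; exact: ltW.
by rewrite -EFinM lee_fin -mulrDl mulfK// gt_eqF.
Qed.

(* Here (l - 1) / (l + 1) lies in ]-1, 1[ for l > 0, so hfun is finite there by
   hfun_fin_num. Only the values on [0, +oo] are meaningful. *)
Definition ramsey_f (l : \bar R) : R :=
  match l with
  | l%:E => if l == 0 then 1 else
      1 - (2 * l / (1 + l) ^+ 2 * fine (hfun ((l - 1) / (l + 1)))
           + 2 * l / (1 + l))^-1
  | +oo%E => 1 / 2
  | -oo%E => 0
  end.

End TheFunctionF.

(* Main.v *)
Require Import Defs.
From HB Require Import structures.
From mathcomp Require Import all_boot all_order all_algebra.
From mathcomp Require Import all_classical all_reals all_analysis.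
From mathcomp Require Import ring lra zify.
Import Order.TTheory GRing.Theory Num.Theory.
Import numFieldNormedType.Exports.
Set Implicit Arguments.
Unset Strict Implicit.
Unset Printing Implicit Defensive.
Local Open Scope ring_scope.

(** Let lam be the least ratio |N(I)|/|I|.  If lam = 0, then F has an isolated
    vertex, which can be placed anywhere, so copies of F can be made to absorb
    every vertex and the density is 1.  Suppose lam > 0 and write D for the
    number [walk_rate] with f(lam) = 1 - 1/D.

    D as a problem on walks.  A 1-Lipschitz function g with g(0) = 0 is a
    monotone walk in the quadrant: at time x it is at the point (b, r) with
    b + r = x and b - r = g(x).  For gamma = (lam-1)/(lam+1), the condition
    gamma x + g(x) >= t says b - r/lam >= u, and gamma x - g(x) >= t says
    r - b/lam >= u, where t = 2 lam u/(1+lam).  If (b, r) and (b', r') are the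
    first points of the walk that satisfy them, then D is the infimum over all
    walks of limsup (b + r')/u.  From a walk one reads off the offsets
    al(u) = r/lam and si(u) = b'/lam, which determine the two points up to
    inequalities and satisfy a dichotomy because the walk is monotone
    ([offsets]).  Conversely, any two families of points such that b <= b' or
    r' <= r for each point of the first and each point of the second family are
    separated by a walk, and so bound D from above ([walk_rate_le]).

    Upper bound ([upper_coloring]).  Take the offsets of a nearly optimal walk
    and enumerate blue and red vertices so that, by time s, about s + al(s) blue
    and s + si(s) red ones have appeared.  Edges within a class take its
    color, and an edge between a red vertex of time s' and a blue one of time s
    is red when s' + si(s') <= lam al(s).  In a red copy of omega F, the blue
    vertices of time at most s form independent sets whose neighborhoods lie
    among at most lam al(s) red vertices, so that at most al(s) of them are
    covered, and about s of them are not.  The same holds with the colors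
    exchanged, and at time s there are at most D s vertices up to a small error.

    Lower bound ([lower_bound]).  Given a coloring, an ultrafilter colors each
    vertex so that finitely many vertices of color i have infinitely many common
    neighbors in color i ([ultrafilter_colors]).  Hence every vertex of color i
    lies in monochromatic copies of F whose other vertices are arbitrarily
    large, and p = |I| vertices of the other color are covered whenever they form
    a complete bipartite graph in color i with q = |N(I)| vertices of color i
    ([complete_copy]).  So [1, n] can be covered well in color i if
    many disjoint such K_{p,q} exist.  If this fails for all large n in both
    colors, an approximate form of Konig's theorem for tilings by K_{p,q}
    ([approx_konig]) gives a set X of vertices of the other color and a set Y of
    vertices of color i with |X| - |Y|/lam too large, such that almost all edges
    from X to the vertices of color i outside Y avoid color i.
    Comparing these sets for the two colors, an edge between them would have to
    avoid both colors; this is the dichotomy needed to separate the points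
    (|X|, |Y|) by a walk ([sparse_dichotomy]), whose rate would be less than D.

    Closed form ([walk_rateE]).  For lam <= 1 the best walk is a zigzag with
    corners at the powers of k = 1/(sqrt(1+lam) - 1), which gives
    D <= 2 + k^2.  For the converse, following the alternation of the two
    offsets of a walk of smaller rate yields levels at which the ratio of the
    larger to the smaller offset decreases by a fixed amount forever. *)

(** * Matchings and vertex covers of bipartite graphs *)

Section Konig.
Local Open Scope nat_scope.
Local Open Scope set_scope.
Variables P Q : finType.
Implicit Types (E M : {set P * Q}) (U : {set P}) (V : {set Q}).

Definition vertex_cover E U V := [forall e in E, (e.1 \in U) || (e.2 \in V)].

Definition matching M := forall e f, e \in M -> f \in M ->
  e.1 = f.1 \/ e.2 = f.2 -> e = f.

(** Delete edges as long as the cover number stays at least k.  In the remaining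
    graph each edge is critical, and critical edges are pairwise disjoint:
    if two of them met in a vertex v, covers of the two edge-deleted graphs
    of size less than k could be uncrossed into two covers of the whole graph,
    of total size less than 2k, by adding v on its side, taking unions on
    one side and intersections on the other. *)
Lemma konig E k :
  (forall U V, vertex_cover E U V -> k <= #|U| + #|V|) ->
  exists M, [/\ M \subset E, matching M & k <= #|M|].
Proof.
have [n] := ubnP #|E|; elim: n E => // n IH E En Ek.
have [/exists_inP[e eE /forallP h]|] :=
  boolP [exists e in E, [forall U, forall V,
           vertex_cover (E :\ e) U V ==> (k <= #|U| + #|V|)]].
  have [||M [ME mM kM]] := IH (E :\ e).
  - by move: En; rewrite (cardsD1 e E) eE.
  - by move=> U V c; move/forallP/(_ V)/implyP: (h U); apply.
  by exists M; split=> //; apply: (fintype.subset_trans ME); apply: subD1set.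
rewrite negb_exists_in => /forall_inP crit.
have {}crit e : e \in E -> exists U V, [/\ e.1 \notin U, e.2 \notin V,
    #|U| + #|V| < k & forall f, f \in E -> f != e -> (f.1 \in U) || (f.2 \in V)].
  move=> eE; have := crit e eE; rewrite negb_forall => /existsP[U].
  rewrite negb_forall => /existsP[V]; rewrite negb_imply -ltnNge => /andP[c lk].
  have c' f : f \in E -> f != e -> (f.1 \in U) || (f.2 \in V).
    by move=> fE fe; apply: (forall_inP c); rewrite !inE fe.
  suff /norP[eU eV] : ~~ ((e.1 \in U) || (e.2 \in V)) by exists U, V.
  apply/negP => cUV; move: lk; rewrite ltnNge Ek//.
  by apply/forall_inP => f fE; have [->|] := eqVneq f e; last exact: c'.
(* A matching is covered by the left ends of its edges. *)
exists E; split=> //; last first.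
  rewrite (leq_trans _ (leq_imset_card (fun e => e.1) E))//.
  have := Ek [set e.1 | e in E] finset.set0; rewrite cards0 addn0; apply.
  by apply/forall_inP => e eE; rewrite imset_f.
move=> e f eE fE ef; apply/eqP/negP => /negP nef.
have [U1 [V1 [eU1 eV1 k1 c1]]] := crit _ eE.
have [U2 [V2 [fU2 fV2 k2 c2]]] := crit _ fE.
have cUI := cardsUI U1 U2; have cVI := cardsUI V1 V2.
case: ef => ef.
- have h1 : k <= #|e.1 |: (U1 :|: U2)| + #|V1 :&: V2|.
    apply: Ek; apply/forall_inP => d dE; rewrite !inE.
    have [->|de] := eqVneq d e; first by rewrite eqxx.
    have [->|df] := eqVneq d f; first by rewrite ef eqxx.
    have := c1 d dE de; have := c2 d dE df.
    by case: (d.1 \in U1); case: (d.1 \in U2); case: (d.2 \in V1); case: (d.2 \in V2); rewrite ?orbT.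
  have h2 : k <= #|U1 :&: U2| + #|V1 :|: V2|.
    apply: Ek; apply/forall_inP => d dE; rewrite !inE.
    have [->|de] := eqVneq d e.
      by have := c2 e eE nef; rewrite ef (negPf fU2) /= => ->; rewrite !orbT.
    have [->|df] := eqVneq d f.
      by have := c1 f fE; rewrite eq_sym nef -ef (negPf eU1) /= => ->; rewrite ?orbT.
    have := c1 d dE de; have := c2 d dE df.
    by case: (d.1 \in U1); case: (d.1 \in U2); case: (d.2 \in V1); case: (d.2 \in V2); rewrite ?orbT.
  have := cardsU1 e.1 (U1 :|: U2); case: (e.1 \notin _) => /=; lia.
- have h1 : k <= #|U1 :&: U2| + #|e.2 |: (V1 :|: V2)|.
    apply: Ek; apply/forall_inP => d dE; rewrite !inE.
    have [->|de] := eqVneq d e; first by rewrite eqxx orbT.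
    have [->|df] := eqVneq d f; first by rewrite ef eqxx orbT.
    have := c1 d dE de; have := c2 d dE df.
    by case: (d.1 \in U1); case: (d.1 \in U2); case: (d.2 \in V1); case: (d.2 \in V2); rewrite ?orbT.
  have h2 : k <= #|U1 :|: U2| + #|V1 :&: V2|.
    apply: Ek; apply/forall_inP => d dE; rewrite !inE.
    have [->|de] := eqVneq d e.
      by have := c2 e eE nef; rewrite ef (negPf fV2) orbF => ->; rewrite !orbT.
    have [->|df] := eqVneq d f.
      by have := c1 f fE; rewrite eq_sym nef -ef (negPf eV1) orbF => ->.
    have := c1 d dE de; have := c2 d dE df.
    by case: (d.1 \in U1); case: (d.1 \in U2); case: (d.2 \in V1); case: (d.2 \in V2); rewrite ?orbT.
  have := cardsU1 e.2 (V1 :|: V2); case: (e.2 \notin _) => /=; lia.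
Qed.

End Konig.

(** * Complete bipartite blocks in dense bipartite graphs *)

Section Blocks.
Local Open Scope nat_scope.
Local Open Scope set_scope.

Definition edges (T : finType) (e : rel T) (A B : {set T}) :=
  \sum_(x in A) \sum_(y in B) (e x y : nat).

Definition complete (T : finType) (e : rel T) (A B : {set T}) :=
  forall x y, x \in A -> y \in B -> e x y.

Lemma exists_subset (T : finType) (A : {set T}) n :
  n <= #|A| -> exists2 B : {set T}, B \subset A & #|B| = n.
Proof.
move=> nA; exists [set x in take n (enum A)].
  by apply/fintype.subsetP => x; rewrite inE => /mem_take; rewrite mem_enum.
rewrite cardsE; have /card_uniqP -> : uniq (take n (enum A)).
  by rewrite take_uniq// enum_uniq.
by rewrite size_takel// -cardE.
Qed.

Lemma chunks (T : finType) (A : {set T}) a m : m * a <= #|A| ->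
  exists X : 'I_m -> {set T}, [/\ forall i, X i \subset A,
    forall i, #|X i| = a & forall i j, i != j -> [disjoint X i & X j]].
Proof.
elim: m A => [|m IH] A mA; first by exists (fun=> A); split=> -[].
have [|B BA Ba] := @exists_subset T A a.
  by rewrite (leq_trans _ mA)// leq_pmull.
have [|X [XA Xa Xd]] := IH (A :\: B).
  by rewrite cardsD (finset.setIidPr BA) Ba; move: mA; rewrite mulSn; lia.
have XB j : [disjoint B & X j].
  rewrite disjoint_sym finset.disjoints_subset.
  by apply: (fintype.subset_trans (XA j)); rewrite finset.setDE finset.subsetIr.
exists (fun i => if unlift ord0 i is Some j then X j else B); split.
- move=> i; case: unlift => [j|//].
  exact: (fintype.subset_trans (XA j) (finset.subsetDl _ _)).
- by move=> i; case: unlift.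
- move=> i j; case: unliftP => [i'|] ->; case: unliftP => [j'|] ->.
  + by move=> ij; apply: Xd; apply: contra ij => /eqP ->.
  + by move=> _; rewrite disjoint_sym.
  + by [].
  + by rewrite eqxx.
Qed.

(** Many vertices of B have degree at least |A|/E; keep D = 2 E b of them.
    At least |A|/(2E) vertices of A have b neighbors among these D, and by
    the pigeonhole principle many of them have the same set of neighbors there.
    The bound N depends on neither the graph nor the sets. *)
Lemma dense_block a b E : 0 < b -> exists N, forall (T : finType) (e : rel T)
    (A B : {set T}), N <= #|A| -> N <= #|B| ->
    2 * (#|A| * #|B|) <= E * edges e A B ->
  exists A0 B0 : {set T}, [/\ A0 \subset A, B0 \subset B,
    #|A0| = a, #|B0| = b & complete e A0 B0].
Proof.
move=> b0; pose D := 2 * E * b.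
exists (2 * E * (a.+1 * 2 ^ D) + E * D + 1) => T e A B NA NB dens.
have E0 : 0 < E by rewrite lt0n; apply/eqP => E0; move: dens; rewrite E0 mul0n; nia.
pose deg y := \sum_(x in A) (e x y : nat).
pose B1 := [set y in B | #|A| <= E * deg y].
have degA y : deg y <= #|A|.
  by rewrite -sum1_card; apply: leq_sum => x _; case: (e x y).
have BB1 : #|B| <= E * #|B1|.
  have : E * edges e A B <= E * (#|B1| * #|A|) + #|B| * #|A|.
    rewrite /edges exchange_big /= big_distrr /= (bigID (mem B1)) /=.
    apply: leq_add.
      rewrite -sum_nat_const -big_distrr /= leq_mul2l; apply/orP; right.
      rewrite [leqRHS](_ : _ = \sum_(y in B | y \in B1) #|A|).
        by apply: leq_sum => y _; apply: degA.
      apply: eq_bigl => y; rewrite !inE.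
      by case: (y \in B).
    rewrite -sum_nat_const [leqRHS](bigID (mem B1)) /=.
    rewrite (leq_trans _ (leq_addl _ _))//; apply: leq_sum => y.
    by rewrite !inE => /andP[-> /=]; rewrite -ltnNge => /ltnW.
  have : 0 < #|A| by lia.
  nia.
have [|Q1 Q1B Q1D] := @exists_subset T B1 D.
  have : E * D <= E * #|B1| by lia.
  by rewrite leq_mul2l; case/orP => // /eqP E00; move: E0; rewrite E00.
have e1 : D * #|A| <= E * edges e A Q1.
  rewrite /edges exchange_big /= big_distrr /= -Q1D -sum_nat_const.
  apply: leq_sum => y /(fintype.subsetP Q1B); rewrite inE => /andP[_]//.
pose tr x := [set y in Q1 | e x y].
have trE x : \sum_(y in Q1) (e x y : nat) = #|tr x|.
  rewrite -sum1_card big_mkcond [RHS]big_mkcond /=.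
  by apply: eq_bigr => y _; rewrite !inE; case: (y \in Q1); case: (e x y).
pose P1 := [set x in A | b <= #|tr x|].
have trD x : #|tr x| <= D.
  by rewrite -Q1D; apply: subset_leq_card; apply/fintype.subsetP => y; rewrite inE => /andP[].
have P1A : #|A| <= 2 * E * #|P1|.
  have : edges e A Q1 <= #|P1| * D + #|A| * b.
    rewrite /edges (bigID (mem P1)) /=; apply: leq_add.
      rewrite -sum_nat_const [leqRHS](_ : _ = \sum_(x in A | x \in P1) D).
        by apply: leq_sum => x _; rewrite trE.
      by apply: eq_bigl => x; rewrite !inE; case: (x \in A).
    rewrite -sum_nat_const [leqRHS](bigID (mem P1)) /=.
    rewrite (leq_trans _ (leq_addl _ _))//; apply: leq_sum => x.
    by rewrite !inE trE => /andP[-> /=]; rewrite -ltnNge => /ltnW.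
  move: e1; rewrite /D => e1 e2.
  have : (E * b) * #|A| <= (E * b) * (2 * E * #|P1|) by nia.
  by rewrite leq_mul2l; case/orP => // /eqP; nia.
have [Z ZQ Za] : exists2 Z, Z \in powerset Q1 &
    a < #|[set x in P1 | tr x == Z]|.
  apply/exists_inP; apply: contraT; rewrite negb_exists_in => /forall_inP h.
  have : #|P1| <= 2 ^ D * a.
    rewrite -[X in X <= _]sum1_card (partition_big tr (mem (powerset Q1))) /=.
      rewrite -Q1D -card_powerset -sum_nat_const; apply: leq_sum => Z ZQ.
      have := h Z ZQ; rewrite -leqNgt; apply: leq_trans.
      by rewrite -sum1_card; apply: eq_leq; apply: eq_bigl => x; rewrite [in RHS]inE.
    move=> x _; rewrite powersetE; apply/fintype.subsetP => y.
    by rewrite inE => /andP[].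
  move=> h1.
  have h2 : 2 * E * #|P1| <= 2 * E * (2 ^ D * a) by rewrite leq_mul2l h1 orbT.
  have : 2 * E * (2 ^ D * a) <= 2 * E * (a.+1 * 2 ^ D).
    by rewrite leq_mul2l (mulnC (2 ^ D)) leq_mul2r leqnSn !orbT.
  lia.
have [x xZ] : exists x, x \in [set x in P1 | tr x == Z].
  by apply/finset.set0Pn; rewrite -card_gt0 (leq_ltn_trans _ Za).
have [B0 B0Z B0b] : exists2 B0 : {set T}, B0 \subset Z & #|B0| = b.
  by apply: exists_subset; move: xZ; rewrite !inE => /andP[/andP[_ ?] /eqP <-].
have [A0 A0P A0a] := exists_subset (ltnW Za).
exists A0, B0; split=> //.
- by apply/fintype.subsetP => y /(fintype.subsetP A0P); rewrite !inE => /andP[/andP[->]].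
- apply: (fintype.subset_trans B0Z); move: ZQ; rewrite powersetE => ZQ.
  apply: (fintype.subset_trans ZQ); apply: (fintype.subset_trans Q1B).
  by apply/fintype.subsetP => y; rewrite inE => /andP[].
- move=> u v /(fintype.subsetP A0P); rewrite !inE => /andP[_ /eqP Zu].
  by move/(fintype.subsetP B0Z); rewrite -Zu inE => /andP[].
Qed.

End Blocks.

(** * A min-max theorem for tilings by complete bipartite graphs *)

Section Stage.
Local Open Scope nat_scope.
Local Open Scope set_scope.

Lemma edges_leq (T : finType) (e : rel T) A B : edges e A B <= #|A| * #|B|.
Proof.
rewrite -sum_nat_const; apply: leq_sum => x _.
by rewrite -sum1_card; apply: leq_sum => y _; case: (e x y).
Qed.

(** Removing a small part of either side of a pair loses few edges. *)
Lemma edges_setD (T : finType) (e : rel T) (A B A1 B1 : {set T}) :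
  edges e A B <= edges e (A :\: A1) (B :\: B1) + #|A1| * #|B| + #|A| * #|B1|.
Proof.
have -> : edges e A B = edges e (A :&: A1) B + edges e (A :\: A1) B.
  exact: big_setID.
have -> : edges e (A :\: A1) B =
    edges e (A :\: A1) (B :&: B1) + edges e (A :\: A1) (B :\: B1).
  by rewrite /edges -big_split; apply: eq_bigr => x _; apply: big_setID.
have h1 := edges_leq e (A :&: A1) B.
have h2 := edges_leq e (A :\: A1) (B :&: B1).
have h3 : #|A :&: A1| * #|B| <= #|A1| * #|B|.
  by rewrite leq_mul2r subset_leq_card ?orbT// finset.subsetIr.
have h4 : #|A :\: A1| * #|B :&: B1| <= #|A| * #|B1|.
  by apply: leq_mul; apply: subset_leq_card; rewrite ?finset.subsetDl ?finset.subsetIr.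
lia.
Qed.

Lemma card_bigcup_const (T I : finType) (X : I -> {set T}) a :
  (forall i, #|X i| = a) -> #|\bigcup_i X i| <= #|I| * a.
Proof.
move=> Xa; have : #|\bigcup_i X i| <= \sum_i #|X i|.
  elim/big_rec2: _ => [|i n A _ An]; first by rewrite cards0.
  by have := cardsUI (X i) A; lia.
by rewrite (eq_bigr (fun=> a)) ?sum_nat_const.
Qed.

Lemma sum_bigcup (T I : finType) (X : I -> {set T}) (W : {set I}) (h : T -> nat) :
  (forall i j, i != j -> [disjoint X i & X j]) ->
  \sum_(x in \bigcup_(i in W) X i) h x = \sum_(i in W) \sum_(x in X i) h x.
Proof.
move=> Xd; have -> : \bigcup_(i in W) X i =
    \bigcup_i (if i \in W then X i else finset.set0) by rewrite big_mkcond.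
rewrite partition_disjoint_bigcup.
  by rewrite [RHS]big_mkcond; apply: eq_bigr => i _; case: ifP => // _; rewrite big_set0.
move=> i j /Xd ij; case: (i \in W); case: (j \in W) => //;
  by rewrite -finset.setI_eq0 ?finset.setI0 ?finset.set0I.
Qed.

(** Remove blocks greedily: as long as they fill at most a 1/E part of each side,
    half of the edges remain, so the density is still at least 2/E. *)
Lemma dense_blocks p q s E : 0 < p -> 0 < q -> 0 < s -> 1 < E ->
  exists K, forall k, K <= k -> forall (T : finType) (e : rel T) (A B : {set T}),
    #|A| = E * (k * (p * s)) -> #|B| = E * (k * (q * s)) ->
    4 * (#|A| * #|B|) <= E * edges e A B ->
  exists X Y : 'I_k -> {set T}, [/\ forall i, X i \subset A /\ Y i \subset B,
    forall i, #|X i| = p * s /\ #|Y i| = q * s,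
    forall i j, i != j -> [disjoint X i & X j] /\ [disjoint Y i & Y j] &
    forall i, complete e (X i) (Y i)].
Proof.
move=> p0 q0 s0 E1.
have [|N HN] := @dense_block (p * s) (q * s) E; first by rewrite muln_gt0 q0.
exists N => k Nk T e A B cA cB dens.
suff : forall j, j <= k -> exists X Y : 'I_j -> {set T},
    [/\ forall i, X i \subset A /\ Y i \subset B,
    forall i, #|X i| = p * s /\ #|Y i| = q * s,
    forall i j, i != j -> [disjoint X i & X j] /\ [disjoint Y i & Y j] &
    forall i, complete e (X i) (Y i)] by apply.
elim=> [|j IH] jk; first by exists (fun=> A), (fun=> B); split=> -[].
have [X [Y [XYs XYc XYd XYe]]] := IH (ltnW jk).
pose A1 := \bigcup_i X i; pose B1 := \bigcup_i Y i.
have cA1 : #|A1| <= j * (p * s).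
  by rewrite -[X in X * _](card_ord j); apply: card_bigcup_const => i; have [] := XYc i.
have cB1 : #|B1| <= j * (q * s).
  by rewrite -[X in X * _](card_ord j); apply: card_bigcup_const => i; have [] := XYc i.
have A1A : A1 \subset A by apply/bigcupsP => i _; have [] := XYs i.
have B1B : B1 \subset B by apply/bigcupsP => i _; have [] := XYs i.
have kA : j * (p * s) <= k * (p * s) by rewrite leq_mul2r (ltnW jk) orbT.
have kB : j * (q * s) <= k * (q * s) by rewrite leq_mul2r (ltnW jk) orbT.
have cA' : #|A :\: A1| = #|A| - #|A1| by rewrite cardsD (finset.setIidPr A1A).
have cB' : #|B :\: B1| = #|B| - #|B1| by rewrite cardsD (finset.setIidPr B1B).
have kpA : k <= k * (p * s) by rewrite leq_pmulr// muln_gt0 p0.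
have kpB : k <= k * (q * s) by rewrite leq_pmulr// muln_gt0 q0.
have [|||A0 [B0 [A0A B0B A0c B0c A0e]]] := HN T e (A :\: A1) (B :\: B1).
- by rewrite cA' cA; nia.
- by rewrite cB' cB; nia.
- have ed := edges_setD e A B A1 B1.
  have h1 : E * (#|A1| * #|B|) <= #|A| * #|B| by rewrite mulnA leq_mul2r cA; nia.
  have h2 : E * (#|A| * #|B1|) <= #|A| * #|B| by rewrite mulnCA leq_mul2l cB; nia.
  have h3 : #|A :\: A1| * #|B :\: B1| <= #|A| * #|B|.
    by apply: leq_mul; apply: subset_leq_card; apply: finset.subsetDl.
  have h4 : E * edges e A B <= E * (edges e (A :\: A1) (B :\: B1)
      + #|A1| * #|B| + #|A| * #|B1|) by rewrite leq_mul2l ed orbT.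
  by rewrite !mulnDr in h4; lia.
have dA i : [disjoint A0 & X i].
  rewrite disjoint_sym finset.disjoints_subset.
  apply: fintype.subset_trans (_ : ~: (A :\: A1) \subset _); last by rewrite finset.setCS.
  by rewrite finset.setCD (fintype.subset_trans (finset.bigcup_sup i _) (finset.subsetUr _ _)).
have dB i : [disjoint B0 & Y i].
  rewrite disjoint_sym finset.disjoints_subset.
  apply: fintype.subset_trans (_ : ~: (B :\: B1) \subset _); last by rewrite finset.setCS.
  by rewrite finset.setCD (fintype.subset_trans (finset.bigcup_sup i _) (finset.subsetUr _ _)).
exists (fun i => if unlift ord0 i is Some j then X j else A0).
exists (fun i => if unlift ord0 i is Some j then Y j else B0); split.
- move=> i; case: unlift => [i'|]; first exact: XYs.
  by split; [apply: (fintype.subset_trans A0A)|apply: (fintype.subset_trans B0B)];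
     apply: finset.subsetDl.
- by move=> i; case: unlift.
- move=> i i'; case: unliftP => [x|] ->; case: unliftP => [y|] ->.
  + by move=> ij; apply: XYd; apply: contra ij => /eqP ->.
  + by move=> _; split; rewrite disjoint_sym.
  + by [].
  + by rewrite eqxx.
- by move=> i; case: unlift.
Qed.

(** The index type is arbitrary, so that two tilings combine through a sum type
    and a tiling is subdivided through a product type. *)
Definition tiling (T : finType) (e : rel T) (B R : {set T}) (a b l : nat) :=
  exists (I : finType) (X Y : I -> {set T}),
    [/\ #|I| = l, forall i, X i \subset B /\ Y i \subset R,
        forall i, #|X i| = a /\ #|Y i| = b,
        forall i j, i != j -> [disjoint X i & X j] /\ [disjoint Y i & Y j] &
        forall i, complete e (X i) (Y i)].

(** The complement of the given sets is cut as far as possible, which leaves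
    fewer than a elements out. *)
Lemma extend_chunks (T I : finType) (X : I -> {set T}) (B : {set T}) a :
  0 < a -> (forall i, X i \subset B) -> (forall i, #|X i| = a) ->
  (forall i j, i != j -> [disjoint X i & X j]) ->
  exists (m : nat) (X1 : I + 'I_m -> {set T}),
    [/\ forall i, X1 i \subset B, forall i, #|X1 i| = a,
        forall i j, i != j -> [disjoint X1 i & X1 j],
        forall i, X1 (inl i) = X i & #|B :\: \bigcup_i X1 i| < a].
Proof.
move=> a0 XB Xa Xd; pose B0 := B :\: \bigcup_i X i; pose m := #|B0| %/ a.
have [Y [YB Ya Yd]] := @chunks T B0 a m (leq_divM _ _).
have XY i j : [disjoint X i & Y j].
  rewrite finset.disjoints_subset finset.subsetC; apply: (fintype.subset_trans (YB j)).
  by rewrite /B0 finset.setDE (fintype.subset_trans (finset.subsetIr _ _))// finset.setCS finset.bigcup_sup.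
pose X1 i := match i with inl i => X i | inr j => Y j end.
exists m, X1; split=> //.
- by case=> // j; apply: (fintype.subset_trans (YB j)); apply: finset.subsetDl.
- by case.
- case=> [i|i] [j|j] ij //=; first exact: Xd.
  + by rewrite disjoint_sym.
  + exact: Yd.
have UY : #|\bigcup_j Y j| = m * a.
  rewrite -sum1_card partition_disjoint_bigcup//.
  by rewrite (eq_bigr (fun=> a)) ?sum_nat_const ?card_ord// => j _; rewrite sum1_card Ya.
have -> : B :\: \bigcup_i X1 i = B0 :\: \bigcup_j Y j.
  rewrite /B0 finset.setDDl; congr (_ :\: _).
  apply/finset.setP => x; rewrite inE; apply/bigcupP/orP.
    by case=> -[i|j] _ xi; [left|right]; apply/bigcupP; [exists i|exists j].
  by case=> /bigcupP[i _ xi]; [exists (inl i)|exists (inr i)].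
rewrite cardsD (finset.setIidPr _); last by apply/bigcupsP => j _.
by rewrite UY; have := divn_eq #|B0| a; have := ltn_pmod #|B0| a0; rewrite -/m; lia.
Qed.

(** One side of the refinement.  X lists all chunks, the old blocks being those
    at the places [inj]; Y m lists the subsets of size a that have been selected
    in the chunk [pos m] and fill a 1/E part of it.  As at most one m selects in
    a given chunk, the rest of each old block still splits into (E-1) k sets. *)
Lemma refine_side (T I P M : finType) (inj : I -> P) (pos : M -> P) E k a
    (X : P -> {set T}) (Y : M -> 'I_k -> {set T}) :
  injective inj -> injective pos ->
  (forall i, #|X i| = E * (k * a)) ->
  (forall i j, i != j -> [disjoint X i & X j]) ->
  (forall m u, Y m u \subset X (pos m)) -> (forall m u, #|Y m u| = a) ->
  (forall m u v, u != v -> [disjoint Y m u & Y m v]) ->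
  exists Z : I * 'I_(E.-1 * k) + M * 'I_k -> {set T},
    [/\ forall j, #|Z j| = a, forall i j, i != j -> [disjoint Z i & Z j],
        forall i t, Z (inl (i, t)) \subset X (inj i) &
        forall m u, Z (inr (m, u)) = Y m u].
Proof.
move=> injI posI cX dX YX cY dY.
pose U i := \bigcup_(m | pos m == inj i) \bigcup_u Y m u.
have cU i : #|U i| <= k * a.
  rewrite /U; have [/existsP[m /eqP mi]|/existsPn nm] := boolP [exists m, pos m == inj i].
    rewrite (big_pred1 m) => [|m'].
      by rewrite -[X in X * _](card_ord k); apply: card_bigcup_const.
    by rewrite -mi /=; apply/eqP/eqP => [/posI|->].
  rewrite big1 ?cards0// => m; by rewrite (negPf (nm m)).
have /choice[C HC] i : exists C : 'I_(E.-1 * k) -> {set T},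
    [/\ forall t, C t \subset X (inj i) :\: U i, forall t, #|C t| = a &
        forall t u, t != u -> [disjoint C t & C u]].
  apply: chunks; rewrite cardsD cX.
  have := subset_leq_card (finset.subsetIr (X (inj i)) (U i)); have := cU i.
  by case: E {cX} => [|E] /=; rewrite ?mul0n// mulSn mulnA; lia.
have CX i t : C i t \subset X (inj i).
  by have [h _ _] := HC i; apply: (fintype.subset_trans (h t)); apply: finset.subsetDl.
have sub_disj (A A' B B' : {set T}) : A \subset A' -> B \subset B' ->
    [disjoint A' & B'] -> [disjoint A & B].
  by move=> sA sB d; apply: (disjointWl sA); apply: (disjointWr sB).
have CY i t m u : [disjoint C i t & Y m u].
  have [mi|nmi] := eqVneq (pos m) (inj i); last first.
    by apply: sub_disj (CX i t) (YX m u) _; apply: dX; rewrite eq_sym.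
  have [h _ _] := HC i; apply: (disjointWl (h t)).
  rewrite disjoint_sym finset.disjoints_subset finset.setCD.
  apply: (fintype.subset_trans _ (finset.subsetUr _ _)).
  apply: (@fintype.subset_trans _ _ (\bigcup_v Y m v)); first exact: finset.bigcup_sup.
  by apply: (finset.bigcup_sup m); rewrite mi.
exists (fun j => match j with inl (i, t) => C i t | inr (m, u) => Y m u end).
split=> //.
- by case=> [[i t]|[m u]] //; have [] := HC i.
- case=> [[i t]|[m u]] [[i' t']|[m' u']] //.
  + have [<-|ii' _] := eqVneq i i'; last first.
      by apply: sub_disj (CX i t) (CX i' t') _; apply: dX; apply: contra ii' => /eqP/injI ->.
    have [_ _ d] := HC i => ne; apply: d.
    by apply: contra ne => /eqP ->.
  + by move=> _; rewrite disjoint_sym.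
  + have [<-|mm' _] := eqVneq m m'; last first.
      by apply: sub_disj (YX m u) (YX m' u') _; apply: dX; apply: contra mm' => /eqP/posI ->.
    by move=> ne; apply: dY; apply: contra ne => /eqP ->.
Qed.

(** Either a tiling by blocks of size E k s is refined to blocks of size s with
    a gain of g/E old blocks, or a cover certifies that it was almost optimal:
    the blocks of B \ X and R \ Z number less than l + g, up to the two
    incomplete chunks, and X and Z span few edges. *)
Definition refinable p q s E K := forall k, K <= k -> 0 < k ->
  forall (T : finType) (e : rel T) (B R : {set T}) l g,
    tiling e B R (E * (k * (p * s))) (E * (k * (q * s))) l ->
  (exists2 l', tiling e B R (p * s) (q * s) l' & E * (k * l) + k * g <= l') \/
  (exists X Z : {set T}, [/\ X \subset B, Z \subset R,
     E * edges e X Z <= 4 * (#|X| * #|Z|) &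
     q * #|B :\: X| + p * #|R :\: Z| <= p * q * (E * (k * s)) * (l + g + 2)]).

(** Cut everything outside the blocks into chunks of the same two sizes and join
    two chunks when the pair has density at least 4/E.  If the reduced graph has
    a matching of size l + g, every matched pair contains disjoint complete
    blocks filling a 1/E part of it, and the old blocks, being complete, still
    tile whatever (1 - 1/E) part of them is left over; the new number of blocks
    is thus the convex combination of l and l + g with weights 1 - 1/E and 1/E.
    Otherwise a small vertex cover of the reduced graph gives X and Z, since the
    uncovered chunk pairs are sparse. *)
Lemma refine_or_cover p q s E : 0 < p -> 0 < q -> 0 < s -> 1 < E ->
  exists K, refinable p q s E K.
Proof.
move=> p0 q0 s0 E1; have [K HK] := dense_blocks p0 q0 s0 E1.
exists K => k Kk k0 T e B R l g [I [X [Y [cI XYs XYc XYd XYe]]]].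
have E0 : 0 < E by lia.
pose a := E * (k * (p * s)); pose b := E * (k * (q * s)).
have a0 : 0 < a by rewrite !muln_gt0 E0 k0 p0 s0.
have b0 : 0 < b by rewrite !muln_gt0 E0 k0 q0 s0.
have [|||m [X1 [X1B X1a X1d X1X X1r]]] := @extend_chunks T I X B a a0.
- by move=> i; have [] := XYs i.
- by move=> i; have [] := XYc i.
- by move=> i j /XYd[].
have [|||m' [Y1 [Y1R Y1b Y1d Y1Y Y1r]]] := @extend_chunks T I Y R b b0.
- by move=> i; have [] := XYs i.
- by move=> i; have [] := XYc i.
- by move=> i j /XYd[].
pose G := [set ij : (I + 'I_m) * (I + 'I_m') |
  4 * (#|X1 ij.1| * #|Y1 ij.2|) <= E * edges e (X1 ij.1) (Y1 ij.2)].
have [[U [V [cUV ltUV]]]|nocov] :=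
    pselect (exists U V, vertex_cover G U V /\ #|U| + #|V| < l + g).
(* A small cover: X and Z are the unions of the uncovered chunks. *)
- right; exists (\bigcup_(i in ~: U) X1 i), (\bigcup_(j in ~: V) Y1 j); split.
  + by apply/bigcupsP => i _.
  + by apply/bigcupsP => i _.
  + have cX : #|\bigcup_(i in ~: U) X1 i| = #|~: U| * a.
      rewrite -sum1_card sum_bigcup// -sum_nat_const.
      by apply: eq_bigr => i _; rewrite sum1_card X1a.
    have cZ : #|\bigcup_(j in ~: V) Y1 j| = #|~: V| * b.
      rewrite -sum1_card sum_bigcup// -sum_nat_const.
      by apply: eq_bigr => i _; rewrite sum1_card Y1b.
    have -> : edges e (\bigcup_(i in ~: U) X1 i) (\bigcup_(j in ~: V) Y1 j) =
        \sum_(i in ~: U) \sum_(j in ~: V) edges e (X1 i) (Y1 j).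
      rewrite /edges sum_bigcup//; apply: eq_bigr => i _.
      by rewrite [RHS]exchange_big; apply: eq_bigr => x _; rewrite sum_bigcup.
    have -> : 4 * (#|\bigcup_(i in ~: U) X1 i| * #|\bigcup_(j in ~: V) Y1 j|) =
        #|~: U| * (#|~: V| * (4 * (a * b))) by rewrite cX cZ; nia.
    rewrite -sum_nat_const big_distrr /=; apply: leq_sum => i; rewrite inE => iU.
    rewrite -sum_nat_const big_distrr /=; apply: leq_sum => j; rewrite inE => jV.
    rewrite leqNgt; apply/negP => h.
    have ijG : (i, j) \in G by rewrite inE /= X1a Y1b ltnW.
    by have /= := forall_inP cUV _ ijG; rewrite (negPf iU) (negPf jV).
  + have side (J : finType) (F : J -> {set T}) (A : {set T}) (W : {set J}) c :
        (forall j, #|F j| = c) -> #|A :\: \bigcup_j F j| < c ->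
        #|A :\: \bigcup_(j in ~: W) F j| <= (#|W| + 1) * c.
      move=> Fc Ac; have sAW : A :\: \bigcup_(j in ~: W) F j \subset
          (A :\: \bigcup_j F j) :|: \bigcup_(j in W) F j.
        apply/fintype.subsetP => x; rewrite !inE => /andP[xW ->]; rewrite andbT.
        rewrite -implybE; apply/implyP => /bigcupP[j _ xj].
        apply/bigcupP; exists j => //; apply: contraNT xW => jW.
        by apply/bigcupP; exists j => //; rewrite inE.
      rewrite (leq_trans (subset_leq_card sAW))//.
      rewrite (leq_trans (leq_card_setU _ _))//.
      have : #|\bigcup_(j in W) F j| <= #|W| * c.
        rewrite -sum_nat_const; elim/big_rec2: _ => [|j n S _ Sn]; first by rewrite cards0.
        by have := cardsUI (F j) S; rewrite Fc; lia.
      by lia.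
    have := side _ X1 B U a X1a X1r; have := side _ Y1 R V b Y1b Y1r.
    have qa : q * a = p * q * (E * (k * s)) by rewrite /a; lia.
    have pb : p * b = p * q * (E * (k * s)) by rewrite /b; lia.
    move=> h1 h2.
    have := leq_mul (leqnn q) h2; have := leq_mul (leqnn p) h1.
    have -> : q * ((#|U| + 1) * a) = (#|U| + 1) * (q * a) by lia.
    have -> : p * ((#|V| + 1) * b) = (#|V| + 1) * (p * b) by lia.
    rewrite qa pb; move: (p * q * _) => w; nia.
(* A large matching: subdivide its pairs and the rest of the old blocks. *)
- left.
  have [|M [MG mM cM]] := @konig _ _ G (l + g).
    by move=> U V c; rewrite leqNgt; apply/negP => h; apply: nocov; exists U, V.
  pose MT := {ij | ij \in M}.
  have /choice[XY HXY] (m0 : MT) : exists XY : ('I_k -> {set T}) * ('I_k -> {set T}),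
     [/\ forall i, XY.1 i \subset X1 (val m0).1 /\ XY.2 i \subset Y1 (val m0).2,
    forall i, #|XY.1 i| = p * s /\ #|XY.2 i| = q * s,
    forall i j, i != j -> [disjoint XY.1 i & XY.1 j] /\ [disjoint XY.2 i & XY.2 j] &
    forall i, complete e (XY.1 i) (XY.2 i)].
    have [|||X2 [Y2 h]] := HK k Kk T e (X1 (val m0).1) (Y1 (val m0).2).
    - exact: X1a.
    - exact: Y1b.
    - by have := fintype.subsetP MG _ (valP m0); rewrite inE.
    by exists (X2, Y2).
  have [|||||||X2 [X2a X2d X2X X2Y]] := @refine_side T I (I + 'I_m)%type MT inl (fun m => (val m).1)
    E k (p * s) X1 (fun m => (XY m).1).
  + by move=> i j [].
  + by move=> u v uv; apply/val_inj/mM; [exact: valP|exact: valP|left].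
  + exact: X1a.
  + exact: X1d.
  + by move=> m0 u; have [h _ _ _] := HXY m0; have [] := h u.
  + by move=> m0 u; have [_ h _ _] := HXY m0; have [] := h u.
  + by move=> m0 u v; have [_ _ h _] := HXY m0 => /h[].
  have [|||||||Y2 [Y2a Y2d Y2X Y2Y]] := @refine_side T I (I + 'I_m')%type MT inl (fun m => (val m).2)
    E k (q * s) Y1 (fun m => (XY m).2).
  + by move=> i j [].
  + by move=> u v uv; apply/val_inj/mM; [exact: valP|exact: valP|right].
  + exact: Y1b.
  + exact: Y1d.
  + by move=> m0 u; have [h _ _ _] := HXY m0; have [] := h u.
  + by move=> m0 u; have [_ h _ _] := HXY m0; have [] := h u.
  + by move=> m0 u v; have [_ _ h _] := HXY m0 => /h[].
  exists (l * (E.-1 * k) + #|M| * k).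
    exists (I * 'I_(E.-1 * k) + MT * 'I_k)%type, X2, Y2; split.
    * by rewrite card_sum !card_prod !card_ord cI card_sig.
    * case=> [[i t]|[m0 u]].
        by split; [apply: (fintype.subset_trans (X2X i t))|apply: (fintype.subset_trans (Y2X i t))].
      rewrite X2Y Y2Y; have [h _ _ _] := HXY m0; have [h1 h2] := h u.
      by split; [apply: (fintype.subset_trans h1)|apply: (fintype.subset_trans h2)].
    * by [].
    * by move=> i j ij; split; [exact: X2d|exact: Y2d].
    * case=> [[i t]|[m0 u]].
        move=> x y /(fintype.subsetP (X2X i t)) xi /(fintype.subsetP (Y2X i t)) yi.
        by apply: (XYe i); rewrite -?X1X -?Y1Y.
      by rewrite X2Y Y2Y; have [_ _ _ h] := HXY m0; apply: h.
  have := leq_mul cM (leqnn k).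
  move: (#|M| * k) => w; have EE : E = E.-1.+1 by lia.
  by move: E.-1 EE => E' ->; nia.
Qed.

End Stage.

Section ApproximateKonig.
Local Open Scope nat_scope.
Local Open Scope set_scope.

Lemma tiling_split (T : finType) (e : rel T) B R t a b l :
  tiling e B R (t * a) (t * b) l -> tiling e B R a b (l * t).
Proof.
move=> [I [X [Y [cI XYs XYc XYd XYe]]]].
have /choice[C HC] i : exists C : 'I_t -> {set T}, [/\ forall u, C u \subset X i,
    forall u, #|C u| = a & forall u v, u != v -> [disjoint C u & C v]].
  by apply: chunks; have [-> _] := XYc i.
have /choice[D HD] i : exists D : 'I_t -> {set T}, [/\ forall u, D u \subset Y i,
    forall u, #|D u| = b & forall u v, u != v -> [disjoint D u & D v]].
  by apply: chunks; have [_ ->] := XYc i.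
exists (I * 'I_t)%type, (fun j => C j.1 j.2), (fun j => D j.1 j.2); split.
- by rewrite card_prod card_ord cI.
- move=> [i u] /=; have [h1 h2] := XYs i; have [h3 _ _] := HC i; have [h4 _ _] := HD i.
  by split; [apply: (fintype.subset_trans (h3 u))|apply: (fintype.subset_trans (h4 u))].
- by move=> [i u] /=; have [_ h3 _] := HC i; have [_ h4 _] := HD i.
- move=> [i u] [j v] /= ne; have [h1 _ h2] := HC i; have [h3 _ h4] := HD i.
  have [ij|ij] := eqVneq i j.
    by rewrite -ij; split; [apply: h2|apply: h4]; apply: contra ne => /eqP ->; rewrite ij.
  have [h5 _ _] := HC j; have [h6 _ _] := HD j; have [d1 d2] := XYd i j ij.
  by split; [apply: (disjointWl (h1 u)); apply: (disjointWr (h5 v))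
            |apply: (disjointWl (h3 u)); apply: (disjointWr (h6 v))].
- move=> [i u] x y /=; have [h1 _ _] := HC i; have [h2 _ _] := HD i.
  by move=> /(fintype.subsetP (h1 u)) xi /(fintype.subsetP (h2 u)); apply: XYe.
Qed.

Lemma tiling_card (T : finType) (e : rel T) B R a b l :
  tiling e B R a b l -> l * a <= #|B|.
Proof.
move=> [I [X [Y [cI XYs XYc XYd XYe]]]].
have <- : #|\bigcup_i X i| = l * a.
  rewrite -sum1_card partition_disjoint_bigcup; last by move=> i j /XYd[].
  rewrite (eq_bigr (fun=> a)) ?sum_nat_const ?cI// => i _.
  by rewrite sum1_card; have [] := XYc i.
by apply: subset_leq_card; apply/bigcupsP => i _; have [] := XYs i.
Qed.

Lemma tiling0 (T : finType) (e : rel T) B R a b : tiling e B R a b 0.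
Proof. by exists 'I_0, (fun=> B), (fun=> R); split; rewrite ?card_ord// => -[]. Qed.

(** With Lambda = q/p and E, L large, this says that the largest number of
    vertices of B in disjoint copies of K_{p,q} is the minimum of
    |B \ X| + |R \ Z| / Lambda over the pairs (X, Z) spanning few edges, up to
    an error n/L + O(1).  The constant C may not depend on the graph. *)
Definition tiling_duality p q E L C := forall (T : finType) (e : rel T) (B R : {set T}) n,
    0 < n -> #|B| <= n ->
  exists m (X Z : {set T}), [/\ tiling e B R p q m, X \subset B, Z \subset R,
    E * edges e X Z <= 4 * (#|X| * #|Z|) &
    L * (q * #|B :\: X| + p * #|R :\: Z|) <= p * q * (L * m + n + C)].

(** Start from the empty tiling by very large blocks and refine.  Each
    refinement covers at least n/(E L) further vertices of B, up to the factor p,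
    so a refinement must fail after at most E L steps, and then there is a cover.
    This takes the place of a regularity lemma: the block sizes t_j are fixed
    in advance, so that the last block size is a constant. *)
Theorem approx_konig p q E L : 0 < p -> 0 < q -> 1 < E -> 0 < L ->
  exists C, tiling_duality p q E L C.
Proof.
move=> p0 q0 E1 L0.
pose good s K := 0 < s -> refinable p q s E K.
have /choice[K HK] s : exists K, good s K.
  have [s0|s0] := ltnP 0 s; last by exists 0 => /(leq_ltn_trans s0); rewrite ltnn.
  by have [K HK] := refine_or_cover p0 q0 s0 E1; exists K => _.
pose next s := E * ((K s).+1 * s); pose t j := iter j next 1.
have t0 j : 0 < t j by elim: j => // j IH; rewrite /t iterS !muln_gt0 /= (ltnW E1).
pose J := (E * L).+1; pose C := \max_(j < J.+1) (3 * L * t j).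
exists C => T e B R n n0 Bn.
(* The invariant says that J - j refinements have been made, with their gains. *)
suff H j l : j <= J -> tiling e B R (t j * p) (t j * q) l ->
    (J - j) * n <= E * L * (t j * l) ->
    exists m (X Z : {set T}), [/\ tiling e B R p q m, X \subset B, Z \subset R,
    E * edges e X Z <= 4 * (#|X| * #|Z|) &
    L * (q * #|B :\: X| + p * #|R :\: Z|) <= p * q * (L * m + n + C)].
  by apply: (H J 0) => //; [exact: tiling0|rewrite subnn].
elim: j l => [|j IH] l jJ tl inv.
  have := tiling_card tl; move: inv; rewrite subn0 !mul1n /J => inv.
  have : l <= l * p by rewrite leq_pmulr.
  by move=> h1 h2; have := leq_mul (leqnn (E * L)) (leq_trans (leq_trans h1 h2) Bn); nia.
have tjE : t j.+1 = E * ((K (t j)).+1 * t j) by [].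
pose g := (n %/ (L * t j.+1)).+1.
have ng : n <= L * t j.+1 * g.
  by rewrite mulnC ltnW// ltn_ceil// muln_gt0 L0 t0.
have gn : L * t j.+1 * g <= n + L * t j.+1.
  by rewrite /g mulnS addnC leq_add2r (mulnC (L * t _)) leq_divM.
have [|[l' tl' hl']|[X [Z [XB ZR eXZ cXZ]]]] := HK (t j) (t0 j) (K (t j)).+1 (leqnSn _) isT T e B R l g.
- by move: tl; rewrite tjE; congr tiling; lia.
- apply: (IH l' (ltnW jJ)); first by rewrite ![t j * _]mulnC.
  have := leq_mul (leqnn (E * L * t j)) hl'; rewrite tjE in inv ng.
  have -> : J - j = (J - j.+1).+1 by lia.
  rewrite mulSn; move: (J - j.+1) inv ng => d; lia.
exists (l * t j.+1), X, Z; split=> //.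
  by apply: tiling_split.
have CJ : 3 * L * t j.+1 <= C.
  by rewrite /C; apply: (@leq_bigmax _ (fun j : 'I_J.+1 => 3 * L * t j) (Ordinal (jJ : j.+1 < J.+1))).
have := leq_mul (leqnn L) cXZ; rewrite -tjE => h; apply: (leq_trans h).
have -> : L * (p * q * t j.+1 * (l + g + 2)) =
    p * q * (L * (l * t j.+1) + L * t j.+1 * g + 2 * (L * t j.+1)) by lia.
by rewrite leq_mul2l; apply/orP; right; move: gn CJ; lia.
Qed.

End ApproximateKonig.

(** * The optimization problem as a problem on monotone walks *)

Section Offsets.
Local Open Scope classical_set_scope.
Variable R : realType.
Implicit Types (lam t u S : R) (g : R -> R).

(** The number D with f(lam) = 1 - 1/D: the infimum of limsup (b + r')/u
    over monotone walks, where b is the abscissa at which b - r/lam first reaches u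
    and r' the ordinate at which r' - b'/lam first does. *)
Definition walk_rate lam : R :=
  2 * lam / (1 + lam) ^+ 2 * fine (hfun ((lam - 1) / (lam + 1)))
  + 2 * lam / (1 + lam).

Lemma gam_lt1 lam : 0 < lam -> `|(lam - 1) / (lam + 1)| < 1.
Proof.
move=> l0; rewrite ltr_norml ltr_pdivlMr ?ltr_pdivrMr; lra.
Qed.

(** A walk passes weakly to the right of and below (b, r) when g(b+r) >= b-r, and
    weakly to the left of and above it when g(b+r) <= b-r.  The largest
    1-Lipschitz function satisfying the constraints of P' (and g(0) = 0) satisfies
    those of P as well, because the two constraints are only incompatible
    for b > b' and r < r'. *)
Lemma walk_through (P P' : R -> R -> Prop) :
  (forall b r, P b r -> 0 <= b /\ 0 <= r) ->
  (forall b r, P' b r -> 0 <= b /\ 0 <= r) ->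
  (forall b r b' r', P b r -> P' b' r' -> b <= b' \/ r' <= r) ->
  exists g, [/\ admissible g, forall b r, P b r -> b - r <= g (b + r) &
                forall b r, P' b r -> g (b + r) <= b - r].
Proof.
move=> P0 P'0 PP'.
pose A x := [set y : R | (exists b r, P' b r /\ y = b - r + `|x - (b + r)|) \/ y = `|x|].
have Ane x : A x !=set0 by exists `|x|; right.
have Alb x : has_lbound (A x).
  exists (- `|x|) => _ [[b [r [/P'0[b0 r0] ->]]]|->].
    have := ler_norm (b + r - x); have := ler_norm x; rewrite distrC; lra.
  by have := normr_ge0 x; lra.
pose g x := inf (A x).
have glb x z : (forall b r, P' b r -> z <= b - r + `|x - (b + r)|) -> z <= `|x| ->
    z <= g x.
  move=> h1 h2; apply: lb_le_inf => // _ [[b [r [br ->]]]|->//]; exact: h1.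
have gub x b r : P' b r -> g x <= b - r + `|x - (b + r)|.
  by move=> br; apply: ge_inf => //; left; exists b, r.
have gub0 x : g x <= `|x| by apply: ge_inf => //; right.
have glip x z : g x - g z <= `|x - z|.
  rewrite lerBlDr -lerBlDl; apply: glb => [b r br|].
    by have := gub x b r br; have := ler_distD z x (b + r); lra.
  by have := gub0 x; have := ler_distD z x 0; rewrite !subr0; lra.
exists g; split.
- split.
    move=> [x z] _ /=; rewrite mul1r ler_norml glip andbT lerNl opprB distrC.
    exact: glip.
  apply/eqP; rewrite eq_le; apply/andP; split.
    by have := gub0 0; rewrite normr0.
  apply: glb => [b r /P'0[b0 r0]|]; last by rewrite normr0.
  by rewrite sub0r normrN ger0_norm; lra.
- move=> b r br; have [b0 r0] := P0 _ _ br; apply: glb => [b' r' br'|].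
    have := ler_norm (b + r - (b' + r')); have := ler_norm (b' + r' - (b + r)).
    by rewrite distrC; have [] := PP' _ _ _ _ br br'; lra.
  by rewrite ger0_norm; lra.
- by move=> b r br; have := gub (b + r) b r br; rewrite subrr normr0 addr0.
Qed.

(** The families bound the hitting points of the walk that separates them.  With
    r <= lam (b - u), the hitting time b + r is at most (1+lam) b - lam u. *)
Lemma walk_rate_le (P P' : R -> R -> Prop) lam S u0 : 0 < lam ->
  (forall b r, P b r -> 0 <= b /\ 0 <= r) ->
  (forall b r, P' b r -> 0 <= b /\ 0 <= r) ->
  (forall b r b' r', P b r -> P' b' r' -> b <= b' \/ r' <= r) ->
  (forall u, u0 <= u -> exists b r b' r', [/\ P b r, P' b' r',
      r <= lam * (b - u), b' <= lam * (r' - u) & b + r' <= S * u]) ->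
  walk_rate lam <= S.
Proof.
move=> l0 P0 P'0 PP' HS.
have [g [adm gP gP']] := walk_through P0 P'0 PP'.
pose gam := (lam - 1) / (lam + 1).
(* V is the value of h for which D equals S. *)
pose V := ((1 + lam) * S - 2 * lam) * ((1 + lam) / (2 * lam)).
have l1 : 1 + lam != 0 by apply/eqP; lra.
have l1' : lam + 1 != 0 by rewrite addrC.
have l2 : lam != 0 by apply/eqP; lra.
suff : (hfun gam <= V%:E)%E.
  rewrite -(fineK (hfun_fin_num (gam_lt1 l0))) lee_fin => hV.
  rewrite /walk_rate -/gam.
  have : 2 * lam / (1 + lam) ^+ 2 * fine (hfun gam) <= 2 * lam / (1 + lam) ^+ 2 * V.
    rewrite ler_wpM2l// divr_ge0//; first lra.
    by rewrite exprn_ge0; lra.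
  have -> : 2 * lam / (1 + lam) ^+ 2 * V = S - 2 * lam / (1 + lam).
    by rewrite /V; field; rewrite ?l1 ?l1' ?l2.
  by lra.
apply: (@le_trans _ _ (limf_esup
   (fun t => (Gamma_plus gam g t + Gamma_minus gam g t) * (t^-1)%:E)%E
   (pinfty_nbhs R))).
  by apply: ereal_inf_lbound; exists g.
pose T := Num.max 0 (2 * lam / (1 + lam) * u0).
apply: (@le_trans _ _ (ereal_sup [set ((Gamma_plus gam g t + Gamma_minus gam g t)
      * (t^-1)%:E)%E | t in [set t | T < t]])).
  by apply: ereal_inf_lbound; exists [set t | T < t] => //; exists T; split => //; apply: num_real.
apply: ge_ereal_sup => _ [t /= Tt <-].
have [t0 tu] : 0 < t /\ 2 * lam / (1 + lam) * u0 < t.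
  by move: Tt; rewrite /T gt_max => /andP[].
pose u := (1 + lam) / (2 * lam) * t.
have tE : t = 2 * lam / (1 + lam) * u by rewrite /u; field; rewrite ?l1 ?l1' ?l2.
have u0u : u0 <= u.
  have c0 : 0 < 2 * lam / (1 + lam) by rewrite divr_gt0; lra.
  by rewrite -(ler_pM2l c0) -tE ltW.
have [b [r [b' [r' [br br' hr hb hS]]]]] := HS u u0u.
have [b0 r0] := P0 _ _ br; have [b'0 r'0] := P'0 _ _ br'.
have gE x y : gam * (x + y) + (x - y) = 2 / (1 + lam) * (lam * x - y).
  by rewrite /gam; field; rewrite ?l1 ?l1' ?l2.
have gE' x y : gam * (x + y) - (x - y) = 2 / (1 + lam) * (lam * y - x).
  by rewrite /gam; field; rewrite ?l1 ?l1' ?l2.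
have tu' z : lam * u <= z -> t <= 2 / (1 + lam) * z.
  move=> uz; rewrite tE (_ : _ * u = 2 / (1 + lam) * (lam * u)); last by field; rewrite ?l1 ?l1' ?l2.
  by rewrite ler_wpM2l// divr_ge0; lra.
have Gp : (Gamma_plus gam g t <= (b + r)%:E)%E.
  apply: ereal_inf_lbound; exists (b + r) => //; split; first lra.
  apply: (@le_trans _ _ (gam * (b + r) + (b - r))); last by rewrite lerD2l gP.
  by rewrite gE tu'; lra.
have Gm : (Gamma_minus gam g t <= (b' + r')%:E)%E.
  apply: ereal_inf_lbound; exists (b' + r') => //; split; first lra.
  apply: (@le_trans _ _ (gam * (b' + r') - (b' - r'))); last by rewrite lerD2l lerN2 gP'.
  by rewrite gE' tu'; lra.
apply: (@le_trans _ _ (((b + r) + (b' + r')) * t^-1)%:E).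
  rewrite EFinM EFinD; apply: lee_wpmul2r; first by rewrite lee_fin invr_ge0 ltW.
  exact: leeD.
rewrite lee_fin ler_pdivrMr// (_ : V * t = ((1 + lam) * S - 2 * lam) * u); last first.
  by rewrite /V /u; field; rewrite ?l1 ?l1' ?l2.
have : (1 + lam) * (b + r') <= (1 + lam) * (S * u) by rewrite ler_wpM2l//; lra.
by lra.
Qed.

(** When b - r/lam first reaches u, b is u + al(u) with al(u) = r/lam, and
    symmetrically for si.  Of the hitting points for u in one direction and v in
    the other, the earlier one is below the later one in both coordinates:
    this is the alternative relating al and si. *)
Lemma offsets lam S : 0 < lam -> walk_rate lam < S ->
  exists (al si : R -> R) (u0 : R), [/\
    forall u, 0 <= u -> 0 <= al u /\ 0 <= si u,
    forall u v, 0 <= u -> u <= v -> al u <= al v /\ si u <= si v,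
    forall u v, 0 <= u -> 0 <= v -> u + al u <= lam * si v \/ v + si v <= lam * al u &
    forall u, u0 <= u -> 2 * u + al u + si u <= S * u].
Proof.
move=> l0 DS; pose gam := (lam - 1) / (lam + 1).
have gam1 : `|gam| < 1 := gam_lt1 l0.
pose V := ((1 + lam) * S - 2 * lam) * ((1 + lam) / (2 * lam)).
have l1 : 1 + lam != 0 by apply/eqP; lra.
have l1' : lam + 1 != 0 by rewrite addrC.
have l2 : lam != 0 by apply/eqP; lra.
have : (hfun gam < V%:E)%E.
  rewrite -(fineK (hfun_fin_num gam1)) lte_fin.
  have c0 : 0 < 2 * lam / (1 + lam) ^+ 2 by rewrite divr_gt0 ?exprn_gt0; lra.
  rewrite -(ltr_pM2l c0).
  have -> : 2 * lam / (1 + lam) ^+ 2 * V = S - 2 * lam / (1 + lam).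
    by rewrite /V; field; rewrite ?l1 ?l1' ?l2.
  by move: DS; rewrite /walk_rate -/gam; lra.
move=> /ereal_inf_lt[_ [g adm <-] /ereal_inf_lt[_ [W [M [_ MW]] <-] WV]].
have GV t : M < t -> ((Gamma_plus gam g t + Gamma_minus gam g t) * (t^-1)%:E < V%:E)%E.
  move=> Mt; apply: le_lt_trans WV; apply: ereal_sup_ubound; exists t => //; exact: MW.
have Gp0 t : (0 <= Gamma_plus gam g t)%E.
  by apply: le_ereal_inf_tmp => _ [x [x0 _] <-]; rewrite lee_fin.
have Gm0 t : (0 <= Gamma_minus gam g t)%E.
  by apply: le_ereal_inf_tmp => _ [x [x0 _] <-]; rewrite lee_fin.
have Gpm t t' : t <= t' -> (Gamma_plus gam g t <= Gamma_plus gam g t')%E.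
  move=> tt; apply: ereal_inf_le_tmp => _ [x [x0 h] <-]; exists x => //.
  by split=> //; apply: le_trans h.
have Gmm t t' : t <= t' -> (Gamma_minus gam g t <= Gamma_minus gam g t')%E.
  move=> tt; apply: ereal_inf_le_tmp => _ [x [x0 h] <-]; exists x => //.
  by split=> //; apply: le_trans h.
(* The limsup is finite, so the hitting times of large levels are finite, and
   then those of all levels by monotonicity. *)
have Gfin t : (Gamma_plus gam g t < +oo /\ Gamma_minus gam g t < +oo)%E.
  have [t' [tt' Mt' t'0]] : exists t', [/\ t <= t', M < t' & 0 < t'].
    exists (`|t| + `|M| + 1); have := ler_norm t; have := ler_norm M.
    by have := normr_ge0 t; have := normr_ge0 M; split; lra.
  have := GV t' Mt'.
  have := Gpm _ _ tt'; have := Gmm _ _ tt'; have := Gp0 t'; have := Gm0 t'.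
  case: (Gamma_plus gam g t') => [x||] //; case: (Gamma_minus gam g t') => [y||] //.
  - by move=> _ _ hm hp _; split;
      [exact: le_lt_trans hp (ltry _)|exact: le_lt_trans hm (ltry _)].
  - by move=> _ _ _ _; rewrite [X in (X * _)%E](_ : _ = +oo%E) // gt0_mulye ?lte_fin ?invr_gt0.
  - by move=> _ _ _ _; rewrite [X in (X * _)%E](_ : _ = +oo%E) // gt0_mulye ?lte_fin ?invr_gt0.
  - by move=> _ _ _ _; rewrite [X in (X * _)%E](_ : _ = +oo%E) // gt0_mulye ?lte_fin ?invr_gt0.
have /choice[xp Hp] : forall t, exists x, [/\ 0 <= x, t <= gam * x + g x & Gamma_plus gam g t = x%:E].
  move=> t; have [|x [x0 hx] e] := @Gamma_plus_min _ gam g t gam1 adm; last by exists x.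
  apply/set0P/negP => /eqP S0; have [+ _] := Gfin t.
  by rewrite /Gamma_plus S0 image_set0 ereal_inf0 ltxx.
have /choice[xm Hm] : forall t, exists x, [/\ 0 <= x, t <= gam * x - g x & Gamma_minus gam g t = x%:E].
  move=> t; have [|x [x0 hx] e] := @Gamma_minus_min _ gam g t gam1 adm; last by exists x.
  apply/set0P/negP => /eqP S0; have [_] := Gfin t.
  by rewrite /Gamma_minus S0 image_set0 ereal_inf0 ltxx.
have [glip0 g00] := adm.
have glip x y : 0 <= x -> x <= y -> `|g x - g y| <= y - x.
  move=> x0 xy; have := glip0 (x, y); rewrite /= mul1r => h.
  have : `|x - y| = y - x by rewrite distrC ger0_norm// subr_ge0.
  by move=> <-; apply: h; split => //=; apply: le_trans xy.
have gx x : 0 <= x -> - x <= g x /\ g x <= x.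
  move=> x0; have := glip 0 x (lexx _) x0; rewrite g00 sub0r subr0 normrN.
  by rewrite ler_norml => /andP[].
(* Level u of the walk is level c u of the original problem. *)
pose c := 2 * lam / (1 + lam).
have c0 : 0 < c by rewrite divr_gt0; lra.
pose x u := xp (c * u); pose y u := xm (c * u).
have xP u : [/\ 0 <= x u, lam * (2 * u) <= lam * (x u + g (x u)) - (x u - g (x u)) &
    Gamma_plus gam g (c * u) = (x u)%:E].
  have [h1 h2 h3] := Hp (c * u); split => //.
  have : (1 + lam) * (c * u) <= (1 + lam) * (gam * x u + g (x u)) by rewrite ler_wpM2l//; lra.
  have -> : (1 + lam) * (c * u) = lam * (2 * u) by rewrite /c; field; rewrite ?l1.
  have -> : (1 + lam) * (gam * x u + g (x u)) = (lam - 1) * x u + (1 + lam) * g (x u).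
    by rewrite /gam; field; rewrite ?l1 ?l1'.
  by lra.
have yP u : [/\ 0 <= y u, lam * (2 * u) <= lam * (y u - g (y u)) - (y u + g (y u)) &
    Gamma_minus gam g (c * u) = (y u)%:E].
  have [h1 h2 h3] := Hm (c * u); split => //.
  have : (1 + lam) * (c * u) <= (1 + lam) * (gam * y u - g (y u)) by rewrite ler_wpM2l//; lra.
  have -> : (1 + lam) * (c * u) = lam * (2 * u) by rewrite /c; field; rewrite ?l1.
  have -> : (1 + lam) * (gam * y u - g (y u)) = (lam - 1) * y u - (1 + lam) * g (y u).
    by rewrite /gam; field; rewrite ?l1 ?l1'.
  by lra.
pose al u := (x u - g (x u)) / (2 * lam).
pose si u := (y u + g (y u)) / (2 * lam).
have alE u : lam * al u = (x u - g (x u)) / 2 by rewrite /al; field; rewrite ?l2.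
have siE u : lam * si u = (y u + g (y u)) / 2 by rewrite /si; field; rewrite ?l2.
have xal u : u + al u <= (x u + g (x u)) / 2.
  by have [_ h _] := xP u; rewrite -(ler_pM2l l0) mulrDr alE; lra.
have ysi u : u + si u <= (y u - g (y u)) / 2.
  by have [_ h _] := yP u; rewrite -(ler_pM2l l0) mulrDr siE; lra.
exists al, si, (Num.max 1 (M / c + 1)); split.
- move=> u u0; have [x0 _ _] := xP u; have [y0 _ _] := yP u.
  by have := gx _ x0; have := gx _ y0; split; apply: divr_ge0; lra.
- move=> u v u0 uv; have [x0 _ hx] := xP u; have [y0 _ hy] := yP u.
  have [_ _ hx'] := xP v; have [_ _ hy'] := yP v.
  have cuv : c * u <= c * v by rewrite ler_pM2l.
  have := Gpm _ _ cuv; rewrite hx hx' lee_fin => xx.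
  have := Gmm _ _ cuv; rewrite hy hy' lee_fin => yy.
  have := glip _ _ x0 xx; have := glip _ _ y0 yy; rewrite !ler_norml.
  move=> /andP[? ?] /andP[? ?].
  by split; rewrite ler_pM2r ?invr_gt0//; lra.
- move=> u v u0 v0; have [x0 _ _] := xP u; have [y0 _ _] := yP v.
  have [xy|/ltW yx] := leP (x u) (y v).
    left; rewrite siE; apply: le_trans (xal u) _.
    by have := glip _ _ x0 xy; rewrite ler_norml => /andP[? ?]; lra.
  right; rewrite alE; apply: le_trans (ysi v) _.
  by have := glip _ _ y0 yx; rewrite ler_norml => /andP[? ?]; lra.
- move=> u; rewrite ge_max => /andP[u1 uM].
  have Mcu : M < c * u.
    have : c * (M / c + 1) <= c * u by rewrite ler_pM2l.
    have -> : c * (M / c + 1) = M + c by field; apply/eqP; lra.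
    by lra.
  have [x0 _ hx] := xP u; have [y0 _ hy] := yP u.
  have := GV _ Mcu; rewrite hx hy -EFinD -EFinM lte_fin.
  have cu0 : 0 < c * u by apply: mulr_gt0; lra.
  rewrite ltr_pdivrMr// => h.
  have hV : V * (c * u) = ((1 + lam) * S - 2 * lam) * u.
    by rewrite /V /c; field; rewrite ?l1 ?l2.
  have h1 := xal u; have h2 := ysi u.
  have [e1 e2] := (alE u, siE u).
  have p1 : 0 < 1 + lam by lra.
  rewrite -(ler_pM2l p1).
  by rewrite hV in h; lra.
Qed.

End Offsets.

(** * The closed form for ratios at most 1 *)

Section ExplicitValue.
Local Open Scope classical_set_scope.
Variable R : realType.
Implicit Types (lam u v k S : R).

Lemma expr_unbounded k u : 1 < k -> exists n, u <= k ^+ n.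
Proof.
move=> k1; exists (Num.bound `|u / (k - 1)|).
have un : u <= (Num.bound `|u / (k - 1)|)%:R * (k - 1).
  rewrite -ler_pdivrMr; last by lra.
  exact: le_trans (ler_norm _) (ltW (archi_boundP (normr_ge0 _))).
apply: (le_trans un); elim: (Num.bound _) => [|n IH]; first by rewrite mul0r exprn_ge0; lra.
rewrite exprS -natr1.
have : 1 <= k ^+ n by rewrite exprn_ege1// ltW.
have : k * k ^+ n = k ^+ n + (k - 1) * k ^+ n by ring.
move=> -> kn; have : (k - 1) * 1 <= (k - 1) * k ^+ n by rewrite ler_wpM2l//; lra.
by lra.
Qed.

(** The scaling factor between successive corners of the optimal zigzag; it
    minimizes k (1 + k) / (lam k - 1), and its value there is k^2. *)
Definition zigzag_ratio lam : R := (Num.sqrt (1 + lam) - 1)^-1.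

Lemma zigzag_ratioP lam : 0 < lam -> lam <= 1 ->
  exists w, [/\ Num.sqrt (lam + 1) = w, 1 < w, w < 2, w ^+ 2 = 1 + lam & zigzag_ratio lam = (w - 1)^-1].
Proof.
move=> l0 l1; exists (Num.sqrt (1 + lam)).
have w2 : Num.sqrt (1 + lam) ^+ 2 = 1 + lam by rewrite sqr_sqrtr//; lra.
have w0 := sqrtr_ge0 (1 + lam); split => //; first by rewrite addrC.
- by rewrite ltNge; apply/negP => h; nra.
- by rewrite ltNge; apply/negP => h; nra.
Qed.

Lemma zigzag_ratio_eq lam : 0 < lam -> lam <= 1 ->
  1 < zigzag_ratio lam /\ lam * zigzag_ratio lam ^+ 2 = 2 * zigzag_ratio lam + 1.
Proof.
move=> l0 l1; have [w [_ w1 w2 wl ->]] := zigzag_ratioP l0 l1.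
split; first by rewrite -[X in X < _]invr1 ltf_pV2 ?posrE; lra.
have -> : lam = w ^+ 2 - 1 by lra.
by field; apply/eqP; lra.
Qed.

(** The zigzag runs alternately to the right at height k^(2i), up to the abscissa
    k^(2i+1), and upwards at this abscissa, up to the height k^(2i+2).  The run
    at k^i reaches the levels up to d k^(i+1), where d = 1 - 1/(lam k), so a
    level u between d k^n and d k^(n+1) is reached on the runs at k^n and at
    k^(n+1), whichever of the two directions they have. *)
Lemma walk_rate_upper lam : 0 < lam -> lam <= 1 -> walk_rate lam <= 2 + zigzag_ratio lam ^+ 2.
Proof.
move=> l0 l1; have [k1 kE] := zigzag_ratio_eq l0 l1; set k := zigzag_ratio lam in k1 kE *.
have k0 n : 0 < k ^+ n by rewrite exprn_gt0//; lra.
have kmon i j : (i <= j)%N -> k ^+ i <= k ^+ j by move=> ij; rewrite ler_weXn2l// ltW.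
pose P b r := exists i, [/\ r = k ^+ i.*2, 0 <= b & b <= k ^+ i.*2.+1].
pose P' b r := exists i, [/\ b = k ^+ i.*2.+1, 0 <= r & r <= k ^+ i.*2.+2].
have lk : 0 < lam * k by rewrite mulr_gt0//; lra.
have lk1 : 1 < lam * k.
  by rewrite -(@ltr_pM2r _ k); [rewrite mul1r -mulrA -expr2 kE; lra|lra].
pose d := 1 - (lam * k)^-1.
have d0 : 0 < d by rewrite subr_gt0 invf_lt1.
have ln0 : lam != 0 by apply/eqP; lra.
have kn0 : k != 0 by apply/eqP; lra.
have dE n : d * k ^+ n.+1 = k ^+ n.+1 - k ^+ n / lam.
  by rewrite exprS /d; field; rewrite ln0 kn0.
apply: (@walk_rate_le _ P P' _ _ (d * k)) => //.
- by move=> b r [i [-> b0 _]]; split=> //; apply: ltW.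
- by move=> b r [i [-> b0 _]]; split=> //; apply: ltW.
- move=> b r b' r' [i [-> _ bi]] [j [-> _ rj]].
  have [ij|ji] := leqP i j; [left|right].
    by apply: le_trans bi _; apply: kmon; rewrite ltnS leq_double.
  by apply: le_trans rj _; apply: kmon; rewrite -doubleS leq_double.
move=> u ud.
have u0 : 0 < u by apply: lt_le_trans ud; apply: mulr_gt0; lra.
have ex : exists n, u <= d * k ^+ n.+1.
  have [n hn] := expr_unbounded (u / d) k1; exists n.
  rewrite -ler_pdivrMl// mulrC (le_trans hn)// kmon//.
case: (ex_minnP ex) => n hn nmin.
have dn : d * k ^+ n < u.
  case: n hn nmin => [|n] hn nmin.
    by rewrite expr0 mulr1; apply: lt_le_trans ud; rewrite ltr_pMr.
  by rewrite ltNge; apply/negP => /nmin; rewrite ltnn.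
have hn1 : u + k ^+ n / lam <= k ^+ n.+1 by rewrite dE in hn; lra.
have hn2 : u + k ^+ n.+1 / lam <= k ^+ n.+2.
  have : d * k ^+ n.+1 <= d * k ^+ n.+2 by rewrite ler_pM2l// kmon.
  by rewrite [d * k ^+ n.+2]dE; lra.
have low m : 0 <= u + k ^+ m / lam by rewrite addr_ge0 ?divr_ge0// ltW.
have lamE m : k ^+ m <= lam * (u + k ^+ m / lam - u).
  by rewrite addrAC subrr add0r mulrC divfK.
have sum : (u + k ^+ n / lam) + (u + k ^+ n.+1 / lam) <= (2 + k ^+ 2) * u.
  have : k ^+ 2 * (d * k ^+ n) <= k ^+ 2 * u by rewrite ler_pM2l// ltW.
  have -> : k ^+ 2 * (d * k ^+ n) = k ^+ n * (lam * k ^+ 2 - k) / lam.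
    by rewrite /d; field; rewrite ln0 kn0.
  by rewrite kE (exprS k n) => h; move: h; rewrite (_ : k ^+ n * (2 * k + 1 - k) / lam =
       k ^+ n / lam + k * k ^+ n / lam); [lra|field].
have [no|ne] := boolP (odd n).
  have nE : n = n./2.*2.+1 by rewrite -[LHS]odd_double_half no.
  exists (u + k ^+ n.+1 / lam), (k ^+ n.+1), (k ^+ n), (u + k ^+ n / lam); split => //.
  - by exists n./2.+1; rewrite doubleS -nE.
  - by exists n./2; rewrite -nE.
  - by rewrite addrC.
have nE : n = n./2.*2 by rewrite -[LHS]odd_double_half (negPf ne).
exists (u + k ^+ n / lam), (k ^+ n), (k ^+ n.+1), (u + k ^+ n.+1 / lam); split => //.
- by exists n./2; rewrite -nE.
- by exists n./2; rewrite -nE.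
Qed.

(** At level w the walk hits the f-direction first.  Let w' be slightly larger
    than the last level hit in this direction before level w is hit in the
    other one.  Then w' is hit in the f-direction after that, which makes f(w') at
    least h(w), whereas w' <= lam h(w) - f(w) up to the factor (1+e)^2. *)
Lemma zigzag_step (f h : R -> R) lam e w : 0 < lam -> lam <= 1 -> 0 < e -> 0 < w ->
  (forall u v, 0 <= u -> u <= v -> f u <= f v) ->
  (forall u v, 0 <= u -> u <= v -> h u <= h v) -> (forall u, 0 <= u -> 0 <= f u) ->
  (forall u v, 0 <= u -> 0 <= v -> u + f u <= lam * h v \/ v + h v <= lam * f u) ->
  w + f w <= lam * h w ->
  exists w', [/\ w <= w', h w <= f w', h w <= h w' &
     w' <= (1 + e) ^+ 2 * (lam * h w - f w)].
Proof.
move=> l0 l1 e0 w0 fm hm f0 dich wU.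
pose U := [set u : R | 0 <= u /\ u + f u <= lam * h w].
have Uw : U w by split => //; exact: ltW.
have Usup : has_sup U.
  split; first by exists w.
  by exists (lam * h w) => u [u0 hu]; have := f0 u u0; lra.
have sw : w <= sup U by apply: ub_le_sup => //; case: Usup.
set s := sup U in sw *.
have s0 : 0 < s by lra.
have eps0 : 0 < s - s / (1 + e) by rewrite subr_gt0 ltr_pdivrMr; nra.
have [u [u0 hu] su] := sup_adherent eps0 Usup.
rewrite -/s in su.
have [v [[v0 hv] uv wv]] : exists v, [/\ U v, u <= v & w <= v].
  have [uw|wu] := leP u w; first by exists w.
  by exists u; split=> //; exact: ltW.
have vs : s <= (1 + e) * v.
  have : s / (1 + e) <= v by lra.
  by rewrite ler_pdivrMr; lra.
have ws : s < (1 + e) * s by nra.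
exists ((1 + e) * s); split.
- by lra.
- have : ~ U ((1 + e) * s).
    by move=> Us; have [_ ub] := Usup; have := ub_le_sup ub Us; rewrite -/s; lra.
  move=> nU; have [h1|h1] := dich ((1 + e) * s) w ltac:(lra) (ltW w0).
    by exfalso; apply: nU; split => //; lra.
  have : 0 <= f ((1 + e) * s) by apply: f0; lra.
  move=> h2; have h3 : lam * f ((1 + e) * s) <= f ((1 + e) * s) by rewrite ler_piMl.
  by apply: (le_trans _ h3); lra.
- by apply: hm; lra.
- have fv := fm _ _ (ltW w0) wv.
  have : (1 + e) * s <= (1 + e) * ((1 + e) * v) by rewrite ler_pM2l; lra.
  have : (1 + e) ^+ 2 * v <= (1 + e) ^+ 2 * (lam * h w - f w).
    by rewrite ler_wpM2l ?exprn_ge0; lra.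
  by rewrite expr2; lra.
Qed.

(** Suppose the offsets sum to at most S u with S < k^2.  For M and m the larger
    and the smaller offset, [zigzag_step] leads from a level w to a later level w'
    with m(w') >= M(w) and M(w') + m(w') <= S w' <= S1 (lam M(w) - m(w)).  The
    ratio x = M/m thus becomes at most S1 lam - 1 - S1/x, and since
    x + S1/x >= 2 sqrt(S1), it drops by at least c = 1 + 2 sqrt(S1) - lam S1.
    This c is positive exactly for sqrt(S1) < k, but the ratio never gets below 1. *)
Lemma walk_rate_lower lam : 0 < lam -> lam <= 1 -> 2 + zigzag_ratio lam ^+ 2 <= walk_rate lam.
Proof.
move=> l0 l1; have [k1 kE] := zigzag_ratio_eq l0 l1; set k := zigzag_ratio lam in k1 kE *.
rewrite leNgt; apply/negP => Dk.
pose S := (walk_rate lam + (2 + k ^+ 2)) / 2 - 2.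
have [DS Sk] : walk_rate lam < S + 2 /\ S < k ^+ 2 by rewrite /S; split; lra.
have [f [h [u0 [fh0 fhm dich bnd]]]] := offsets l0 DS.
have {}bnd u : u0 <= u -> f u + h u <= S * u by move=> /bnd; rewrite mulrDl; lra.
have f0 u : 0 <= u -> 0 <= f u by move=> /fh0[].
have h0 u : 0 <= u -> 0 <= h u by move=> /fh0[].
have fm u v : 0 <= u -> u <= v -> f u <= f v by move=> a b; have [] := fhm u v a b.
have hm u v : 0 <= u -> u <= v -> h u <= h v by move=> a b; have [] := fhm u v a b.
pose W0 := `|u0| + 1.
have [W01 W0u] : 1 <= W0 /\ u0 <= W0.
  by have := ler_norm u0; have := normr_ge0 u0; rewrite /W0; split; lra.
have ord w : 0 < w -> w + f w <= lam * h w \/ w + h w <= lam * f w.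
  by move=> w0; apply: dich; exact: ltW.
have S0 : 0 < S.
  have w0 : 0 < W0 by lra.
  have := bnd W0 W0u; have := f0 W0 (ltW w0); have := h0 W0 (ltW w0).
  by case: (ord W0 w0) => h1 h2 h3 h4; rewrite ltNge; apply/negP => h5; nra.
have [e [e0 eS]] : exists e, 0 < e /\ S * (1 + e) ^+ 2 < k ^+ 2.
  pose x := Num.min 1 ((k ^+ 2 - S) / (4 * S)).
  have x0 : 0 < x by rewrite lt_min ltr01 divr_gt0//; lra.
  have [x1 xS] : x <= 1 /\ 4 * S * x <= k ^+ 2 - S.
    by rewrite /x; split; [rewrite ge_min lexx|rewrite mulrC -ler_pdivlMr ?ge_min ?lexx ?orbT//; lra].
  by exists (x / 2); split; [lra|nra].
pose S1 := S * (1 + e) ^+ 2.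
have S10 : 0 < S1 by rewrite mulr_gt0// exprn_gt0//; lra.
pose sg := Num.sqrt S1.
have sg2 : sg ^+ 2 = S1 by rewrite sqr_sqrtr// ltW.
have sg0 : 0 < sg by rewrite sqrtr_gt0.
have sgk : sg < k by rewrite ltNge; apply/negP => hh; move: eS; rewrite -/S1 -sg2; nra.
pose c := 1 + 2 * sg - lam * S1.
have c0 : 0 < c.
  have k20 : 0 < k ^+ 2 by rewrite exprn_gt0//; lra.
  rewrite -(pmulr_rgt0 _ k20).
  (* This uses lam k^2 = 2k + 1. *)
  have -> : k ^+ 2 * c = (k - sg) * (k + (1 + 2 * k) * sg).
    rewrite /c -sg2 !mulrDr mulrN.
    by rewrite (_ : k ^+ 2 * (lam * sg ^+ 2) = (lam * k ^+ 2) * sg ^+ 2); [rewrite kE; ring|ring].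
  by apply: mulr_gt0; nra.
pose M w := Num.max (f w) (h w); pose m w := Num.min (f w) (h w).
have step w : W0 <= w -> exists w', [/\ w <= w', M w <= m w', 0 < M w,
    w' <= (1 + e) ^+ 2 * (lam * M w - m w) & M w' + m w' <= S * w'].
  move=> Ww; have w0 : 0 < w by lra.
  have MmS w' : w <= w' -> M w' + m w' <= S * w'.
    by move=> ww; rewrite /M /m addr_max_min; apply: bnd; lra.
  case: (ord w w0) => hw.
    have fw : f w <= h w by have := f0 w (ltW w0); nra.
    have hw0 : 0 < h w by have := f0 w (ltW w0); nra.
    have [w' [a1 a2 a3 a4]] := zigzag_step l0 l1 e0 w0 fm hm f0 dich hw.
    exists w'; rewrite /M /m (max_idPr fw) (min_idPl fw); split => //.
    - by rewrite le_min a2 a3.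
    - exact: MmS.
  have fw : h w <= f w by have := h0 w (ltW w0); nra.
  have hw0 : 0 < f w by have := h0 w (ltW w0); nra.
  have dich' u v : 0 <= u -> 0 <= v -> u + h u <= lam * f v \/ v + f v <= lam * h u.
    by move=> a b; have [] := dich v u b a; [right|left].
  have [w' [a1 a2 a3 a4]] := zigzag_step l0 l1 e0 w0 hm fm h0 dich' hw.
  exists w'; rewrite /M /m (max_idPl fw) (min_idPr fw); split => //.
  - by rewrite le_min a2 a3.
  - exact: MmS.
have [w1 [Ww1 Mw1 Mw0 _ _]] := step W0 (lexx _).
have m1 : 0 < m w1 by apply: lt_le_trans Mw1.
pose x0 := M w1 / m w1.
have desc N : exists w, [/\ W0 <= w, 0 < m w & M w <= (x0 - N%:R * c) * m w].
  elim: N => [|N [w [Ww mw Mx]]].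
    by exists w1; split=> //; rewrite mul0r subr0 divfK// gt_eqF.
  have [w' [ww' Mm M0 w'le MS]] := step w Ww.
  exists w'; split; [lra|lra|]; set x := x0 - N%:R * c in Mx.
  have -> : x0 - N.+1%:R * c = x - c by rewrite /x -natr1; ring.
  have x0' : 0 < x by rewrite -(pmulr_lgt0 _ mw); lra.
  have h1 : M w' <= S1 * (lam * M w - m w) - m w'.
    have : S * w' <= S * ((1 + e) ^+ 2 * (lam * M w - m w)) by rewrite ler_pM2l.
    by rewrite /S1 -!mulrA; lra.
  have h2 : M w / x <= m w by rewrite ler_pdivrMr// mulrC.
  have h3 : S1 * (lam * M w - m w) <= S1 * (lam - x^-1) * M w.
    by rewrite -mulrA ler_pM2l// mulrBl lerD2l lerN2 mulrC.
  have h4 : S1 * (lam - x^-1) <= x - c + 1.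
    have : 0 <= (x - sg) ^+ 2 / x by rewrite divr_ge0 ?sqr_ge0// ltW.
    have -> : (x - sg) ^+ 2 / x = x - 2 * sg + S1 / x.
      by rewrite -sg2; field; apply/eqP; lra.
    by rewrite /c; lra.
  have h5 : 0 < S1 * (lam * M w - m w).
    apply: mulr_gt0 => //; have p2 : 0 < (1 + e) ^+ 2 by rewrite exprn_gt0//; lra.
    by rewrite -(pmulr_rgt0 _ p2); lra.
  have h6 : 0 < x - c + 1.
    apply: lt_le_trans h4; rewrite -(pmulr_lgt0 _ M0); lra.
  have h7 : S1 * (lam - x^-1) * M w <= (x - c + 1) * m w'.
    apply: (@le_trans _ _ ((x - c + 1) * M w)); first by rewrite ler_pM2r.
    by rewrite ler_pM2l.
  by lra.
have [w [_ mw Mx]] := desc (Num.bound `|x0 / c|).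
have : `|x0 / c| < (Num.bound `|x0 / c|)%:R by apply: archi_boundP.
move: (_%:R) Mx => y Mx; have := ler_norm (x0 / c); move=> h1 h2.
have : x0 / c < y by lra.
rewrite ltr_pdivrMr// => h3.
have : m w <= M w by rewrite /m /M ge_min le_max lexx.
by nra.
Qed.

Lemma walk_rateE lam : 0 < lam -> lam <= 1 -> walk_rate lam = 2 + zigzag_ratio lam ^+ 2.
Proof.
by move=> l0 l1; apply/eqP; rewrite eq_le walk_rate_upper// walk_rate_lower.
Qed.

Lemma ramsey_fE lam : 0 < lam -> ramsey_f lam%:E = 1 - (walk_rate lam)^-1.
Proof. by move=> l0; rewrite /ramsey_f gt_eqF. Qed.

Lemma ramsey_f_closed lam : 0 < lam -> lam <= 1 ->
  ramsey_f lam%:E = (2 * lam ^+ 2 + 3 * lam + 7 + 2 * Num.sqrt (lam + 1))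
       / (4 * lam ^+ 2 + 4 * lam + 9).
Proof.
move=> l0 l1; rewrite ramsey_fE// walk_rateE//.
have [w [-> w1 w2 wl ->]] := zigzag_ratioP l0 l1.
have -> : lam = w ^+ 2 - 1 by lra.
field; apply/and3P; split; apply/eqP; nra.
Qed.

End ExplicitValue.

(** * Upper densities and limits of growing sequences *)

Section Density.
Local Open Scope classical_set_scope.
Variable R : realType.
Implicit Types (V : set nat) (l : R).

(** An additive error C disappears in the limit. *)
Lemma upper_density_le V l (C : R) (N : nat) :
  (forall n, (N <= n)%N -> (count (mem V) (iota 1 n))%:R <= l * n%:R + C) ->
  (upper_density R V <= l%:E)%E.
Proof.
move=> h; apply/lee_addgt0Pr => e e0; rewrite -EFinD.
pose N1 := maxn N (Num.bound `|C / e|).+1.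
apply: (@le_trans _ _ (ereal_sup
  ((fun n => ((count (mem V) (iota 1 n))%:R / n%:R)%:E : \bar R) @` [set n | (N1 <= n)%N]))).
  by apply: ereal_inf_lbound; exists [set n | (N1 <= n)%N] => //; exists N1.
apply: ge_ereal_sup => _ [n /= N1n <-].
have [Nn Cn] : (N <= n)%N /\ (Num.bound `|C / e| < n)%N.
  by move: N1n; rewrite geq_max => /andP[].
have n0 : 0 < n%:R :> R by rewrite ltr0n (leq_ltn_trans _ Cn).
rewrite lee_fin ler_pdivrMr// (le_trans (h n Nn))// mulrDl lerD2l.
rewrite mulrC -ler_pdivrMr//; apply: (le_trans (ler_norm _)).
by apply: ltW; apply: (lt_trans (archi_boundP (normr_ge0 _))); rewrite ltr_nat.
Qed.

Lemma upper_density_ge V l :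
  (forall N, exists n, (N <= n)%N /\ l * n%:R <= (count (mem V) (iota 1 n))%:R) ->
  (l%:E <= upper_density R V)%E.
Proof.
move=> h; apply: le_ereal_inf_tmp => _ [W [N _ NW] <-].
have [n [Nn hn]] := h N.+1.
apply: (@le_trans _ _ ((count (mem V) (iota 1 n))%:R / n%:R)%:E).
  by rewrite lee_fin ler_pdivlMr// ltr0n (leq_ltn_trans _ Nn).
by apply: ereal_sup_ubound; exists n => //; apply: NW; apply: ltnW.
Qed.

End Density.

(** Growing finite sequences have a common infinite extension; every infinite
    construction below is carried out by finite stages. *)
Lemma chain_limit (T : Type) (x0 : T) (s : nat -> seq T) :
  (forall k, exists w, s k.+1 = s k ++ w) -> (forall k, (k <= size (s k))%N) ->
  exists f : nat -> T, forall k, s k = mkseq f (size (s k)).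
Proof.
move=> chain sz; exists (fun i => nth x0 (s i.+1) i) => k.
have mono m d : exists w, s (m + d)%N = s m ++ w.
  elim: d => [|d [w IH]]; first by exists [::]; rewrite addn0 cats0.
  by have [w' hw'] := chain (m + d)%N; exists (w ++ w'); rewrite addnS hw' IH catA.
apply: (@eq_from_nth _ x0); first by rewrite size_mkseq.
move=> i ik; rewrite nth_mkseq//.
have [w1 h1] := mono k i.+1; have [w2 h2] := mono i.+1 k.
have := congr1 (fun l => nth x0 l i) h1; rewrite nth_cat ik => <-.
by rewrite addnC h2 nth_cat sz.
Qed.

(** Any two nondecreasing counting functions are realized by appending, at each
    stage, the missing vertices of one color and then those of the other. *)
Lemma two_colored_sequence (N : bool -> nat -> nat) :
  (forall i s, (N i s <= N i s.+1)%N) -> (forall s, (s <= N true s + N false s)%N) ->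
  exists col : nat -> bool, forall i s,
    count (fun v => col v == i) (iota 1 (N true s + N false s)) = N i s.
Proof.
move=> mono sN.
pose fix W s := if s is s'.+1
  then W s' ++ nseq (N true s'.+1 - N true s') true ++ nseq (N false s'.+1 - N false s') false
  else nseq (N true 0%N) true ++ nseq (N false 0%N) false.
have cW i s : count (fun b => b == i) (W s) = N i s.
  elim: s => [|s IH] /=.
    by rewrite count_cat !count_nseq; case: i => /=; lia.
  rewrite !count_cat IH !count_nseq; have := mono i s.
  by case: i {IH} => /=; lia.
have sW s : size (W s) = (N true s + N false s)%N.
  rewrite -(cW true) -(cW false) -(count_predC (fun b => b == true)).
  by congr addn; apply: eq_count; case.
have [||f Hf] := @chain_limit bool true W.
- by move=> k; eexists.
- by move=> k; rewrite sW.
exists (fun v => f v.-1) => i s.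
rewrite -(cW i s) [in RHS](Hf s) /mkseq sW (iotaDl 1 0) !count_map.
by apply: eq_count.
Qed.

(** * The coloring attached to a walk *)

Section UpperBound.
Local Open Scope classical_set_scope.
Variable R : realType.

(** The part of C in each copy is independent, so its neighborhood is at least
    lam times as large, and all these neighborhoods are disjoint and consist of
    near vertices. *)
Lemma few_independent_copies (F : fin_graph) (lam : R) (phi : nat * F -> nat)
    (near : nat -> bool) (C : seq nat) (X : R) :
  injective phi -> 0 < lam ->
  (forall J : {set F}, independent J -> lam * #|J|%:R <= #|neighborhood J|%:R) ->
  uniq C -> (forall v, v \in C -> exists p, phi p = v) ->
  (forall p q, adj (g := omega F) p q -> phi p \in C -> near (phi q) /\ phi q \notin C) ->
  (forall W, uniq W -> all near W -> (size W)%:R <= lam * X) ->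
  (size C)%:R <= X.
Proof.
move=> phiI l0 Fexp uC Cphi Cadj Wsmall.
have [K HK] : exists K, forall v, v \in C -> exists k x, (k < K)%N /\ phi (k, x) = v.
  elim: C {uC Cadj} Cphi => [|v C IH] Cphi; first by exists 0%N.
  have [|K HK] := IH; first by move=> u uC; apply: Cphi; rewrite inE uC orbT.
  have [[k x] kx] := Cphi v (mem_head _ _); exists (maxn K k.+1) => u.
  rewrite inE => /orP[/eqP ->|/HK[k' [x' [k'K e]]]].
    by exists k, x; split => //; rewrite leq_max leqnn orbT.
  by exists k', x'; split => //; rewrite leq_max k'K.
pose J k := [set x | phi (k, x) \in C]%SET.
pose all_of (G : nat -> {set F}) := [seq phi (k, x) | k <- iota 0 K, x <- enum (G k)].
have size_all G : size (all_of G) = (\sum_(k <- iota 0 K) #|G k|)%N.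
  by rewrite size_allpairs_dep sumnE big_map; apply: eq_bigr => k _; rewrite -cardE.
have CJ : (size C <= \sum_(k <- iota 0 K) #|J k|)%N.
  rewrite -size_all; apply: uniq_leq_size => // v vC.
  have [k [x [kK kx]]] := HK v vC; apply/allpairsPdep; exists k, x.
  by rewrite mem_iota mem_enum inE kx.
have uW : uniq (all_of (fun k => neighborhood (J k))).
  apply: allpairs_uniq_dep; [exact: iota_uniq|by move=> k _; exact: enum_uniq|].
  by move=> [k x] [k' x'] _ _ /= /phiI [-> ->].
have nW : all near (all_of (fun k => neighborhood (J k))).
  apply/allP => _ /allpairsPdep[k [x [_ + ->]]].
  rewrite mem_enum inE => /andP[_ /bigcupP[y yJ]]; rewrite inE => yx.
  by have [] := Cadj (k, y) (k, x); rewrite // inE in yJ.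
have := Wsmall _ uW nW; rewrite size_all => h.
rewrite -(ler_pM2l l0); apply: le_trans h.
rewrite (le_trans (_ : _ <= lam * (\sum_(k <- iota 0 K) #|J k|)%:R))//.
  by rewrite ler_pM2l// ler_nat.
rewrite !natr_sum big_distrr /=; apply: ler_sum => k _; apply: Fexp.
apply/forall_inP => x; rewrite inE => xC; apply/forall_inP => y; rewrite inE => yC.
apply/negP => xy; have [_] := Cadj (k, x) (k, y) (conj erefl xy) xC.
by rewrite yC.
Qed.

(** [off true] and [off false] are the offsets of blue and red.  Both colors are
    treated at once: in color i, a vertex of the other color j is adjacent only
    to vertices w of color i with tau(w) + off_i(tau w) <= lam off_j(tau v), and
    there are few of these. *)
Lemma upper_coloring (off : bool -> nat -> R) (lam S : R) s0 : 0 < lam ->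
  (forall i s, 0 <= off i s) ->
  (forall i s t, (s <= t)%N -> off i s <= off i t) ->
  (forall i s t, s%:R + off i s <= lam * off (~~ i) t \/
                 t%:R + off (~~ i) t <= lam * off i s) ->
  (forall s, (s0 <= s)%N -> 2 * s%:R + off true s + off false s <= S * s%:R) ->
  exists2 c : nat -> nat -> bool, symmetric c &
  forall (F : fin_graph) H',
    (forall J : {set F}, independent J -> lam * #|J|%:R <= #|neighborhood J|%:R) ->
    monochromatic c H' -> isomorphic (omega F) H' ->
    (upper_density R (svertex H') <= (1 - S^-1)%:E)%E.
Proof.
move=> l0 off0 offm dich bnd.
pose N i s := Num.truncn (s%:R + off i s).
have so0 i s : 0 <= s%:R + off i s by rewrite addr_ge0.
have Nle i s : (N i s)%:R <= s%:R + off i s by rewrite truncn_le.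
have Nge i s : s%:R + off i s < (N i s)%:R + 1 by rewrite natr1 truncnS_gt.
have Nm i s t : (s <= t)%N -> (N i s <= N i t)%N.
  by move=> st; apply: le_truncn; rewrite lerD ?offm ?ler_nat.
have sN i s : (s <= N i s)%N by rewrite truncn_ge_nat// lerDl.
pose n s := (N true s + N false s)%N.
have nm s t : (s <= t)%N -> (n s <= n t)%N by move=> st; rewrite leq_add ?Nm.
have sn s : (s <= n s)%N by rewrite (leq_trans (sN true s))// leq_addr.
have [||col Hcol] := @two_colored_sequence N.
- by move=> i s; apply: Nm.
- exact: sn.
(* The time of v is the first stage at which it is present. *)
pose tau v := ex_minn (ex_intro (fun s => v <= n s)%N v (sn v)).
have tauP v s : (tau v <= s)%N = (v <= n s)%N.
  rewrite /tau; case: ex_minnP => t vt tmin; apply/idP/idP => [ts|]; last exact: tmin.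
  by apply: (leq_trans vt); apply: nm.
pose bef r b := (tau r)%:R + off false (tau r) <= lam * off true (tau b).
pose c v w := if col v == col w then col v else
  if col v then ~~ bef w v else ~~ bef v w.
have csym : symmetric c.
  by move=> v w; rewrite /c eq_sym; case: (col v); case: (col w).
exists c => // F H' Fexp [i Hi] [phi [[phiV phiI phiS] phiA]].
have {}phiI : injective phi by move=> p q; apply: phiI; rewrite inE.
set V := svertex H'; pose j := ~~ i.
have adjP v w : sadj H' w v -> col v = j ->
    col w = i /\ (tau w)%:R + off i (tau w) <= lam * off j (tau v).
  move=> /Hi + vj; rewrite /c vj /j; case: (col w); case: (i) => //=.
  - move=> nb; split=> //; have [//|h] := dich true (tau w) (tau v).
    by rewrite /bef h in nb.
  - by move=> /negbFE.
have small s W : uniq W ->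
    all (fun w => [&& (0 < w)%N, col w == i & ((tau w)%:R + off i (tau w) <= lam * off j s)]) W ->
    (size W)%:R <= lam * off j s.
  have [->|W0] := eqVneq W [::]; first by move=> _ _; rewrite mulr_ge0// ltW.
  move=> uW /allP aW.
  have [w wW wmax] : exists2 w, w \in W & forall v, v \in W -> (tau v <= tau w)%N.
    elim: W W0 {uW aW} => // v W IH _.
    have [->|/IH[w wW wmax]] := eqVneq W [::].
      by exists v; [exact: mem_head|move=> u; rewrite inE => /eqP ->].
    have [vw|wv] := leqP (tau v) (tau w).
      by exists w; [rewrite inE wW orbT|move=> u; rewrite inE => /orP[/eqP ->|/wmax]].
    exists v; [exact: mem_head|move=> u; rewrite inE => /orP[/eqP -> //|/wmax h]].
    by rewrite (leq_trans h)// ltnW.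
  have /and3P[_ _ h] := aW w wW; apply: le_trans h; apply: le_trans (Nle i (tau w)).
  rewrite ler_nat -(Hcol i) -size_filter; apply: uniq_leq_size => // v vW.
  have /and3P[v0 vi _] := aW v vW.
  by rewrite mem_filter vi mem_iota v0 add1n ltnS -tauP wmax.
(* Of the s + off_j(s) vertices of color j up to time s (rounded down), at most
   off_j(s) are covered. *)
have uncovered s : s%:R - 1 <= (count (predC (mem V)) (iota 1 (n s)))%:R :> R.
  pose C := [seq v <- iota 1 (n s) | (v \in V) && (col v == j)].
  have CP v : v \in C -> [/\ V v, col v = j & (tau v <= s)%N].
    rewrite mem_filter mem_iota add1n ltnS -tauP => /andP[/andP[vV /eqP vj] /andP[_ h]].
    by split=> //; rewrite inE in vV.
  have Csz : (size C)%:R <= off j s.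
    apply: (@few_independent_copies F lam phi (fun w =>
      [&& (0 < w)%N, col w == i & ((tau w)%:R + off i (tau w) <= lam * off j s)])) => //.
    - by rewrite filter_uniq// iota_uniq.
    - by move=> v /CP[/phiS[p _ <-]]; exists p.
    - move=> p q pq /CP[vV vj vs].
      have qp : sadj H' (phi q) (phi p) by apply: sadj_sym; rewrite -phiA.
      have [qi qle] := adjP _ _ qp vj; split.
        apply/and3P; split; first by apply: (@svertex_pos H'); apply: (sadj_vertex qp).1.
          by rewrite qi.
        by apply: le_trans qle _; rewrite ler_wpM2l ?offm// ltW.
      by apply/negP => /CP[_ qj _]; move: qi; rewrite qj /j; case: (i).
    - by move=> W uW aW; apply: small.
  have : (N j s <= size C + count (predC (mem V)) (iota 1 (n s)))%N.
    rewrite -(Hcol j) size_filter.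
    rewrite -(count_predUI (fun v => (v \in V) && (col v == j))).
    apply: leq_trans (leq_addr _ _); apply: sub_count => v /= ->.
    by case: (v \in V).
  rewrite -(ler_nat R) natrD; have := Nge j s; lra.
have S2 : 2 <= S.
  have := bnd s0.+1 (leqnSn _); have := off0 true s0.+1; have := off0 false s0.+1.
  move=> h1 h2 h3; rewrite -(ler_pM2r (_ : 0 < s0.+1%:R)); [lra|by rewrite ltr0n].
apply: (@upper_density_le _ _ _ 2 (n s0)) => m nm0.
have [s [ss0 sm ms]] : exists s, [/\ (s0 <= s)%N, (n s <= m)%N & (m < n s.+1)%N].
  have ex : exists s, (m < n s)%N by exists m.+1; apply: sn.
  case: (ex_minnP ex) => -[|s] hs smin.
    by have := leq_ltn_trans nm0 hs; rewrite ltnNge nm.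
  exists s; split => //.
    have := leq_ltn_trans nm0 hs; rewrite ltnNge => h; rewrite leqNgt; apply: contra h.
    by move=> h; apply: nm.
  by rewrite leqNgt; apply/negP => /smin; rewrite ltnn.
have h1 : (count (mem V) (iota 1 m) + count (predC (mem V)) (iota 1 (n s)) <= m)%N.
  rewrite -[leqRHS](size_iota 1) -(count_predC (mem V)) leq_add2l.
  by rewrite -(subnKC sm) iotaD count_cat leq_addr.
have h2 : m%:R <= S * (s%:R + 1) :> R.
  have : m%:R <= (n s.+1)%:R :> R by rewrite ler_nat ltnW.
  have := bnd s.+1 (leqW ss0); have := Nle true s.+1; have := Nle false s.+1.
  by rewrite /n natrD -natr1; lra.
move: h1; rewrite -(ler_nat R) natrD; have := uncovered s.
have : m%:R / S <= s%:R + 1 by rewrite ler_pdivrMr; lra.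
by lra.
Qed.

End UpperBound.

(** * Monochromatic copies from partial copies *)

Section Embedding.
Local Open Scope nat_scope.
Variables (F : fin_graph) (A : {set F}).
Hypotheses (indA : independent A) (indAc : independent (~: A)%SET).
Variables (c : nat -> nat -> bool) (i : bool) (cl : pred nat).
Hypotheses (csym : symmetric c) (cl_inf : forall N, exists2 w, N < w & cl w)
  (cl_nbr : forall vs, all cl vs -> forall N, exists2 w, N < w &
     forall v, v \in vs -> c v w = i).

(** An embedding of a part of F that extends to all of F: vertices outside A go
    to the class cl, which has common neighbors, and a vertex of A is only placed
    together with all its neighbors. *)
Definition partial_copy (P : {set F} * (F -> nat)) :=
  [/\ {in P.1 &, injective P.2}, {in P.1, forall x, 0 < P.2 x},
      forall x, x \in P.1 -> x \notin A -> cl (P.2 x) &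
      forall x y, x \in P.1 -> x \in A -> fadj x y ->
        y \in P.1 /\ c (P.2 x) (P.2 y) = i].

Definition copy (f : F -> nat) :=
  [/\ injective f, forall x, 0 < f x & forall x y, fadj x y -> c (f x) (f y) = i].

Lemma sides x y : fadj x y -> (x \in A) = (y \notin A).
Proof.
move=> xy; have [xA|xA] := boolP (x \in A); have [yA|yA] := boolP (y \in A) => //.
  by have /forall_inP/(_ x xA)/forall_inP/(_ y yA) := indA; rewrite xy.
have xA' : x \in (~: A)%SET by rewrite inE.
have yA' : y \in (~: A)%SET by rewrite inE.
by have /forall_inP/(_ x xA')/forall_inP/(_ y yA') := indAc; rewrite xy.
Qed.

Lemma unbounded_injection (Q : nat -> Prop) :
  (forall N, exists2 w, N < w & Q w) ->
  forall N, exists2 f : nat -> nat, injective f & forall k, N < f k /\ Q (f k).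
Proof.
move=> Qinf N.
have /choice[next Hnext] : forall m, exists w, m < w /\ Q w.
  by move=> m; have [w] := Qinf m; exists w.
have incr k : iter k.+1 next N < iter k.+2 next N by have [] := Hnext (iter k.+1 next N).
exists (fun k => iter k.+1 next N).
  have homo := homo_ltn ltn_trans incr.
  move=> k l kl; have [kl'|lk|//] := ltngtP k l.
    by have := homo _ _ kl'; rewrite kl ltnn.
  by have := homo _ _ lk; rewrite kl ltnn.
move=> k; split; last by have [] := Hnext (iter k next N).
elim: k => [|k IH]; first by have [] := Hnext N.
exact: ltn_trans IH (incr k).
Qed.

Lemma seq_bounded (U : seq nat) : exists N, forall v, v \in U -> v <= N.
Proof.
by exists (\max_(v <- U) v) => v vU; apply: (@leq_bigmax_seq _ U xpredT id).
Qed.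

(** First place the remaining vertices outside A at large elements of cl, and then
    those of A at still larger common neighbors of everything outside A. *)
Lemma complete_copy P (U : seq nat) : partial_copy P ->
  exists f, [/\ copy f, forall x, x \in P.1 -> f x = P.2 x &
                forall x, x \notin P.1 -> f x \notin U].
Proof.
move=> [Pinj Ppos Pcl Padj].
have [N0 HN0] := seq_bounded (U ++ [seq P.2 x | x <- enum F]).
have PN x : P.2 x <= N0 by apply: HN0; rewrite mem_cat map_f ?orbT// mem_enum.
have [f1 f1I f1P] := unbounded_injection cl_inf N0.
have [N1 HN1] := seq_bounded (N0 :: [seq f1 (enum_rank (x : F)) | x <- enum F]).
have f1N (x : F) : f1 (enum_rank x) <= N1.
  by apply: HN1; rewrite in_cons; apply/orP; right; apply/mapP; exists x; rewrite ?mem_enum.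
have N01 : N0 <= N1 by apply: HN1; rewrite mem_head.
pose g x := if x \in P.1 then P.2 x else f1 (enum_rank x).
have gcl : all cl [seq g x | x <- enum (~: A)%SET].
  apply/allP => _ /mapP[x + ->]; rewrite mem_enum inE /g => xA.
  by case: ifP => [xP|_]; [apply: Pcl|have [] := f1P (enum_rank x)].
have [f2 f2I f2P] := unbounded_injection (cl_nbr gcl) N1.
pose f x := if x \in P.1 then P.2 x else
  if x \in A then f2 (enum_rank x) else f1 (enum_rank x).
have f1N0 (x : F) : N0 < f1 (enum_rank x) by have [] := f1P (enum_rank x).
have f2N1 (x : F) : N1 < f2 (enum_rank x) by have [] := f2P (enum_rank x).
have hN0 (x : F) : N0 < if x \in A then f2 (enum_rank x) else f1 (enum_rank x).
  by case: (x \in A); [apply: leq_ltn_trans N01 _|].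
have rk (x y : F) : enum_rank x = enum_rank y :> nat -> x = y.
  by move=> /val_inj/enum_rank_inj.
exists f; split; last first.
- move=> x xP; rewrite /f (negPf xP); apply/negP => xU.
  have := HN0 (if x \in A then f2 (enum_rank x) else f1 (enum_rank x)).
  by rewrite mem_cat xU => /(_ isT); rewrite leqNgt hN0.
- by move=> x xP; rewrite /f xP.
split.
- move=> x y; rewrite /f.
  case: (boolP (x \in P.1)) => xP; case: (boolP (y \in P.1)) => yP.
  + exact: Pinj.
  + by move=> e; have := PN x; rewrite e leqNgt hN0.
  + by move=> e; have := PN y; rewrite -e leqNgt hN0.
  + case: (x \in A); case: (y \in A).
    * by move=> /f2I/rk.
    * by move=> e; have := f1N y; rewrite -e leqNgt f2N1.
    * by move=> e; have := f1N x; rewrite e leqNgt f2N1.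
    * by move=> /f1I/rk.
- move=> x; rewrite /f; case: (boolP (x \in P.1)) => xP; first exact: Ppos.
  exact: leq_ltn_trans (hN0 x).
have main x y : x \in A -> fadj x y -> c (f x) (f y) = i.
  move=> xA xy; have yA : y \notin A by rewrite -(sides xy).
  have [xP|xP] := boolP (x \in P.1).
    by have [yP e] := Padj x y xP xA xy; rewrite /f xP yP.
  have -> : f x = f2 (enum_rank x) by rewrite /f (negPf xP) xA.
  have -> : f y = g y by rewrite /f /g (negPf yA).
  rewrite csym; have [_] := f2P (enum_rank x); apply.
  by rewrite map_f// mem_enum inE.
move=> x y xy; have [xA|xA] := boolP (x \in A); first exact: main.
rewrite csym; apply: main; last by rewrite fadj_sym.
by have := sides xy; rewrite (negPf xA); case: (y \in A).
Qed.

Definition disjoint_copies (f g : F -> nat) := [forall x, forall y, f x != g y].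

Definition partial_family (J : finType) (P : J -> {set F} * (F -> nat)) :=
  (forall j, partial_copy (P j)) /\
  (forall j k x y, j != k -> x \in (P j).1 -> y \in (P k).1 -> (P j).2 x != (P k).2 y).

(** The partial copies are completed one at a time; each completion avoids U, the
    other partial copies and all completions made so far. *)
Lemma complete_family (J : finType) (P : J -> {set F} * (F -> nat)) (U : seq nat) :
  partial_family P -> (forall j x, x \in (P j).1 -> (P j).2 x \notin U) ->
  exists f : J -> F -> nat, [/\ forall j, copy (f j),
    forall j x, x \in (P j).1 -> f j x = (P j).2 x,
    forall j x, f j x \notin U &
    forall j k, j != k -> disjoint_copies (f j) (f k)].
Proof.
move=> [Pp Pd] PU.
pose im := [seq (P j).2 x | j <- enum J, x <- enum (P j).1].
have imP j x : x \in (P j).1 -> (P j).2 x \in im.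
  move=> xP; apply/allpairsPdep; exists j, x.
  by rewrite !mem_enum.
suff H (s : seq J) : uniq s -> exists f : J -> F -> nat, [/\ forall j, j \in s -> copy (f j),
    forall j x, j \in s -> x \in (P j).1 -> f j x = (P j).2 x,
    forall j x, j \in s -> f j x \notin U,
    forall j x, j \in s -> x \notin (P j).1 -> f j x \notin im &
    forall j k, j \in s -> k \in s -> j != k -> disjoint_copies (f j) (f k)].
  have [f [h1 h2 h3 _ h4]] := H (enum J) (enum_uniq _).
  by exists f; split => [j|j x|j x|j k]; [apply: h1|apply: h2|apply: h3|apply: h4];
    rewrite ?mem_enum.
elim: s => [|j s IH] /=; first by exists (fun _ _ => 0).
move=> /andP[js /IH[f [fc fP fU fim fd]]].
pose U' := U ++ im ++ [seq f k x | k <- s, x <- enum F].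
have [g [gc gP gU']] := complete_copy U' (Pp j).
have gU x : x \notin (P j).1 -> [/\ g x \notin U, g x \notin im &
    forall k y, k \in s -> g x != f k y].
  move=> /gU'; rewrite !mem_cat !negb_or => /and3P[h1 h2 h3]; split => // k y ks.
  apply: contra h3 => /eqP ->; apply/allpairsPdep; exists k, y.
  by rewrite ks mem_enum.
have gf k x y : k \in s -> g x != f k y.
  move=> ks; have [xP|/gU[_ _]] := boolP (x \in (P j).1); last exact.
  rewrite gP//; have [yP|yP] := boolP (y \in (P k).1).
    by rewrite fP//; apply: Pd => //; apply: contraNneq js => ->.
  by apply: contraNneq (fim k y ks yP) => <-; apply: imP.
exists (fun k => if k == j then g else f k); split.
- by move=> k; rewrite inE; case: eqP => //= _; apply: fc.
- move=> k x; rewrite inE; case: eqP => [->|] //= _; [exact: gP|exact: fP].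
- move=> k x; rewrite inE; case: eqP => [->|] //= _; last exact: fU.
  have [xP|/gU[]//] := boolP (x \in (P j).1).
  by rewrite gP// PU.
- move=> k x; rewrite inE; case: eqP => [->|] //= _; last exact: fim.
  by move=> /gU[].
- move=> k l; rewrite !inE; case: eqP => [->|kj]; case: eqP => [->|lj] //=.
  + by rewrite eqxx.
  + by move=> _ ls _; apply/forallP => x; apply/forallP => y; apply: gf.
  + by move=> ks _ _; apply/forallP => x; apply/forallP => y; rewrite eq_sym; apply: gf.
  + exact: fd.
Qed.

End Embedding.

Section DenseCopy.
Local Open Scope classical_set_scope.
Variable R : realType.
Variables (F : fin_graph) (A : {set F}).
Hypotheses (indA : independent A) (indAc : independent (~: A)%SET).
Variables (c : nat -> nat -> bool) (i : bool) (cl : pred nat).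
Hypotheses (csym : symmetric c) (cl_inf : forall N, exists2 w, (N < w)%N & cl w)
  (cl_nbr : forall vs, all cl vs -> forall N, exists2 w, (N < w)%N &
     forall v, v \in vs -> c v w = i).

Definition covered (J : finType) (P : J -> {set F} * (F -> nat)) (v : nat) :=
  [exists j, exists x, (x \in (P j).1) && ((P j).2 x == v)].

(** The bound M keeps the partial copies away from the copies built before; no
    density is lost, because n can be taken large with respect to M. *)
Definition good_prefix (l : R) (M n : nat) :=
  exists (J : finType) (P : J -> {set F} * (F -> nat)),
    [/\ partial_family A c i cl P,
        forall j x, x \in (P j).1 -> (M < (P j).2 x)%N &
        l * n%:R <= (count (covered P) (iota 1 n))%:R].

Let valid (s : seq (F -> nat)) :=
  all (fun f => `[< copy c i f >]) s && pairwise (@disjoint_copies F) s.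

Let range_of (s : seq (F -> nat)) (v : nat) := has (fun f => [exists x, f x == v]) s.

Lemma extend_copies l s k : valid s -> (forall M N, exists2 n, (N <= n)%N & good_prefix l M n) ->
  exists w, [/\ (0 < size w)%N, valid (s ++ w) &
    exists2 n, (k <= n)%N & l * n%:R <= (count (range_of (s ++ w)) (iota 1 n))%:R].
Proof.
move=> /andP[/allP sc sd] good.
pose U := [seq (f : F -> nat) x | f <- s, x <- enum F].
have [M HM] := seq_bounded U.
have [n kn [J [P [[Pp Pd] PM cov]]]] := good M k.
(* The additional, empty partial copy ensures that the sequence really grows. *)
pose P' (j : option J) := if j is Some j then P j else (finset.set0, fun=> 0%N).
have fP' : partial_family A c i cl P'.
  split.
    by case=> [j|] //=; split=> [x y|x|x|x y]; rewrite /= inE.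
  by case=> [j|] [k'|] x y //=; rewrite ?inE// => jk; apply: Pd; apply: contra jk => /eqP ->.
have [|f [fc fP fU fd]] := complete_family indA indAc csym cl_inf cl_nbr (U := U) fP'.
  case=> [j|] x /=; last by rewrite inE.
  by move=> /PM; rewrite ltnNge; apply: contra => /HM.
exists [seq f j | j <- enum {: option J}]; split.
- by rewrite size_map -cardE card_option.
- apply/andP; split.
    rewrite all_cat; apply/andP; split; first by apply/allP.
    by rewrite all_map; apply/allP => j _ /=; apply/asboolP.
  rewrite pairwise_cat sd /=; apply/andP; split.
    apply/allrelP => g h gs /mapP[j _ ->]; apply/forallP => x; apply/forallP => y.
    apply: contra (fU j y) => /eqP <-; apply/allpairsPdep; exists g, x.
    by rewrite gs mem_enum.
  rewrite pairwise_map; have := enum_uniq {: option J}; rewrite uniq_pairwise.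
  by apply: sub_pairwise => j k' /=; apply: fd.
exists n => //; apply: le_trans cov _; rewrite ler_nat; apply: sub_count => v.
move=> /existsP[j /existsP[x /andP[xP /eqP <-]]]; rewrite /range_of has_cat.
apply/orP; right; rewrite has_map; apply/hasP; exists (Some j); rewrite ?mem_enum//=.
by apply/existsP; exists x; rewrite (fP (Some j)).
Qed.

(** Infinitely many finite stages, at each of which the copies cover a proportion
    l of a longer prefix. *)
Lemma dense_monochromatic_copy l :
  (forall M N, exists2 n, (N <= n)%N & good_prefix l M n) ->
  exists H', [/\ monochromatic c H', isomorphic (omega F) H' &
     (l%:E <= upper_density R (svertex H'))%E].
Proof.
move=> good.
have /choice[g Hg] : forall p : seq (F -> nat) * nat, exists w, valid p.1 ->
    [/\ (0 < size w)%N, valid (p.1 ++ w) & exists2 n, (p.2 <= n)%N &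
        l * n%:R <= (count (range_of (p.1 ++ w)) (iota 1 n))%:R].
  move=> [s k] /=; have [vs|vs] := boolP (valid s); last by exists [::].
  by have [w hw] := extend_copies k vs good; exists w.
pose fix S k := if k is k'.+1 then S k' ++ g (S k', k') else [::].
have Sv k : valid (S k).
  by elim: k => //= k IH; have [_] := Hg (S k, k) IH.
have Ssz k : (k <= size (S k))%N.
  elim: k => //= k IH; rewrite size_cat.
  by have [h _ _] := Hg (S k, k) (Sv k); lia.
have [|f Hf] := @chain_limit _ (fun=> 0%N) S _ Ssz.
  by move=> k; exists (g (S k, k)).
have fc k : copy c i (f k).
  have /andP[/allP h _] := Sv k.+1; apply/asboolP/h; rewrite (Hf k.+1).
  by apply: map_f; rewrite mem_iota add0n; apply: Ssz.
have fd_lt k k' x y : (k < k')%N -> f k x != f k' y.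
  move=> kk'; have /andP[_ /(pairwiseP (fun=> 0%N)) h] := Sv k'.+1.
  have k'S : (k' < size (S k'.+1))%N by apply: Ssz.
  have kS : (k < size (S k'.+1))%N by apply: ltn_trans kk' k'S.
  have := h k k'; rewrite !inE => /(_ kS k'S kk').
  rewrite (Hf k'.+1) !nth_mkseq//.
  by move=> /forallP/(_ x)/forallP/(_ y).
have fd k k' x y : f k x = f k' y -> k = k'.
  move=> e; have [kk|kk|//] := ltngtP k k'.
    by have := fd_lt k k' x y kk; rewrite e eqxx.
  by have := fd_lt k' k y x kk; rewrite e eqxx.
pose phi (p : omega F) := f p.1 p.2.
have phiI : injective phi.
  move=> [k x] [k' y]; rewrite /phi /= => e; have kk := fd _ _ _ _ e.
  by subst k'; congr pair; have [fI _ _] := fc k; apply: fI.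
have Hpos v : range phi v -> (0 < v)%N.
  by move=> [[k x] _ <-]; have [_ h _] := fc k; apply: h.
pose ad (a b : nat) := exists p q, [/\ omega_adj p q, phi p = a & phi q = b].
have ad1 a b : ad a b -> range phi a /\ range phi b.
  by move=> [p [q [_ <- <-]]]; split; [exists p|exists q].
have ad2 a b : ad a b -> ad b a.
  by move=> [p [q [pq <- <-]]]; exists q, p; split => //; apply: omega_adj_sym.
have ad3 a : ~ ad a a.
  by move=> [p [q [pq <- /phiI qp]]]; move: pq; rewrite qp; apply: omega_adj_irr.
exists (SubgraphKN Hpos ad1 ad2 ad3); split.
- exists i => _ _ [[k x] [[k' y] [[/= kk xy] <- <-]]]; rewrite /phi /= -kk.
  by have [_ _ h] := fc k; apply: h.
- exists phi; split.
    split; first by move=> p _; exists p.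
      by move=> p q _ _; apply: phiI.
    by move=> v [p _ <-]; exists p.
  move=> p q; split; first by move=> pq; exists p, q.
  by move=> [p' [q' [pq /phiI <- /phiI <-]]].
- apply: upper_density_ge => N.
  have [_ _ [n Nn hn]] := Hg (S N, N) (Sv N).
  exists n; split=> //; apply: le_trans hn _; rewrite ler_nat; apply: sub_count => v.
  rewrite -[_ ++ _]/(S N.+1) (Hf N.+1) /range_of has_map => /hasP[k _ /existsP[x /eqP <-]].
  by rewrite /= inE; exists (k, x).
Qed.

End DenseCopy.

(** * Colors of vertices and tilings of prefixes *)

Section VertexColors.
Local Open Scope classical_set_scope.

(** The color of v is the one of almost all edges at v, with respect to a
    nonprincipal ultrafilter. *)
Lemma ultrafilter_colors (c : nat -> nat -> bool) :
  exists col : nat -> bool, forall i vs, all (fun v => col v == i) vs ->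
    forall N, exists2 w, (N < w)%N & forall v, v \in vs -> c v w = i.
Proof.
have [U [UU oU]] := ultraFilterLemma (@eventually_filter).
have UF : ProperFilter U := @ultra_proper _ _ UU.
pose col v := `[< U [set w | c v w = true] >].
have Ucol v : U [set w | c v w = col v].
  rewrite /col; case: asboolP => // nU.
  have [//|h] := in_ultra_setVsetC [set w | c v w = true] UU.
  by apply: filterS h => w /= /negP; case: (c v w).
exists col => i vs vsi N.
have : U [set w | (N < w)%N /\ forall v, v \in vs -> c v w = i].
  apply: filterI; first by apply: oU; exists N.+1.
  elim: vs vsi => [|v vs IH] /=; first by move=> _; apply: filterS filterT => w _ v.
  move=> /andP[/eqP vi /IH h]; apply: filterS (filterI (Ucol v) h) => w /= [h1 h2] u.
  by rewrite inE => /orP[/eqP ->|/h2//]; rewrite h1.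
by move=> /filter_ex[w [h1 h2]]; exists w.
Qed.

End VertexColors.

Lemma onto_seq (F : finType) (S : {set F}) (xs : seq nat) : uniq xs -> size xs = #|S| ->
  exists h : F -> nat, [/\ {in S &, injective h}, {in S, forall x, h x \in xs} &
    forall v, v \in xs -> exists2 x, x \in S & h x = v].
Proof.
move=> uxs sz; exists (fun x => nth 0%N xs (index x (enum S))).
have ix x : x \in S -> (index x (enum S) < size xs)%N.
  by move=> xS; rewrite sz cardE index_mem mem_enum.
split.
- move=> x y xS yS /eqP; rewrite nth_uniq ?ix// => /eqP e.
  by rewrite -(nth_index x (_ : x \in enum S)) ?mem_enum// e nth_index ?mem_enum.
- by move=> x xS; rewrite mem_nth ?ix.
- move=> v vxs; have iv : (index v xs < size (enum S))%N by rewrite -cardE -sz index_mem.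
  case: (enum S) (enum_uniq S) (mem_enum S) iv => // x0 s us ms iv.
  exists (nth x0 (x0 :: s) (index v xs)); first by rewrite -ms mem_nth.
  by rewrite index_uniq// nth_index.
Qed.

Section GoodPrefixes.
Local Open Scope set_scope.
Variable R : realType.
Variables (F : fin_graph) (A I : {set F}) (w0 : F).
Hypotheses (indA : independent A) (indAc : independent (~: A)) (IA : I \subset A)
  (w0A : w0 \notin A).
Variables (c : nat -> nat -> bool) (col : nat -> bool) (i : bool).

(** A tile serves as a partial copy of I together with its neighborhood.  Each
    vertex of color i outside the tiles is a partial copy of the single vertex
    w0, so that all vertices of color i in the prefix are covered. *)
Lemma good_prefix_of_tiling (l : R) M n N (m : nat) (B Rr : {set 'I_N}) :
  (forall v, v \in B -> [/\ (M < v)%N, (v <= n)%N & col v = ~~ i]) ->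
  (forall v, v \in Rr -> (M < v)%N /\ col v = i) ->
  tiling (fun v w : 'I_N => c v w == i) B Rr #|I| #|neighborhood I| m ->
  l * n%:R <= (m * #|I| + count (fun v => (M < v)%N && (col v == i)) (iota 1 n))%:R ->
  good_prefix A c i (fun v => col v == i) l M n.
Proof.
move=> BP RP [It [X [Y [cI XYs XYc XYd XYe]]]] cov.
pose vals (Z : {set 'I_N}) := [seq val v | v <- enum Z].
have valsP Z v : v \in vals Z -> exists2 o, o \in Z & val o = v.
  by case/mapP => z; rewrite mem_enum => zZ ->; exists z.
have uvals Z : uniq (vals Z) by rewrite map_inj_uniq ?enum_uniq//; apply: val_inj.
have svals Z : size (vals Z) = #|Z| by rewrite size_map -cardE.
have /choice[hX HX] : forall j, exists h : F -> nat, [/\ {in I &, injective h},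
    {in I, forall x, h x \in vals (X j)} &
    forall v, v \in vals (X j) -> exists2 x, x \in I & h x = v].
  by move=> j; apply: onto_seq; rewrite ?uvals ?svals//; have [] := XYc j.
have /choice[hY HY] : forall j, exists h : F -> nat, [/\ {in neighborhood I &, injective h},
    {in neighborhood I, forall x, h x \in vals (Y j)} &
    forall v, v \in vals (Y j) -> exists2 x, x \in neighborhood I & h x = v].
  by move=> j; apply: onto_seq; rewrite ?uvals ?svals//; have [] := XYc j.
have XP j v : v \in vals (X j) -> [/\ (M < v)%N, (v <= n)%N & col v = ~~ i].
  move=> /valsP[z oX <-]; apply: BP; have [h _] := XYs j.
  exact: (fintype.subsetP h).
have YP j v : v \in vals (Y j) -> (M < v)%N /\ col v = i.
  move=> /valsP[z oX <-]; apply: RP; have [_ h] := XYs j.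
  exact: (fintype.subsetP h).
have XYne j k x y : x \in vals (X j) -> y \in vals (Y k) -> x != y.
  move=> /XP[_ _ cx] /YP[_ cy]; apply/eqP => xy.
  by move: cx; rewrite xy cy; case: (i).
have valsd (Z W : {set 'I_N}) x y : [disjoint Z & W] -> x \in vals Z -> y \in vals W -> x != y.
  move=> d /valsP[z oZ <-] /valsP[z' oW <-]; apply/eqP => /val_inj oo.
  by have := disjointFr d oZ; rewrite oo oW.
have NI x : x \in neighborhood I -> (x \notin I) && (x \notin A).
  rewrite inE => /andP[xI /bigcupP[z zI]]; rewrite inE => zx; rewrite xI /=.
  by have := sides indA indAc zx; rewrite (fintype.subsetP IA).
pose free (v : 'I_n.+1) := [&& (M < v)%N, col v == i & [forall j, val v \notin vals (Y j)]].
pose P (j : It + {v | free v}) : {set F} * (F -> nat) := match j with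
  | inl j => (I :|: neighborhood I, fun x => if x \in I then hX j x else hY j x)
  | inr v => ([set w0], fun=> val (val v)) end.
exists (It + {v | free v})%type, P.
have PP j x : x \in (P (inl j)).1 ->
    (x \in I /\ (P (inl j)).2 x \in vals (X j)) \/
    [/\ x \notin I, x \in neighborhood I & (P (inl j)).2 x \in vals (Y j)].
  rewrite /= inE; case: (boolP (x \in I)) => /= xI.
    by move=> _; left; split => //; have [_ h _] := HX j; apply: h.
  by move=> xN; right; split => //; have [_ h _] := HY j; apply: h.
split.
- split.
  + case=> [j|v].
      split.
      * move=> x y xD yD; have [[xI hx]|[xI xN hx]] := PP j x xD;
          have [[yI hy]|[yI yN hy]] := PP j y yD.
        - by rewrite /= xI yI; have [h _ _] := HX j; apply: h.
        - by move=> e; have := XYne _ _ _ _ hx hy; rewrite e eqxx.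
        - by move=> e; have := XYne _ _ _ _ hy hx; rewrite e eqxx.
        - by rewrite /= (negPf xI) (negPf yI); have [h _ _] := HY j; apply: h.
      * move=> x /PP[[_ /XP[h _ _]]|[_ _ /YP[h _]]]; exact: leq_ltn_trans h.
      * move=> x /PP[[xI _]|[_ _ /YP[_ h]] _]; last by rewrite h.
        by rewrite (fintype.subsetP IA).
      * move=> x y /PP[[xI _] xA xy|[_ /NI/andP[_ /negPf ->]]//].
        have yA : y \notin A by rewrite -(sides indA indAc xy).
        have yI : y \notin I by apply: contra yA; apply: (fintype.subsetP IA).
        have yN : y \in neighborhood I.
          by rewrite inE yI; apply/bigcupP; exists x => //; rewrite inE.
        split; first by rewrite /= inE yN orbT.
        rewrite /= xI (negPf yI).
        have [_ /(_ x xI)/valsP[z oX <-] _] := HX j.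
        have [_ /(_ y yN)/valsP[z' oY <-] _] := HY j.
        exact/eqP/(XYe j).
    have /and3P[Mv vi _] := valP v; split => /=.
    * by move=> x y; rewrite !inE => /eqP -> /eqP ->.
    * by move=> x _; apply: leq_ltn_trans Mv.
    * by [].
    * by move=> x y; rewrite inE => /eqP ->; rewrite (negPf w0A).
  + case=> [j|v] [k|w] x y jk.
    * have {}jk : j != k by apply: contra jk => /eqP ->.
      have [dX dY] := XYd j k jk.
      move=> /PP[[_ hx]|[_ _ hx]] /PP[[_ hy]|[_ _ hy]].
      - exact: valsd dX hx hy.
      - exact: XYne hx hy.
      - by rewrite eq_sym; apply: XYne hy hx.
      - exact: valsd dY hx hy.
    * have /and3P[_ /eqP wi /forallP wY] := valP w.
      move=> /PP[[_ /XP[_ _ hx]]|[_ _ hx]] _ /=.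
        by apply/eqP => e; move: hx; rewrite /= e wi; case: (i).
      apply/eqP => e; have e' : (P (inl j)).2 x = val (val w) := e.
      by move: (wY j); rewrite -e' hx.
    * have /and3P[_ /eqP wi /forallP wY] := valP v.
      move=> _ /PP[[_ /XP[_ _ hx]]|[_ _ hx]] /=.
        by apply/eqP => e; move: hx; rewrite /= -e wi; case: (i).
      apply/eqP => e; have e' : val (val v) = (P (inl k)).2 y := e.
      by move: (wY k); rewrite e' hx.
    * by move=> _ _ /=; apply: contra jk => /eqP/val_inj/val_inj ->.
- case=> [j|v] x.
    by move=> /PP[[_ /XP[]]|[_ _ /YP[]]].
  by move=> _; have /and3P[] := valP v.
- apply: le_trans cov _; rewrite ler_nat.
  pose tb := [seq v <- iota 1 n | [exists j, v \in vals (X j)]].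
  have tbm : (m * #|I| <= size tb)%N.
    have <- : #|\bigcup_j X j| = (m * #|I|)%N.
      rewrite -sum1_card partition_disjoint_bigcup; last by move=> j k /XYd[].
      rewrite (eq_bigr (fun=> #|I|)) ?sum_nat_const ?cI// => j _.
      by rewrite sum1_card; have [] := XYc j.
    rewrite -svals; apply: uniq_leq_size => // v /valsP[z /bigcupP[j _ oX] <-].
    have oj : val z \in vals (X j) by apply/mapP; exists z; rewrite ?mem_enum.
    have [Mo on _] := XP _ _ oj.
    rewrite mem_filter mem_iota add1n ltnS on (leq_ltn_trans _ Mo)// !andbT.
    by apply/existsP; exists j.
  apply: (@leq_trans (count (fun v => [exists j, v \in vals (X j)]) (iota 1 n) +
     count (fun v => (M < v)%N && (col v == i)) (iota 1 n))).
    by rewrite leq_add2r -size_filter.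
  rewrite -count_predUI [X in (_ + X)%N](_ : _ = 0%N).
    rewrite addn0 -!size_filter; apply: uniq_leq_size.
      by rewrite filter_uniq// iota_uniq.
    move=> v; rewrite !mem_filter => /andP[+ vio]; rewrite vio andbT.
    move: vio; rewrite mem_iota add1n ltnS => /andP[_ vn] /=.
    move=> /orP[/existsP[j vj]|/andP[Mv vi]].
      have [_ _ /(_ v vj)[x xI xv]] := HX j.
      apply/existsP; exists (inl j); apply/existsP; exists x.
      by rewrite /= inE xI xv eqxx.
    have [/existsP[j vj]|/existsPn nY] := boolP [exists j, v \in vals (Y j)].
      have [_ _ /(_ v vj)[x xN xv]] := HY j; have /andP[/negPf xI _] := NI x xN.
      apply/existsP; exists (inl j); apply/existsP; exists x.
      by rewrite /= inE xI xN xv eqxx.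
    have fv : free (Ordinal (vn : (v < n.+1)%N)).
      by rewrite /free /= Mv vi; apply/forallP.
    apply/existsP; exists (inr (Sub (Ordinal (vn : (v < n.+1)%N)) fv)).
    by apply/existsP; exists w0; rewrite /= inE !eqxx.
  apply/eqP; rewrite -leqn0 leqNgt -has_count; apply/negP => /hasP[v _ /= /andP[]].
  by move=> /existsP[j /XP[_ _ h]] /andP[_ /eqP]; rewrite h; case: (i).
Qed.

End GoodPrefixes.

(** * Prefixes that cannot be covered *)

Section SparsePairs.
Local Open Scope nat_scope.

Lemma sum_sub_seq (s t : seq nat) (f : nat -> nat) : uniq s -> {subset s <= t} ->
  \sum_(x <- s) f x <= \sum_(x <- t) f x.
Proof.
elim: s t => [|x s IH] t /=; first by rewrite big_nil.
move=> /andP[xs us] st; have xt : x \in t by apply: st; rewrite mem_head.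
rewrite big_cons (big_rem x xt) /= leq_add2l; apply: IH => // y ys.
have yt : y \in t by apply: st; rewrite inE ys orbT.
move: yt; rewrite (perm_mem (perm_to_rem xt)) inE => /orP[/eqP yx|//].
by rewrite -yx ys in xs.
Qed.

Definition seq_edges (c : nat -> nat -> bool) i (s t : seq nat) :=
  \sum_(x <- s) \sum_(y <- t) (c x y == i : nat).

(** The points of X outside Y' lie in Z', those of X' outside Y lie in Z, and
    each pair formed by two such points is an edge of color i between X and Z or
    an edge of the other color between X' and Z'.  As these are few, one of
    the two sets is small.  This needs n and m to be comparable, for the two
    error terms to have the same order. *)
Lemma sparse_dichotomy (c : nat -> nat -> bool) i K n m (X Y Z X' Y' Z' : seq nat) :
  symmetric c -> 0 < K -> n <= K * m -> m <= K * n -> uniq X -> uniq X' ->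
  (forall v, v \in X' -> v \in Y \/ v \in Z) ->
  (forall v, v \in X -> v \in Y' \/ v \in Z') ->
  8 * K ^ 4 * seq_edges c i X Z <= 4 * (n * (K * n)) ->
  8 * K ^ 4 * seq_edges c (~~ i) X' Z' <= 4 * (m * (K * m)) ->
  K * size X <= K * size Y' + m \/ K * size X' <= K * size Y + n.
Proof.
move=> csym K0 nm mn uX uX' cX' cX e1 e2.
pose P1 := [seq x <- X | x \in Z']; pose P2 := [seq x <- X' | x \in Z].
have szP (s t w : seq nat) : uniq s -> (forall v, v \in s -> v \in t \/ v \in w) ->
    size s <= size t + size [seq x <- s | x \in w].
  move=> us st; rewrite -(count_predC (fun x => x \in w) s) -!size_filter addnC leq_add2r.
  apply: uniq_leq_size; first by rewrite filter_uniq.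
  by move=> v; rewrite mem_filter /= => /andP[vw /st[//|vw']]; rewrite vw' in vw.
have sX : size X <= size Y' + size P1 by apply: szP.
have sX' : size X' <= size Y + size P2 by apply: szP.
have prod : size P1 * size P2 <= seq_edges c i X Z + seq_edges c (~~ i) X' Z'.
  have -> : size P1 * size P2 = \sum_(x <- P1) \sum_(y <- P2) (c x y == i : nat) +
      \sum_(x <- P1) \sum_(y <- P2) (c x y == ~~ i : nat).
    rewrite -big_split /= (eq_bigr (fun=> size P2)).
      by rewrite big_const_seq count_predT iter_addn_0 mulnC.
    move=> x _; rewrite -big_split /= (eq_bigr (fun=> 1)) ?sum1_size// => y _.
    by case: (c x y); case: (i).
  have f1 : uniq P1 by rewrite filter_uniq.
  have f2 : uniq P2 by rewrite filter_uniq.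
  apply: leq_add.
    rewrite (leq_trans (sum_sub_seq _ f1 (_ : {subset P1 <= X})))//.
      by move=> v; rewrite mem_filter => /andP[].
    apply: leq_sum => x _; apply: sum_sub_seq => // v.
    by rewrite mem_filter => /andP[].
  rewrite exchange_big /=.
  rewrite (leq_trans (sum_sub_seq _ f2 (_ : {subset P2 <= X'})))//.
    by move=> v; rewrite mem_filter => /andP[].
  apply: leq_sum => x _.
  rewrite (leq_trans (sum_sub_seq _ f1 (_ : {subset P1 <= Z'})))//.
    by move=> v; rewrite mem_filter => /andP[].
  by apply: leq_sum => y _; rewrite csym.
have [h|h1] := leqP (K * size X) (K * size Y' + m); first by left.
have [h|h2] := leqP (K * size X') (K * size Y + n); first by right.
exfalso.
have m1 : m < K * size P1 by have := leq_mul (leqnn K) sX; lia.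
have n1 : n < K * size P2 by have := leq_mul (leqnn K) sX'; lia.
have big1 : m * n < K ^ 2 * (size P1 * size P2) by rewrite expnS expn1; nia.
have nn : n * (K * n) <= K ^ 2 * (m * n) by rewrite expnS expn1; nia.
have mm : m * (K * m) <= K ^ 2 * (m * n) by rewrite expnS expn1; nia.
have h : 8 * K ^ 4 * (size P1 * size P2) <= 8 * (K ^ 2 * (m * n)).
  by have := leq_mul (leqnn (8 * K ^ 4)) prod; lia.
have h2' : 8 * K ^ 2 * (m * n) < 8 * K ^ 2 * (K ^ 2 * (size P1 * size P2)).
  by rewrite ltn_pmul2l// muln_gt0 expn_gt0 K0.
have K4 : K ^ 4 = K ^ 2 * K ^ 2 by rewrite -expnD.
by move: h h2'; rewrite K4; lia.
Qed.

End SparsePairs.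

Section BadPrefix.
Variable R : realType.
Variables (F : fin_graph) (A I : {set F}) (w0 : F).
Hypotheses (indA : independent A) (indAc : independent (~: A)%SET) (IA : I \subset A)
  (w0A : w0 \notin A).
Variables (c : nat -> nat -> bool) (col : nat -> bool).

(** The duality is applied between the vertices of the other color in (M, n] and
    those of color i in (M, K n]; the latter are cut off at a multiple of n so
    that a density bound on edges is meaningful.  For lam = q/p, the last
    inequality says that |X| - |Y|/lam is at least (1 - l) n, up to an error. *)
Lemma bad_prefix (i : bool) (l : R) (M n K E L C : nat) :
  (0 < n)%N -> (0 < K)%N -> (0 < L)%N ->
  tiling_duality #|I| #|neighborhood I| E L C ->
  ~ good_prefix A c i (fun v => col v == i) l M n ->
  exists X Y Z : seq nat, [/\ uniq X,
    forall v, v \in X -> [/\ (M < v)%N, (v <= n)%N & col v = ~~ i],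
    forall v, (M < v)%N -> (v <= K * n)%N -> col v = i -> v \in Y \/ v \in Z,
    (E * seq_edges c i X Z <= 4 * (n * (K * n)))%N &
    #|I|%:R * (size Y)%:R <= #|neighborhood I|%:R *
      ((size X)%:R - ((1 - l) * n%:R - M%:R) + #|I|%:R * (n%:R + C%:R) / L%:R)].
Proof.
move=> n0 K0 L0 kb bad; set p := #|I|; set q := #|neighborhood I|.
pose N := (K * n).+1.
have nN : (n < N)%N by rewrite ltnS leq_pmull.
pose B := [set v : 'I_N | [&& (M < v)%N, (v <= n)%N & col v == ~~ i]]%SET.
pose Rr := [set v : 'I_N | (M < v)%N && (col v == i)]%SET.
pose vals (Z : {set 'I_N}) := [seq val v | v <- enum Z].
have valsP Z v : v \in vals Z -> exists2 z, z \in Z & val z = v.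
  by case/mapP => z; rewrite mem_enum => zZ ->; exists z.
have uvals Z : uniq (vals Z) by rewrite map_inj_uniq ?enum_uniq//; apply: val_inj.
have svals Z : size (vals Z) = #|Z| by rewrite size_map -cardE.
have Bn : (#|B| <= n)%N.
  rewrite -svals -[leqRHS](size_iota 1); apply: uniq_leq_size => // v /valsP[z].
  by rewrite inE => /and3P[zM zn _] <-; rewrite mem_iota add1n ltnS zn (leq_ltn_trans _ zM).
have [m [X [Z [til XB ZR eXZ cost]]]] := kb _ (fun v w : 'I_N => c v w == i) B Rr n n0 Bn.
pose cnt := count (fun v => (M < v)%N && (col v == i)) (iota 1 n).
have small : (m * p + cnt)%:R < l * n%:R.
  rewrite ltNge; apply/negP => h; apply: bad.
  apply: (@good_prefix_of_tiling _ _ A I w0 indA indAc IA w0A c col i l M n N m B Rr) => //.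
  - by move=> v; rewrite inE => /and3P[? ? /eqP].
  - by move=> v; rewrite inE => /andP[? /eqP].
have nB : (n <= M + (#|B| + cnt))%N.
  have cB : (count (fun v => (M < v)%N && (col v == ~~ i)) (iota 1 n) <= #|B|)%N.
    rewrite -svals -size_filter; apply: uniq_leq_size.
      by rewrite filter_uniq// iota_uniq.
    move=> v; rewrite mem_filter mem_iota add1n ltnS => /andP[/andP[vM vi] /andP[_ vn]].
    apply/mapP; exists (Ordinal (leq_ltn_trans vn nN)) => //.
    by rewrite mem_enum inE /= vM vn.
  have cM : (count (fun v => ~~ (M < v)%N) (iota 1 n) <= M)%N.
    rewrite -size_filter -[leqRHS](size_iota 1); apply: uniq_leq_size.
      by rewrite filter_uniq// iota_uniq.
    by move=> v; rewrite mem_filter -leqNgt !mem_iota !add1n !ltnS => /andP[-> /andP[-> _]].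
  apply: leq_trans (leq_add cM (leq_add cB (leqnn cnt))).
  rewrite -[leqLHS](size_iota 1) -(count_predC (fun v => (M < v)%N)) addnC leq_add2l.
  rewrite -(count_predUI _ (fun v => (M < v)%N && (col v == i))).
  apply: leq_trans (leq_addr _ _); apply: sub_count => v /= ->.
  by case: (col v); case: (i).
exists (vals X), (vals (Rr :\: Z)%SET), (vals Z); split.
- exact: uvals.
- by move=> v /valsP[z /(fintype.subsetP XB)]; rewrite inE => /and3P[? ? /eqP ?] <-.
- move=> v vM vK vi; have vN : (v < N)%N by [].
  have [vZ|vZ] := boolP (Ordinal vN \in Z); [right|left];
    by apply/mapP; exists (Ordinal vN); rewrite // mem_enum// !inE vZ /= vM vi eqxx.
- have -> : seq_edges c i (vals X) (vals Z) = edges (fun v w : 'I_N => c v w == i) X Z.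
    rewrite /seq_edges big_map big_enum; apply: eq_bigr => x _.
    by rewrite big_map big_enum.
  apply: (leq_trans eXZ); rewrite leq_mul2l /=; apply: leq_mul.
    exact: leq_trans (subset_leq_card XB) Bn.
  rewrite -svals -[leqRHS](size_iota 1); apply: uniq_leq_size => // v /valsP[z].
  move=> /(fintype.subsetP ZR); rewrite inE => /andP[zM _] <-.
  by rewrite mem_iota add1n (leq_ltn_trans _ zM)//= ltn_ord.
- rewrite !svals; move: cost small nB.
  have -> : #|B :\: X|%SET = (#|B| - #|X|)%N by rewrite cardsD (finset.setIidPr XB).
  have XBc := subset_leq_card XB.
  rewrite -!(ler_nat R) !(natrD, natrM, natrB)//.
  move: (#|Rr :\: Z|%SET) (#|X|) (#|B|) => y x b cost small nB.
  have Lp : 0 < L%:R :> R by rewrite ltr0n.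
  rewrite -(ler_pM2l Lp).
  have -> : L%:R * (q%:R * (x%:R - ((1 - l) * n%:R - M%:R) + p%:R * (n%:R + C%:R) / L%:R)) =
      q%:R * (L%:R * (x%:R - (1 - l) * n%:R + M%:R) + p%:R * (n%:R + C%:R)).
    by field; rewrite gt_eqF.
  have key : m%:R * p%:R - b%:R <= l * n%:R - n%:R + M%:R by lra.
  have qL : 0 <= q%:R * L%:R :> R by rewrite mulr_ge0.
  by have := ler_wpM2l qL key; lra.
Qed.

End BadPrefix.

(** * The lower bound *)

Section LowerBound.
Variable R : realType.

Lemma walk_rate_ge2 (lam : R) : 0 < lam -> 2 <= walk_rate lam.
Proof.
move=> l0; rewrite leNgt; apply/negP => D2.
have [|al [si [u0 [h0 _ _ bnd]]]] := @offsets R lam ((walk_rate lam + 2) / 2) l0; first lra.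
pose u := `|u0| + 1; have u1 : 1 <= u by rewrite lerDr.
have := bnd u (le_trans (ler_norm u0) _); rewrite lerDl ler01 => /(_ isT).
have [] := h0 u; first lra.
by move=> a s h; nra.
Qed.

Lemma nat_above (x : R) : exists2 n, (0 < n)%N & x <= n%:R.
Proof.
exists (Num.bound `|x|).+1 => //; apply: (le_trans (ler_norm _)).
by rewrite -natr1 ler_wpDr// ltW// archi_boundP.
Qed.

Lemma good_prefix_le (F : fin_graph) (A : {set F}) c i cl (l : R) M M' n : (M' <= M)%N ->
  good_prefix A c i cl l M n -> good_prefix A c i cl l M' n.
Proof.
move=> MM [J [P [h1 h2 h3]]]; exists J, P; split => // j x xP.
exact: leq_ltn_trans MM (h2 j x xP).
Qed.

Lemma count_above (M n : nat) : (n <= M + count (fun v => M < v) (iota 1 n))%N.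
Proof.
rewrite -[leqLHS](size_iota 1) -(count_predC (fun v => M < v)%N) addnC leq_add2r.
rewrite -size_filter -[leqRHS](size_iota 1); apply: uniq_leq_size.
  by rewrite filter_uniq// iota_uniq.
by move=> v; rewrite mem_filter /= -leqNgt !mem_iota !add1n !ltnS => /andP[-> /andP[-> _]].
Qed.

(** If almost all vertices have color i, they are covered one by one. *)
Lemma monochromatic_cofinite (F : fin_graph) (A I : {set F}) w0 (c : nat -> nat -> bool) col i N (l : R) :
  independent A -> independent (~: A)%SET -> I \subset A -> w0 \notin A ->
  symmetric c -> l < 1 ->
  (forall i vs, all (fun v => col v == i) vs ->
    forall N, exists2 w, (N < w)%N & forall v, v \in vs -> c v w = i) ->
  (forall w, (N < w)%N -> col w = i) ->
  exists H', [/\ monochromatic c H', isomorphic (omega F) H'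
      & (l%:E <= upper_density R (svertex H'))%E].
Proof.
move=> indA indAc IA w0A csym l1 Hcol coli.
apply: (@dense_monochromatic_copy R F A indA indAc c i (fun v => col v == i)) => //.
- by move=> N'; exists (maxn N N').+1; rewrite ?ltnS ?leq_maxr// coli// ltnS leq_maxl.
- exact: Hcol.
move=> M N'; have [n n0 hn] := nat_above ((M + N)%:R / (1 - l)).
exists (maxn n N'); first exact: leq_maxr.
apply: (@good_prefix_of_tiling _ _ A I w0 indA indAc IA w0A c col i l M _ 0 0 finset.set0 finset.set0).
- by move=> v; rewrite inE.
- by move=> v; rewrite inE.
- exact: tiling0.
rewrite mul0n add0n; set n' := maxn n N'.
have h1 : (n' <= M + N + count (fun v => (M < v)%N && (col v == i)) (iota 1 n'))%N.
  apply: leq_trans (count_above (M + N) n') _; rewrite leq_add2l; apply: sub_count => v /= h.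
  by rewrite (leq_ltn_trans (leq_addr _ _) h)//= coli// (leq_ltn_trans (leq_addl _ _) h).
have h2 : (M + N)%:R <= (1 - l) * n'%:R.
  have : (M + N)%:R <= (1 - l) * n%:R by rewrite mulrC -ler_pdivrMr; lra.
  move/le_trans; apply; rewrite ler_wpM2l ?ler_nat ?leq_maxl//; lra.
by move: h1; rewrite -(ler_nat R) natrD; lra.
Qed.

(** Otherwise, [bad_prefix] applies to both colors.  Adding n/K to |Y| turns the
    approximate dichotomy into an exact one, also for prefixes of incomparable
    lengths, since |X'| <= m <= n/K for K m <= n.  The points obtained satisfy
    r <= lam (b - mu n) and b + r' <= n, hence have rate at most 1/mu, although
    mu > 1/D. *)
Lemma lower_bound (F : fin_graph) (A I : {set F}) (l : R) :
  independent A -> independent (~: A)%SET -> I \subset A ->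
  (0 < #|I|)%N -> (0 < #|neighborhood I|)%N ->
  l < 1 - (walk_rate (#|neighborhood I|%:R / #|I|%:R))^-1 ->
  forall c : nat -> nat -> bool, symmetric c ->
  exists H', [/\ monochromatic c H', isomorphic (omega F) H'
      & (l%:E <= upper_density R (svertex H'))%E].
Proof.
move=> indA indAc IA p0 q0; set lam := _ / _ => lD c csym.
have [w0 w0N] : exists w0, w0 \in neighborhood I by apply/finset.set0Pn; rewrite -card_gt0.
have w0A : w0 \notin A.
  move: w0N; rewrite inE => /andP[_ /bigcupP[z zI]]; rewrite inE => zw.
  by have := sides indA indAc zw; rewrite (fintype.subsetP IA).
have [pR qR] : 0 < #|I|%:R :> R /\ 0 < #|neighborhood I|%:R :> R by rewrite !ltr0n.
have l0 : 0 < lam by apply: divr_gt0.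
have D2 := walk_rate_ge2 l0; set D := walk_rate lam in lD D2.
have Di0 : 0 < D^-1 by rewrite invr_gt0; lra.
have l1 : l < 1 by lra.
have [col Hcol] := ultrafilter_colors c.
have [[i [N coli]]|inf] := pselect (exists i N, forall w, (N < w)%N -> col w = i).
  exact: (monochromatic_cofinite indA indAc IA w0A csym l1 Hcol coli).
have {}inf i N : exists2 w, (N < w)%N & col w == i.
  apply: contrapT => h; apply: inf; exists (~~ i), N => w Nw.
  apply/eqP; apply: contrapT => cw; apply: h; exists w => //.
  by move: cw; case: (col w); case: (i).
apply: contrapT => noH.
have bad i : exists M N, forall n, (N <= n)%N ->
    ~ good_prefix A c i (fun v => col v == i) l M n.
  apply: contrapT => h; apply: noH.
  apply: (@dense_monochromatic_copy R F A indA indAc c i (fun v => col v == i)) => //.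
    exact: Hcol.
  move=> M N; apply: contrapT => h2; apply: h; exists M, N => n Nn g.
  by apply: h2; exists n.
have [M [N {}bad]] : exists M N, forall i n, (N <= n)%N ->
    ~ good_prefix A c i (fun v => col v == i) l M n.
  have [M1 [N1 h1]] := bad true; have [M2 [N2 h2]] := bad false.
  exists (maxn M1 M2), (maxn N1 N2) => -[] n; rewrite geq_max => /andP[n1 n2].
    by move=> /(good_prefix_le (leq_maxl _ _)); apply: h1.
  by move=> /(good_prefix_le (leq_maxr _ _)); apply: h2.
set p := #|I| in p0 pR lam l0 D lD D2 Di0 *.
set q := #|neighborhood I| in q0 qR lam l0 D lD D2 Di0 *.
(* The surplus kap pays for mu > 1/D with one half, and for the errors with
   the other. *)
pose kap := (1 - l) - D^-1; have kap0 : 0 < kap by rewrite /kap; lra.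
have [K K0 HK] := nat_above (8 / (kap * lam)).
have [L L0 HL] := nat_above (8 * p%:R / kap).
(* The factor 8 K^4 is the sparsity that the dichotomy requires. *)
have [|C HC] := @approx_konig p q (8 * K ^ 4) L p0 q0 _ L0.
  by rewrite (leq_trans (isT : 1 < 8)%N)// leq_pmulr// expn_gt0 K0.
have [N' N'0 HN'] := nat_above ((M%:R + p%:R * C%:R) * 4 / kap).
pose N1 := maxn N N'; pose mu := D^-1 + kap / 2.
have mu0 : 0 < mu by rewrite /mu; lra.
have KR : 0 < K%:R :> R by rewrite ltr0n.
have LR : 0 < L%:R :> R by rewrite ltr0n.
have /choice[XYZ HXYZ] : forall d : bool * nat, exists T : seq nat * seq nat * seq nat,
   (N1 <= d.2)%N -> [/\ uniq T.1.1,
    forall v, v \in T.1.1 -> [/\ (M < v)%N, (v <= d.2)%N & col v = ~~ d.1],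
    forall v, (M < v)%N -> (v <= K * d.2)%N -> col v = d.1 -> v \in T.1.2 \/ v \in T.2,
    (8 * K ^ 4 * seq_edges c d.1 T.1.1 T.2 <= 4 * (d.2 * (K * d.2)))%N &
    (size T.1.2)%:R + d.2%:R / K%:R <= lam * ((size T.1.1)%:R - mu * d.2%:R)].
  move=> [i n] /=; have [nN|nN] := leqP N1 n; last by exists ([::], [::], [::]).
  have [Nn N'n] : (N <= n)%N /\ (N' <= n)%N by apply/andP; rewrite -geq_max.
  have n0 : (0 < n)%N by apply: leq_trans N'n.
  have [X [Y [Z [h1 h2 h3 h4 h5]]]] :=
    bad_prefix indA indAc IA w0A n0 K0 L0 HC (bad i n Nn).
  exists (X, Y, Z) => _; split => //=.
  have nR : 0 < n%:R :> R by rewrite ltr0n.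
  have e1 : K%:R^-1 <= kap * lam / 8.
    have kl0 : 0 < kap * lam by rewrite mulr_gt0.
    by rewrite ler_pdivlMr// mulrC ler_pdivrMr// mulrC -ler_pdivrMr.
  have e2 : p%:R / L%:R <= kap / 8.
    rewrite ler_pdivrMr// mulrC -ler_pdivrMr; last lra.
    by rewrite invf_div mulrA (mulrC p%:R).
  have e3 : M%:R + p%:R * C%:R <= kap / 4 * n%:R.
    have : (M%:R + p%:R * C%:R) * 4 / kap <= n%:R by apply: le_trans HN' _; rewrite ler_nat.
    by rewrite ler_pdivrMr//; lra.
  have e4 : p%:R * C%:R / L%:R <= p%:R * C%:R :> R.
    by rewrite ler_piMr ?mulr_ge0// invf_le1// ler1n.
  move: h5; rewrite -/p -/q => h5.
  have h6 : (size Y)%:R <= lam * ((size X)%:R - ((1 - l) * n%:R - M%:R) +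
      p%:R * (n%:R + C%:R) / L%:R).
    by rewrite /lam mulrAC ler_pdivlMr// mulrC.
  have e5 : n%:R / K%:R <= kap * lam / 8 * n%:R by rewrite mulrC ler_wpM2r// ltW.
  have e6 : p%:R * (n%:R + C%:R) / L%:R <= kap / 8 * n%:R + p%:R * C%:R.
    have : p%:R / L%:R * n%:R <= kap / 8 * n%:R by rewrite ler_wpM2r// ltW.
    by lra.
  have e7 : lam * ((size X)%:R - ((1 - l) * n%:R - M%:R) + p%:R * (n%:R + C%:R) / L%:R)
     <= lam * ((size X)%:R - mu * n%:R - kap / 8 * n%:R).
    by rewrite ler_pM2l// /mu /kap; move: e3 e6; rewrite /kap; lra.
  by lra.
pose X i n := (XYZ (i, n)).1.1; pose Y i n := (XYZ (i, n)).1.2.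
have Xn i n : (N1 <= n)%N -> (size (X i n) <= n)%N.
  move=> nN; have [uX hX _ _ _] := HXYZ (i, n) nN.
  rewrite -[leqRHS](size_iota 1); apply: uniq_leq_size => // v /hX[Mv vn _].
  by rewrite mem_iota add1n ltnS vn (leq_ltn_trans _ Mv).
pose P (b r : R) := exists2 n, (N1 <= n)%N &
  b = (size (X false n))%:R /\ r = (size (Y false n))%:R + n%:R / K%:R.
pose P' (b r : R) := exists2 n, (N1 <= n)%N &
  r = (size (X true n))%:R /\ b = (size (Y true n))%:R + n%:R / K%:R.
have Dmu : mu^-1 < D.
  by rewrite -[ltRHS]invrK ltf_pV2 ?posrE// /mu; lra.
pose eta := (D - mu^-1) / 2.
suff : D <= mu^-1 + eta by rewrite /eta; lra.
have eta0 : 0 < eta by rewrite /eta; lra.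
apply: (@walk_rate_le _ P P' _ _ (mu * N1%:R + eta^-1)) => //.
- by move=> b r [n _ [-> ->]]; rewrite addr_ge0 ?divr_ge0.
- by move=> b r [n _ [-> ->]]; rewrite addr_ge0 ?divr_ge0.
- move=> b r b' r' [n nN [-> ->]] [m mN [-> ->]].
  have [mn|nm] := ltnP (K * m) n.
    right; apply: (@le_trans _ _ (n%:R / K%:R)); last by rewrite lerDr.
    rewrite ler_pdivlMr// -natrM ler_nat mulnC (leq_trans _ (ltnW mn))// leq_mul2l.
    by rewrite Xn ?orbT.
  have [nm'|mn] := ltnP (K * n) m.
    left; apply: (@le_trans _ _ (m%:R / K%:R)); last by rewrite lerDr.
    rewrite ler_pdivlMr// -natrM ler_nat mulnC (leq_trans _ (ltnW nm'))// leq_mul2l.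
    by rewrite Xn ?orbT.
  have [uX hX cX eX _] := HXYZ (false, n) nN.
  have [uX' hX' cX' eX' _] := HXYZ (true, m) mN.
  have [||h|h] := @sparse_dichotomy c false K n m (X false n) (Y false n)
    (XYZ (false, n)).2 (X true m) (Y true m) (XYZ (true, m)).2 csym K0 nm mn uX uX' _ _ eX eX'.
  + by move=> v /hX'[/= Mv vm cv]; apply: cX => //=; apply: leq_trans vm mn.
  + by move=> v /hX[/= Mv vm cv]; apply: cX' => //=; apply: leq_trans vm nm.
  + left; rewrite -(ler_pM2l KR) mulrDr [_ * (m%:R / _)]mulrC divfK ?gt_eqF//.
    by rewrite -!natrM -natrD ler_nat.
  + right; rewrite -(ler_pM2l KR) mulrDr [_ * (n%:R / _)]mulrC divfK ?gt_eqF//.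
    by rewrite -!natrM -natrD ler_nat.
move=> u uge; have etai0 : 0 < eta^-1 by rewrite invr_gt0.
have muN : 0 <= mu * N1%:R by rewrite mulr_ge0// ltW.
have u0 : 0 < u by lra.
have umu0 : 0 <= u / mu by rewrite divr_ge0 // ltW.
pose n := (Num.truncn (u / mu)).+1.
have nlt : u / mu < n%:R by apply: truncnS_gt.
have nle : n%:R <= u / mu + 1 by rewrite -natr1 lerD2r truncn_le.
have nN : (N1 <= n)%N.
  rewrite -(ler_nat R); apply: (le_trans _ (ltW nlt)); rewrite ler_pdivlMr// mulrC; lra.
have umu : u <= mu * n%:R by rewrite mulrC -ler_pdivrMr// ltW.
have [uX hX _ _ iX] := HXYZ (false, n) nN.
have [uX' hX' _ _ iX'] := HXYZ (true, n) nN.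
exists (size (X false n))%:R, ((size (Y false n))%:R + n%:R / K%:R),
  ((size (Y true n))%:R + n%:R / K%:R), (size (X true n))%:R; split.
- by exists n.
- by exists n.
- by apply: (le_trans iX); rewrite ler_pM2l// lerD2l lerN2.
- by apply: (le_trans iX'); rewrite ler_pM2l// lerD2l lerN2.
- have szn : (size (X false n) + size (X true n) <= n)%N.
    rewrite -size_cat -[leqRHS](size_iota 1); apply: uniq_leq_size.
      rewrite cat_uniq uX uX' andbT; apply/hasPn => v /hX'[_ _ cv].
      by apply/negP => /hX[_ _]; rewrite cv.
    move=> v; rewrite mem_cat mem_iota add1n ltnS => /orP[/hX|/hX'] [Mv vn _];
      by rewrite vn (leq_ltn_trans _ Mv).
  move: szn; rewrite -(ler_nat R) natrD => szn; apply: (le_trans szn).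
  apply: (le_trans nle); rewrite mulrDl (mulrC mu^-1) lerD2l.
  by rewrite -(mulVf (_ : eta != 0)) ?gt_eqF// mulrC ler_pM2l//; lra.
Qed.

End LowerBound.

(** * Minimizers of the expansion ratio *)

Section MinRatio.
Local Open Scope set_scope.
Variables (R : realType) (F : fin_graph).

Lemma min_ratio_attained : (0 < #|F|)%N ->
  exists I : {set F}, [/\ I != finset.set0, independent I,
    min_ratio F R = (#|neighborhood I|%:R / #|I|%:R)%:E &
    forall J : {set F}, independent J ->
      #|neighborhood I|%:R / #|I|%:R * #|J|%:R <= #|neighborhood J|%:R :> R].
Proof.
move=> /card_gt0P[x _].
pose P (I : {set F}) := (I != finset.set0) && independent I.
pose f (I : {set F}) : \bar R := (#|neighborhood I|%:R / #|I|%:R)%:E.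
have Px : P [set x].
  rewrite /P -card_gt0 cards1; apply/forall_inP => y; rewrite inE => /eqP ->.
  by apply/forall_inP => z; rewrite inE => /eqP ->; rewrite fadj_irr.
have [|I IP minI] := @eq_bigmin _ _ _ (+oo%E : \bar R) _ P f Px.
  by move=> I _; apply: leey.
have /andP[I0 indI] : P I := IP.
exists I; split => // J indJ.
have [->|J0] := eqVneq J finset.set0; first by rewrite cards0 mulr0.
have : (f I <= f J)%O.
  rewrite -minI; apply: (@bigmin_le_cond _ _ _ (+oo%E : \bar R) J P f).
  by rewrite /P J0 indJ.
by rewrite lee_fin ler_pdivlMr// ltr0n card_gt0.
Qed.

(** The parts of I on the two sides of F have disjoint neighborhoods contained in
    N(I), so neither can do better than lam without the other doing worse. *)
Lemma one_sided_minimizer (lam : R) (A I : {set F}) :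
  independent A -> independent (~: A) -> I != finset.set0 -> independent I ->
  #|neighborhood I|%:R = lam * #|I|%:R ->
  (forall J : {set F}, independent J -> lam * #|J|%:R <= #|neighborhood J|%:R) ->
  exists A' I' : {set F}, [/\ independent A', independent (~: A'), I' \subset A',
    I' != finset.set0 & #|neighborhood I'|%:R = lam * #|I'|%:R].
Proof.
move=> indA indAc I0 indI eqI lamJ.
have sub_ind (S S' : {set F}) : S \subset S' -> independent S' -> independent S.
  move=> SS /forall_inP h; apply/forall_inP => u uS; apply/forall_inP => v vS.
  by have /forall_inP/(_ v) := h u (fintype.subsetP SS u uS); apply; apply: (fintype.subsetP SS).
have nbr_split : (#|neighborhood (I :&: A)| + #|neighborhood (I :\: A)| <= #|neighborhood I|)%N.
  have sub (S : {set F}) : S \subset I -> neighborhood S \subset neighborhood I.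
    move=> SI; apply/fintype.subsetP => x; rewrite !inE => /andP[_ /bigcupP[y yS yx]].
    have yI := fintype.subsetP SI y yS; apply/andP; split; last by apply/bigcupP; exists y.
    apply/negP => xI; have /forall_inP/(_ y yI)/forall_inP/(_ x xI) := indI.
    by move: yx; rewrite inE => ->.
  have d : [disjoint neighborhood (I :&: A) & neighborhood (I :\: A)].
    rewrite finset.disjoints_subset; apply/fintype.subsetP => x.
    rewrite !inE => /andP[_ /bigcupP[y]]; rewrite !inE => /andP[_ yA] yx.
    apply/negP => /andP[_ /bigcupP[z]]; rewrite !inE => /andP[zA _] zx.
    by have := sides indA indAc yx; have := sides indA indAc zx; rewrite yA (negPf zA) => <-.
  have := cardsUI (neighborhood (I :&: A)) (neighborhood (I :\: A)).
  rewrite (eqP (_ : neighborhood (I :&: A) :&: neighborhood (I :\: A) == finset.set0)).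
    rewrite cards0 addn0 => <-; apply: subset_leq_card; rewrite finset.subUset.
    by rewrite !sub// ?finset.subsetIl ?finset.subsetDl.
  by rewrite finset.setI_eq0.
have h1 := lamJ _ (sub_ind _ _ (finset.subsetIl I A) indI).
have h2 := lamJ _ (sub_ind _ _ (finset.subsetDl I A) indI).
have cI : #|I|%:R = #|I :&: A|%:R + #|I :\: A|%:R :> R by rewrite -natrD cardsID.
move: nbr_split; rewrite -(ler_nat R) natrD eqI cI => h3.
have [IA|IA] := eqVneq (I :&: A) finset.set0.
  exists (~: A), (I :\: A); split => //.
  - by rewrite finset.setCK.
  - by rewrite finset.setDE finset.subsetIr.
  - by apply: contra I0 => /eqP ID; rewrite -(finset.setID I A) IA ID finset.setU0.
  - by lra.
exists A, (I :&: A); split => //; first exact: finset.subsetIr.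
by lra.
Qed.

End MinRatio.

(** * The Ramsey density *)

Section RamseyDensity.
Local Open Scope set_scope.
Variable R : realType.

(** An isolated vertex is a partial copy wherever it is placed, so every vertex of
    the prefix is covered. *)
Lemma isolated_lower (F : fin_graph) (A : {set F}) x0 (l : R) :
  independent A -> independent (~: A) -> x0 \in A -> (forall y, ~~ fadj x0 y) -> l < 1 ->
  forall c : nat -> nat -> bool, symmetric c ->
  exists H', [/\ monochromatic c H', isomorphic (omega F) H'
      & (l%:E <= upper_density R (svertex H'))%E].
Proof.
move=> indA indAc x0A iso l1 c csym.
have [col Hcol] := ultrafilter_colors c.
have [i inf] : exists i, forall N, exists2 w, (N < w)%N & col w == i.
  apply: contrapT => h.
  have fin i : exists N, forall w, (N < w)%N -> col w <> i.
    apply: contrapT => h'; apply: h; exists i => N; apply: contrapT => h2.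
    by apply: h'; exists N => w Nw cw; apply: h2; exists w => //; apply/eqP.
  have [N1 h1] := fin true; have [N2 h2] := fin false.
  have := h1 (maxn N1 N2).+1; have := h2 (maxn N1 N2).+1.
  by rewrite !ltnS leq_maxl leq_maxr; case: (col _) => // a b; [exact: b|exact: a].
apply: (@dense_monochromatic_copy R F A indA indAc c i (fun v => col v == i)) => //.
  exact: Hcol.
move=> M N; have [n n0 hn] := nat_above (M%:R / (1 - l)).
exists (maxn n N); first exact: leq_maxr.
set n' := maxn n N.
pose P (v : {v : 'I_n'.+1 | (M < v)%N}) : {set F} * (F -> nat) :=
  ([set x0], fun=> val (val v)).
exists {v : 'I_n'.+1 | (M < v)%N}, P; split.
- split.
    move=> v; split => /=.
    + by move=> x y; rewrite !inE => /eqP -> /eqP ->.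
    + by move=> x _; apply: leq_ltn_trans (valP v).
    + by move=> x; rewrite inE => /eqP ->; rewrite x0A.
    + by move=> x y; rewrite inE => /eqP -> _; rewrite (negPf (iso y)).
  by move=> v w x y vw _ _; apply: contra vw => /eqP/val_inj/val_inj ->.
- by move=> v x _; apply: (valP v).
- have h2 : M%:R <= (1 - l) * n'%:R.
    have : M%:R <= (1 - l) * n%:R by rewrite mulrC -ler_pdivrMr; lra.
    by move/le_trans; apply; rewrite ler_wpM2l ?ler_nat ?leq_maxl//; lra.
  have h1 : (n' <= M + count (covered P) (iota 1 n'))%N.
    apply: leq_trans (count_above M n') _; rewrite leq_add2l -!size_filter.
    apply: uniq_leq_size; first by rewrite filter_uniq// iota_uniq.
    move=> v; rewrite !mem_filter => /andP[Mv vio]; rewrite vio andbT.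
    move: vio; rewrite mem_iota add1n ltnS => /andP[_ vn].
    apply/existsP; exists (Sub (Ordinal (vn : (v < n'.+1)%N)) Mv).
    by apply/existsP; exists x0; rewrite /= inE !eqxx.
  by move: h1; rewrite -(ler_nat R) natrD; lra.
Qed.

Lemma ramsey_density_eq (H : graph) (x : R) :
  (forall l, (forall c, symmetric c -> exists H', [/\ monochromatic c H', isomorphic H H' &
     (l%:E <= upper_density R (svertex H'))%E]) -> l <= x) ->
  (forall l, l < x -> forall c, symmetric c ->
     exists H', [/\ monochromatic c H', isomorphic H H' &
       (l%:E <= upper_density R (svertex H'))%E]) ->
  ramsey_density R H = x%:E.
Proof.
move=> ub lb; apply/eqP; rewrite eq_le; apply/andP; split.
  by apply: ge_ereal_sup => _ [l /= /ub lx <-]; rewrite lee_fin.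
apply/lee_subgt0Pr => e e0; apply: ereal_sup_ubound; exists (x - e) => //=.
by apply: lb; lra.
Qed.

Theorem ramsey_density_omega (F : fin_graph) : (0 < #|F|)%N -> bipartite F ->
  ramsey_density R (omega F) = (ramsey_f (min_ratio F R))%:E.
Proof.
move=> F0 [A0 [indA0 indA0c]].
have [I0 [I0n indI0 -> minI]] := min_ratio_attained R F0.
set lam := _ / _ in minI *.
have I0c : 0 < #|I0|%:R :> R by rewrite ltr0n card_gt0.
have [|A [I [indA indAc IA In eqI]]] := one_sided_minimizer indA0 indA0c I0n indI0 _ minI.
  by rewrite /lam divfK// gt_eqF.
have Ic : (0 < #|I|)%N by rewrite card_gt0.
have IR : 0 < #|I|%:R :> R by rewrite ltr0n.
have lamE : lam = #|neighborhood I|%:R / #|I|%:R by rewrite eqI mulfK// gt_eqF.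
have lam_ge0 : 0 <= lam by rewrite lamE divr_ge0.
have [lam0|lam_neq0] := eqVneq lam 0.
  rewrite lam0 /= eqxx; apply: ramsey_density_eq => l.
    move=> /(_ (fun _ _ => true)) [//|H' [_ _ h]].
    rewrite -lee_fin; apply: (le_trans h).
    apply: (@upper_density_le _ _ _ 0 0) => n _; rewrite mul1r addr0 ler_nat.
    by rewrite -[leqRHS](size_iota 1) count_size.
  have [x0 x0I] : exists x0, x0 \in I by apply/finset.set0Pn.
  have x0A := fintype.subsetP IA _ x0I.
  apply: (isolated_lower indA indAc x0A) => y; apply/negP => xy.
  have : (#|neighborhood I| == 0)%N.
    by rewrite -(eqr_nat R) eqI lam0 mul0r.
  rewrite cards_eq0 => /eqP/finset.setP/(_ y); rewrite !inE => /negP; apply.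
  have := sides indA indAc xy; rewrite x0A => /esym yA; rewrite (contra _ yA).
    by apply/bigcupP; exists x0; rewrite // inE.
  exact: (fintype.subsetP IA).
have lam0 : 0 < lam by rewrite lt_neqAle eq_sym lam_neq0.
have D2 := walk_rate_ge2 lam0.
rewrite ramsey_fE//; apply: ramsey_density_eq => l; last first.
  rewrite lamE => lD; apply: (lower_bound indA indAc IA Ic _ lD).
  by rewrite lt0n; apply: contra lam_neq0 => /eqP N0; rewrite lamE N0 mul0r.
move=> Hl; rewrite leNgt; apply/negP => lD.
(* An upper bound below l from a walk of rate close to D. *)
have [S [DS Sl]] : exists S, walk_rate lam < S /\ 1 - S^-1 < l.
  have [l1|l1] := leP 1 l.
    exists (walk_rate lam + 1); split; first lra.
    have : 0 < (walk_rate lam + 1)^-1 by rewrite invr_gt0; lra.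
    by lra.
  have dl : walk_rate lam < (1 - l)^-1.
    by rewrite -[ltLHS]invrK ltf_pV2 ?posrE ?invr_gt0; lra.
  exists ((walk_rate lam + (1 - l)^-1) / 2); split; first lra.
  have : 1 - l < ((walk_rate lam + (1 - l)^-1) / 2)^-1.
    by rewrite -[ltLHS]invrK ltf_pV2 ?posrE ?invr_gt0; lra.
  by lra.
have [al [si [u0 [h0 hm dich bnd]]]] := offsets lam0 DS.
pose off (i : bool) (s : nat) := if i then al s%:R else si s%:R.
have [s0 s00 hs0] := nat_above u0.
have [||||c csym cH] := @upper_coloring R off lam S s0 lam0.
- by move=> i s; have [a b] := h0 s%:R (ler0n _ _); case: i.
- move=> i s t st; have st' : s%:R <= t%:R :> R by rewrite ler_nat.
  by have [a b] := hm s%:R t%:R (ler0n _ _) st'; case: i.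
- move=> i s t; case: i; rewrite /off /=; first exact: dich.
  by have [h|h] := dich t%:R s%:R (ler0n _ _) (ler0n _ _); [right|left].
- move=> s s0s; rewrite /off; apply: bnd; apply: (le_trans hs0).
  by rewrite ler_nat.
have [H' [mono iso dens]] := Hl c csym.
have := le_trans dens (cH F H' minI mono iso).
by rewrite lee_fin; lra.
Qed.

End RamseyDensity.

(** * Complete bipartite graphs *)

Section CompleteBipartiteRatio.
Local Open Scope set_scope.
Variables (a b : nat).

Let lefts : {set Kbip a b} := [set inl x | x in 'I_a].
Let rights : {set Kbip a b} := [set inr x | x in 'I_b].

Lemma card_lefts : #|lefts| = a.
Proof. by rewrite card_imset ?card_ord// => x y []. Qed.

Lemma card_rights : #|rights| = b.
Proof. by rewrite card_imset ?card_ord// => x y []. Qed.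

Lemma Kbip_bipartite : bipartite (Kbip a b).
Proof.
exists lefts; split; apply/forall_inP => u uA; apply/forall_inP => v vA.
  by case/imsetP: uA => x _ ->; case/imsetP: vA => y _ ->.
move: uA vA; rewrite !inE; case: u => x; first by rewrite imset_f.
by case: v => y //; rewrite imset_f.
Qed.

(** An independent set lies in one part and its neighborhood is the other part. *)
Lemma Kbip_independent (I : {set Kbip a b}) : I != finset.set0 -> independent I ->
  (#|I| <= a /\ b <= #|neighborhood I|)%N \/ (#|I| <= b /\ a <= #|neighborhood I|)%N.
Proof.
move=> /finset.set0Pn[x xI] /forall_inP ind.
case: x xI => x xI; [left|right].
  have Il : I \subset lefts.
    apply/fintype.subsetP => -[y|y] yI; first by rewrite imset_f.
    by have /forall_inP/(_ _ yI) := ind _ xI.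
  split; first by have := subset_leq_card Il; rewrite card_lefts.
  apply: leq_trans (_ : #|rights| <= _)%N; first by rewrite card_rights.
  apply: subset_leq_card; apply/fintype.subsetP => v vr.
  rewrite inE; apply/andP; split.
    by apply/negP => /(fintype.subsetP Il)/imsetP[y _ e]; case/imsetP: vr => z _; rewrite e.
  by apply/bigcupP; exists (inl x) => //; rewrite inE; case/imsetP: vr => z _ ->.
have Il : I \subset rights.
  apply/fintype.subsetP => -[y|y] yI; last by rewrite imset_f.
  by have /forall_inP/(_ _ yI) := ind _ xI.
split; first by have := subset_leq_card Il; rewrite card_rights.
apply: leq_trans (_ : #|lefts| <= _)%N; first by rewrite card_lefts.
apply: subset_leq_card; apply/fintype.subsetP => v vr.
rewrite inE; apply/andP; split.
  by apply/negP => /(fintype.subsetP Il)/imsetP[y _ e]; case/imsetP: vr => z _; rewrite e.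
by apply/bigcupP; exists (inr x) => //; rewrite inE; case/imsetP: vr => z _ ->.
Qed.

Lemma Kbip_min_ratio (R : realType) : (0 < a)%N -> (a <= b)%N ->
  min_ratio (Kbip a b) R = (a%:R / b%:R)%:E.
Proof.
move=> a0 ab; have b0 : (0 < b)%N := leq_trans a0 ab.
have [|I [I0 indI -> minI]] := @min_ratio_attained R (Kbip a b).
  by rewrite card_sum !card_ord addn_gt0 a0.
have [aR bR] : 0 < a%:R :> R /\ 0 < b%:R :> R by rewrite !ltr0n.
have IR : 0 < #|I|%:R :> R by rewrite ltr0n card_gt0.
congr EFin; apply/eqP; rewrite eq_le; apply/andP; split.
  have indr : independent rights.
    apply/forall_inP => u /imsetP[x _ ->]; apply/forall_inP => v /imsetP[y _ ->].
    by [].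
  have := minI rights indr; rewrite card_rights ler_pdivlMr// => h; apply: (le_trans h).
  rewrite ler_nat; apply: leq_trans (_ : _ <= #|lefts|)%N _; last by rewrite card_lefts.
  apply: subset_leq_card; apply/fintype.subsetP => v.
  rewrite inE => /andP[vr _]; case: v vr => x; first by rewrite imset_f.
  by rewrite imset_f.
rewrite ler_pdivrMr// mulrAC ler_pdivlMr// -!natrM ler_nat.
have [[Ia bN]|[Ib aN]] := Kbip_independent I0 indI.
  by rewrite (leq_trans (leq_mul ab Ia))// mulnC (leq_trans _ (leq_mul bN ab))// mulnC.
by rewrite leq_mul.
Qed.

End CompleteBipartiteRatio.

Theorem corollary7 (R : realType) :
  (forall F : fin_graph, (0 < #|F|)%N -> bipartite F ->
     ramsey_density R (omega F) = (ramsey_f (min_ratio F R))%:E) /\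
  (forall a b : nat, (1 <= a)%N -> (a <= b)%N ->
     let q : R := a%:R / b%:R in
     ramsey_density R (omega (Kbip a b)) = (ramsey_f q%:E)%:E /\
     ramsey_f q%:E =
       (2 * q ^+ 2 + 3 * q + 7 + 2 * Num.sqrt (q + 1))
       / (4 * q ^+ 2 + 4 * q + 9)).
Proof.
split; first exact: ramsey_density_omega.
move=> a b a1 ab q.
have b0 : (0 < b)%N := leq_trans a1 ab.
have q0 : 0 < q by rewrite divr_gt0 ?ltr0n.
have q1 : q <= 1 by rewrite ler_pdivrMr ?ltr0n// mul1r ler_nat.
split; last exact: ramsey_f_closed.
rewrite ramsey_density_omega ?Kbip_min_ratio//; last exact: Kbip_bipartite.
by rewrite card_sum !card_ord addn_gt0 a1.
Qed.
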